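(* Let $n\in\mathbb{N}$ and let $M$ be a conical Minkowski spacetime in $\mathbb{L}^{n+1}$. Every achronal Lipschitz hypersurface $S$ of $M$ with $V(C(S))<\infty$ and $\mu(\pi(S))<\infty$ satisfies \[ \delta_{CM}(S)=\frac{1+\delta_{BE}(S)}{(1-(n+1)\mathcal{E}(S))^{\frac1{n+1}}}-1\ \ge\ \mathcal{E}(S)+(1+\mathcal{E}(S))\,\delta_{BE}(S). \]
   Context: $\mathbb{L}^{n+1}$ is $(n+1)$-dimensional Minkowski space with inner product $\langle\cdot,\cdot\rangle$ of signature $(-,+,\dots,+)$ and $|v|=\sqrt{|\langle v,v\rangle|}$. A vector $v$ is spacelike if $\langle v,v\rangle>0$, causal if it is not spacelike, timelike if $\langle v,v\rangle<0$. Fix a timelike vector $v_0$; a causal vector $v$ is future-directed if $\langle v,v_0\rangle<0$. $I^+(O)$ is the set of future-directed timelike vectors. $\mathbb{R}_+=(0,\infty)$. $\mathbb{H}^n=\{v\in I^+(O):\langle v,v\rangle=-1\}$ carries the induced Riemannian metric (hyperbolic space), with Riemannian measure $\mu$. $\pi:I^+(O)\to\mathbb{H}^n$, $\pi(v)=v/|v|$. $V$ is the Lebesgue measure on $\mathbb{L}^{n+1}$ normalized by an orthonormal basis. A domain in $\mathbb{H}^n$ is a nonempty $n$-dimensional $C^{0,1}$-submanifold of $\mathbb{H}^n$ with boundary (not necessarily connected). A conical Minkowski spacetime is a cone $M=\mathbb{R}_+\Omega$ for a domain $\Omega\subset\mathbb{H}^n$. A timelike curve is a locally Lipschitz curve,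 defined on an interval, whose derivative is almost everywhere timelike, and (after possibly reversing the parametrization) almost everywhere future-directed. A subset of $M$ is achronal if every timelike curve contained in $M$ meets it at most once. A Lipschitz hypersurface of $M$ is a nonempty codimension one $C^{0,1}$-submanifold of $M$ with boundary. Achronal Lipschitz hypersurfaces are non-timelike (almost every tangent space contains no timelike vector); the area measure $\mu_S$ of such an $S$ is given in local Lipschitz parametrizations $F$ by $\sqrt{\det(\langle\partial_jF,\partial_kF\rangle)_{j,k}}\,dx$, and $A(S)=\mu_S(S)$. For $S\subset I^+(O)$: $C(S)=\{tv:t\in(0,1],v\in S\}$, $\inf|S|=\inf_{v\in S}|v|$, $B_t(\mathbb{R}_+S)=\{v\in\mathbb{R}_+S:|v|<t\}$. Define \[ \delta_{BE}(S)=(n+1)V(C(\pi(S)))^{\frac1{n+1}}\frac{V(C(S))^{\frac n{n+1}}}{A(S)}-1,\qquad \delta_{CM}(S)=(n+1)\frac{V(C(S))}{A(S)\cdot\inf|S|}-1, \] and the relative volume excess \[ \mathcal{E}(S)=\frac1{n+1}\,\frac{V(C(S))-V(B_{\inf|S|}(\mathbb{R}_+S))}{V(C(S))}, \] which satisfies $(n+1)\mathcal{E}(S)\in[0,1]$. Quotients with positive numerator and vanishing denominator are $+\infty$. *)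

(* Defs.v *)
From HB Require Import structures.
From mathcomp Require Import all_boot all_order all_algebra.
From mathcomp Require Import all_classical all_reals all_analysis.

Set Implicit Arguments.
Unset Strict Implicit.
Unset Printing Implicit Defensive.

Import Order.TTheory GRing.Theory Num.Theory.
Import numFieldNormedType.Exports.

Local Open Scope classical_set_scope.
Local Open Scope ring_scope.

Lemma countType_bigcup_measurable d (T : measurableType d) (I : countType)
    (P : set I) (F : I -> set T) :
  (forall i, measurable (F i)) -> measurable (\bigcup_(i in P) F i).
Proof.
move=> mF.
rewrite (_ : \bigcup_(i in P) F i = \bigcup_k
    (if unpickle k is Some i then if i \in P then F i else set0 else set0)).
  by apply: bigcupT_measurable => k; case: unpickle => // i; case: ifP.
apply/seteqP; split => [z [i Pi iz]|z [k _]].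
  by exists (pickle i) => //; rewrite pickleK mem_set.
by case: unpickle => // i; case: ifPn => // /set_mem Pi iz; exists i.
Qed.

Section lebesgue_rV.
Variable R : realType.

Definition borel_rV (n : nat) : Type := g_sigma_algebraType (@open 'rV[R]_n).

HB.instance Definition _ n :=
  Measurable.copy (borel_rV n) (g_sigma_algebraType (@open 'rV[R]_n)).

Definition cons_rV n (z : measurableTypeR R * borel_rV n) : borel_rV n.+1 :=
  row_mx (const_mx z.1 : 'rV[R]_1) (z.2 : 'rV[R]_n).

Lemma measurable_cons_rV n : measurable_fun [set: _] (@cons_rV n).
Proof.
apply: (@measurability _ _ (measurableTypeR R * borel_rV n)%type (borel_rV n.+1)
  setT (@cons_rV n) (@open ('rV[R]_n.+1)) erefl).
move=> _ [W oW <-].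
rewrite setTI.
pose I := ((rat * rat) * {ffun 'I_n -> rat * rat})%type : countType.
pose box (p : I) : set (measurableTypeR R * borel_rV n) :=
  `]ratr p.1.1, ratr p.1.2[%classic `*`
  [set v : 'rV[R]_n | forall i, v 0 i \in `]ratr (p.2 i).1, ratr (p.2 i).2[].
have -> : @cons_rV n @^-1` W =
    \bigcup_(p in [set p | box p `<=` @cons_rV n @^-1` W]) box p.
  apply/seteqP; split; last by move=> z [p] /= sub; exact: sub.
  move=> [x v] /= Oxv.
  have : nbhs (@cons_rV n (x, v) : 'rV[R]_n.+1) W by exact: open_nbhs_nbhs.
  move=> /nbhs_ballP[e /= e0 eO].
  have H (y : R) : exists q : rat * rat, [/\ ratr q.1 < y, y < ratr q.2,
      y - e < ratr q.1 & ratr q.2 < y + e].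
    have [//|a] := @rat_in_itvoo R (y - e) y; first by rewrite ltrBlDr ltrDl.
    have [//|b] := @rat_in_itvoo R y (y + e); first by rewrite ltrDl.
    by rewrite !in_itv /= => /andP[b1 b2] /andP[a1 a2]; exists (a, b).
  have [qx [x1 x2 x3 x4]] := H x.
  have [f fP] := choice (fun i : 'I_n => H (v 0 i)).
  exists (qx, [ffun i => f i]).
    move=> [x' v'] /= [x'q v'q]; apply: eO.
    rewrite /ball /= /mx_ball; split=> // i j; rewrite (ord1 i) /cons_rV !mxE.
    case: splitP => k _; rewrite ?mxE /ball /= ltr_distlC.
      move: x'q; rewrite /= in_itv /= => /andP[? ?].
      by rewrite (lt_trans x3)//= (lt_trans _ x4).
    have [? ? f3 f4] := fP k.
    move: (v'q k); rewrite ffunE in_itv /= => /andP[? ?].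
    by rewrite (lt_trans f3)//= (lt_trans _ f4).
  split; first by rewrite /= in_itv /= x1.
  by move=> i /=; rewrite ffunE in_itv /=; have [-> -> _ _] := fP i.
apply: countType_bigcup_measurable => p.
apply: measurableX; first exact: measurable_itv.
apply: sub_sigma_algebra; rewrite /= openE => v /= vp.
rewrite /interior /=.
exists (fun _ i => `]ratr (p.2 i).1, ratr (p.2 i).2[%classic).
  by move=> i j; rewrite (ord1 i); apply: open_nbhs_nbhs; split;
    [exact: interval_open|exact: vp].
by move=> w /= wp i; exact: wp.
Qed.

Definition pushforward_measure d1 d2 (T1 : measurableType d1)
    (T2 : measurableType d2) (m : {measure set T1 -> \bar R}) (f : T1 -> T2)
    (mf : measurable_fun [set: T1] f) : {measure set T2 -> \bar R} :=
  measure_function_pushforward__canonical__measure_function_Measure m mf.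

(* Iterated product of the one-dimensional Lebesgue measure, the first
   coordinate being split off. *)
Fixpoint lebesgue_rV (n : nat) : {measure set (borel_rV n) -> \bar R} :=
  match n with
  | 0 => \d_((0 : 'rV[R]_0) : borel_rV 0)
  | m.+1 => pushforward_measure
             ((@lebesgue_measure R) \x^ (lebesgue_rV m))%E (@measurable_cons_rV m)
  end.

End lebesgue_rV.

Section minkowski.
Variables (R : realType) (n : nat).
Notation L := 'rV[R]_n.+1.
Implicit Types (u v : L) (S X M Omega : set L).

(* Coordinate 0 is the time coordinate. *)
Definition mink u v : R :=
  - (u 0 0 * v 0 0) + \sum_(i < n) u 0 (lift ord0 i) * v 0 (lift ord0 i).

Definition mnorm v : R := Num.sqrt `|mink v v|.

Definition spacelike v := 0 < mink v v.
Definition causal v := ~ spacelike v.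
Definition timelike v := mink v v < 0.
Definition future_directed (v0 : L) v := causal v /\ mink v v0 < 0.

Definition chronological_future (v0 : L) : set L :=
  [set v | timelike v /\ future_directed v0 v].

Definition hyperbolic_space (v0 : L) : set L :=
  [set v | chronological_future v0 v /\ mink v v = -1].

Definition hproj v : L := (mnorm v)^-1 *: v.

Definition Rplus_cone X : set L :=
  [set w | exists t v, [/\ 0 < t, X v & w = t *: v]].

Definition truncated_cone S : set L :=
  [set w | exists t v, [/\ 0 < t, t <= 1, S v & w = t *: v]].

Definition cone_ball (t : R) S : set L :=
  [set v | Rplus_cone S v /\ mnorm v < t].

Definition inf_mnorm S : R := inf [set mnorm v | v in S].

Definition volume X : \bar R := lebesgue_rV R n.+1 X.

(* Closed half-space of R^k; it is all of R^k when k = 0. *)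
Definition halfspace (k : nat) : set 'rV[R]_k :=
  [set x | forall i : 'I_k, i = 0%N :> nat -> 0 <= x 0 i].

Definition halfspace_open (k : nat) (U : set 'rV[R]_k) :=
  exists2 W : set 'rV[R]_k, open W & U = W `&` @halfspace k.

(* k-dimensional C^{0,1}-submanifolds with boundary: locally (in the induced
   topology) bi-Lipschitz images of relatively open subsets of a half-space.
   All Lipschitz conditions are with respect to the norm of the coordinate
   space, to which the hyperbolic distance is locally bi-Lipschitz
   equivalent. *)
Definition lipschitz_submanifold (k : nat) S :=
  forall p, S p ->
    exists (W : set L) (U : set 'rV[R]_k) (F : 'rV[R]_k -> L) (G : L -> 'rV[R]_k),
    [/\ open W /\ W p, halfspace_open U, F @` U = S `&` W,
        {in U, cancel F G}
      & [lipschitz F x | x in U] /\ [lipschitz G y | y in F @` U]].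

Definition domain (v0 : L) Omega :=
  [/\ Omega !=set0, Omega `<=` hyperbolic_space v0
    & lipschitz_submanifold n Omega].

Definition conical_spacetime (v0 : L) M :=
  exists2 Omega, domain v0 Omega & M = Rplus_cone Omega.

Definition lipschitz_hypersurface M S :=
  [/\ S !=set0, S `<=` M & lipschitz_submanifold n S].

Definition timelike_curve (v0 : L) (I : set R) (c : R -> L) :=
  [/\ is_interval I,
      [locally [lipschitz c t | t in I]],
      {ae @lebesgue_measure R, forall t, I t ->
        derivable c t 1 /\ timelike ('D_1 c t)}
    & {ae @lebesgue_measure R, forall t, I t -> future_directed v0 ('D_1 c t)} \/
      {ae @lebesgue_measure R, forall t, I t -> future_directed v0 (- 'D_1 c t)}].

Definition achronal (v0 : L) M S :=
  forall (I : set R) (c : R -> L), timelike_curve v0 I c ->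
    (forall t, I t -> M (c t)) ->
    forall s t, I s -> I t -> S (c s) -> S (c t) -> s = t.

Definition lipschitz_parametrization S (U : set 'rV[R]_n) (F : 'rV[R]_n -> L) :=
  [/\ halfspace_open U, [locally [lipschitz F x | x in U]],
      {in U &, injective F} & F @` U `<=` S].

(* By Rademacher's theorem the partial derivatives exist almost everywhere on
   the domain of a Lipschitz parametrization. *)
Definition area_density (F : 'rV[R]_n -> L) (x : 'rV[R]_n) : R :=
  Num.sqrt (\det (\matrix_(j < n, k < n)
    mink ('D_(delta_mx 0 j) F x) ('D_(delta_mx 0 k) F x))).

(* m is the Borel measure on S with density area_density in every Lipschitz
   parametrization; since S has a countable atlas, this determines m on Borel
   sets. For S the hyperbolic space it is the Riemannian measure of the metric
   induced by mink. *)
Definition is_area_measure S (m : {measure set (borel_rV R n.+1) -> \bar R}) :=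
  m.-negligible (~` S) /\
  forall (U : set 'rV[R]_n) (F : 'rV[R]_n -> L) (B : set (borel_rV R n)),
    lipschitz_parametrization S U F -> measurable B -> B `<=` U ->
    m (F @` B) = (\int[lebesgue_rV R n]_(x in B) (area_density F x)%:E)%E.

Local Open Scope ereal_scope.

(* In \bar R, x / 0 = +oo for 0 < x. *)
Definition delta_BE (A : set L -> \bar R) S : \bar R :=
  n.+1%:R%:E * volume (truncated_cone (hproj @` S)) `^ (n.+1%:R^-1) *
    (volume (truncated_cone S) `^ (n%:R / n.+1%:R) / A S) - 1.

Definition delta_CM (A : set L -> \bar R) S : \bar R :=
  n.+1%:R%:E * (volume (truncated_cone S) / (A S * (inf_mnorm S)%:E)) - 1.

Definition volume_excess S : \bar R :=
  (n.+1%:R^-1)%:E *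
  ((volume (truncated_cone S) - volume (cone_ball (inf_mnorm S) S)) /
   volume (truncated_cone S)).

End minkowski.

(* Main.v *)
(* Write V, P for the volumes of C(S), C(pi(S)), and A, r for A(S), inf|S|. By
   scaling, the cone ball B_r has volume r^(n+1) P, hence
   1 - (n+1) E(S) = r^(n+1) P / V and the identity becomes arithmetic; the
   inequality is Bernoulli's,
   (1 + E)^(n+1) (1 - (n+1) E) <= ((1 + E) (1 - E))^(n+1) <= 1.
   In the extended reals this arithmetic requires 0 < V, and A < +oo when r = 0,
   since otherwise 0 * +oo = 0 spoils the convention x / 0 = +oo. Both facts
   come from achronality, which makes S locally the graph of a Lipschitz
   function over its projection to the hyperbolic space: a steeper piece of S
   could be joined by a timelike curve. The finiteness of A is then a comparison
   A(D) <= const (mu(pi(D)) + V(C(D))) on small pieces D of S: if |p| is of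
   order c on D, then A(D) <= (4 c)^n mu(pi(D)), and for large c one uses
   c^(n+1) mu(pi(D)) <= const V(C(D)), read off in the Klein model. *)
From HB Require Import structures.
Require Import Defs.
From mathcomp Require Import all_boot all_order all_algebra.
From mathcomp Require Import all_classical all_reals all_analysis.
From mathcomp Require Import ring lra.
Set Implicit Arguments.
Unset Strict Implicit.
Unset Printing Implicit Defensive.
Import Order.TTheory GRing.Theory Num.Theory.
Import numFieldNormedType.Exports.
Local Open Scope classical_set_scope.
Local Open Scope ring_scope.

(** * Lebesgue measure on row vectors *)

(** Heuristically, A(S) is at most the integral of |p|^n over pi(S), and V(C(S)) is that of
    |p|^(n+1) / (n+1); since |p|^n <= 1 + |p|^(n+1), finiteness of mu(pi(S)) and V(C(S)) bounds
    A(S). The area measures, however, are known only on images of Borel sets under Lipschitz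
    parametrizations, and no nonlinear change of variables is used. So the integrals become sums
    over countably many disjoint pieces on which |p| and the time coordinate of pi(p) vary by a
    bounded factor, and the constant must be the same for all pieces. The Klein chart serves because
    the hyperbolic density is explicit in it and because the slices of a cone at a fixed height are
    affine copies of the chart image. Almost everywhere differentiability is needed only for curves,
    to recognise them as timelike: on hypersurfaces the density inequality is pointwise and trivial
    where a partial derivative is missing. Positivity of the volume comes from packing balls.
    Boundary points are treated along with interior ones, by segments and cubes that stay in the
    half-space. *)

Section rV_norm.
Variable R : realType.

Lemma coord_le_norm n (v : 'rV[R]_n) i : `|v 0 i| <= `|v|.
Proof.
rewrite [leRHS]mx_normrE; exact: (le_bigmax _ (fun k : 'I_1 * 'I_n => `|v k.1 k.2|) (0, i)).
Qed.

Lemma norm_rV_le n (v : 'rV[R]_n) e :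
  0 <= e -> (forall i, `|v 0 i| <= e) -> `|v| <= e.
Proof.
move=> e0 ve; rewrite [leLHS]mx_normrE; apply/bigmax_leP; split => //= -[i j] _ /=.
by rewrite (ord1 i).
Qed.

End rV_norm.

Section lebesgue_box.
Variable R : realType.

Definition box n (a b : 'I_n -> R) : set (borel_rV R n) :=
  [set v : 'rV[R]_n | forall i, a i < v 0 i < b i].

Lemma cons_rV0 n (z : measurableTypeR R * borel_rV R n) :
  (cons_rV z : 'rV[R]_n.+1) 0 0 = z.1.
Proof.
rewrite /cons_rV mxE; case: splitP => k; first by rewrite mxE.
by rewrite /= add1n.
Qed.

Lemma cons_rV_lift n (z : measurableTypeR R * borel_rV R n) i :
  (cons_rV z : 'rV[R]_n.+1) 0 (lift 0 i) = (z.2 : 'rV[R]_n) 0 i.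
Proof.
rewrite /cons_rV mxE; case: splitP => k; first by rewrite (ord1 k) /= /bump.
by rewrite /= /bump => -[ik]; congr (z.2 _ _); apply: val_inj.
Qed.

Lemma open_box n (a b : 'I_n -> R) : open (box a b : set 'rV[R]_n).
Proof.
rewrite openE => v vab; exists (fun _ i => `]a i, b i[%classic).
  move=> i j; rewrite (ord1 i); apply: open_nbhs_nbhs; split.
    exact: interval_open.
  by rewrite /= in_itv /= vab.
by move=> w wab i; have := wab 0 i; rewrite /= in_itv.
Qed.

Lemma measurable_open_rV n (W : set 'rV[R]_n) :
  open W -> measurable (W : set (borel_rV R n)).
Proof. by move=> oW; exact: sub_sigma_algebra. Qed.

Lemma measurable_closed_rV n (W : set 'rV[R]_n) :
  closed W -> measurable (W : set (borel_rV R n)).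
Proof.
move=> cW; rewrite -[W]setCK; apply: measurableC; apply: measurable_open_rV.
exact: closed_openC.
Qed.

Lemma lebesgue_rV_box n (a b : 'I_n -> R) :
  lebesgue_rV R n (box a b) = (\prod_(i < n) Num.max (b i - a i) 0)%:E.
Proof.
elim: n a b => [|n IH] a b.
  by rewrite big_ord0 /= diracE mem_set// => -[].
rewrite big_ord_recl EFinM -IH /= /pushforward.
have -> : @cons_rV R n @^-1` box a b =
    `]a 0, b 0[%classic `*` box (a \o lift 0) (b \o lift 0).
  apply/seteqP; split => [z zab|z [/= z1 z2] i].
    split=> /=; first by have := zab 0; rewrite cons_rV0 in_itv.
    by move=> i; have := zab (lift 0 i); rewrite cons_rV_lift.
  have [j ->|->] := unliftP 0 i; first by rewrite cons_rV_lift; exact: z2.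
  by rewrite cons_rV0; rewrite in_itv /= in z1.
rewrite product_measure2E//; last by apply: measurable_open_rV; exact: open_box.
congr (_ * _)%E; apply: etrans (lebesgue_measure_itv `]a 0, b 0[) _.
rewrite /= lte_fin.
case: ltP => ab; first by rewrite max_l ?subr_ge0 ?ltW// EFinB.
by rewrite max_r// subr_le0.
Qed.

Lemma ball_box n (v : 'rV[R]_n) (e : R) :
  0 < e -> ball v e = box (fun i => v 0 i - e) (fun i => v 0 i + e).
Proof.
move=> e0; apply/seteqP; split => w.
  by move=> [_ vw] i; have := vw 0 i; rewrite /ball /= ltr_distlC.
move=> vw; split=> // i j; rewrite (ord1 i).
by have := vw j; rewrite /ball /= ltr_distlC.
Qed.

Lemma lebesgue_rV_ball n (v : 'rV[R]_n) (e : R) :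
  0 < e -> lebesgue_rV R n (ball v e) = ((e *+ 2) ^+ n)%:E.
Proof.
move=> e0; rewrite ball_box// lebesgue_rV_box; congr EFin.
under eq_bigr => i _.
  have -> : v 0 i + e - (v 0 i - e) = e *+ 2 by rewrite mulr2n; ring.
  rewrite max_l ?mulrn_wge0 ?ltW//; over.
by rewrite prodr_const card_ord.
Qed.

Lemma bigcup_ball_nat n : \bigcup_k ball (0 : 'rV[R]_n) k.+1%:R = setT.
Proof.
apply/seteqP; split => // v _; exists (Num.truncn `|v|) => //.
rewrite -ball_normE /= sub0r normrN.
by have /andP[] := Num.Theory.truncn_itv (normr_ge0 v).
Qed.

Lemma lebesgue_rV_sigma_finite n : sigma_finite [set: borel_rV R n] (lebesgue_rV R n).
Proof.
exists (fun k => ball (0 : 'rV[R]_n) k.+1%:R); first by rewrite bigcup_ball_nat.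
move=> k; split; first by apply: measurable_open_rV; exact: ball_open.
by rewrite lebesgue_rV_ball ?ltr0n// ltry.
Qed.

(* The fixpoint [lebesgue_rV] cannot be the key of a canonical instance. *)
Definition lebesgue_rV_fun n : set (borel_rV R n) -> \bar R := lebesgue_rV R n.

HB.instance Definition _ n := isMeasure.Build _ _ _ (@lebesgue_rV_fun n)
  (measure0 (lebesgue_rV R n)) (measure_ge0 (lebesgue_rV R n))
  (@measure_semi_sigma_additive _ _ _ (lebesgue_rV R n)).

HB.instance Definition _ n := @Measure_isSigmaFinite.Build _ _ _
  (@lebesgue_rV_fun n) (@lebesgue_rV_sigma_finite n).

(** The product [\x^] in the definition of [lebesgue_rV] integrates over the second factor;
    uniqueness of the product measure exchanges the order, so that slices are taken at a fixed time
    coordinate. *)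
Lemma lebesgue_rV_xsection n (X : set (borel_rV R n.+1)) : measurable X ->
  lebesgue_rV R n.+1 X = (\int[lebesgue_measure]_t
    lebesgue_rV R n [set v | X (cons_rV ((t : measurableTypeR R), (v : borel_rV R n)))])%E.
Proof.
move=> mX.
have mX' : measurable (@cons_rV R n @^-1` X).
  by rewrite -[X in measurable X]setTI; exact: measurable_cons_rV.
apply: etrans (esym (@product_measure_unique _ _ _ _ R lebesgue_measure
  (@lebesgue_rV_fun n) (lebesgue_measure \x^ lebesgue_rV R n)%E _ _ mX')) _.
  by move=> A B mA mB; exact: product_measure2E.
rewrite /product_measure1; apply: eq_integral => t _ /=.
congr (lebesgue_rV R n _); apply/seteqP; split => v /=; rewrite /xsection /=.
  by move/set_mem.
by move=> ?; apply/mem_set.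
Qed.

Lemma open_rV_bigcup_box n (W : set 'rV[R]_n) : open W ->
  W = \bigcup_(p in [set p : {ffun 'I_n -> rat * rat} |
       box (fun i => ratr (p i).1) (fun i => ratr (p i).2) `<=` W])
       (box (fun i => ratr (p i).1 : R) (fun i => ratr (p i).2 : R)).
Proof.
move=> oW; apply/seteqP; split; last by move=> z [p] /= sub; exact: sub.
move=> v Wv.
have : nbhs v W by exact: open_nbhs_nbhs.
move=> /nbhs_ballP[e /= e0 eO].
have H (y : R) : exists q : rat * rat, [/\ ratr q.1 < y, y < ratr q.2,
    y - e < ratr q.1 & ratr q.2 < y + e].
  have [//|a] := @rat_in_itvoo R (y - e) y; first by rewrite ltrBlDr ltrDl.
  have [//|b] := @rat_in_itvoo R y (y + e); first by rewrite ltrDl.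
  by rewrite !in_itv /= => /andP[b1 b2] /andP[a1 a2]; exists (a, b).
have [f fP] := choice (fun i : 'I_n => H (v 0 i)).
exists [ffun i => f i]; last first.
  by move=> i; rewrite !ffunE; have [-> -> _ _] := fP i.
move=> w wb; apply: eO; rewrite ball_box// => i.
have := wb i; rewrite !ffunE => /andP[w1 w2]; have [_ _ f3 f4] := fP i.
by rewrite (lt_trans f3)// (lt_trans w2).
Qed.

(** A generating pi-system. Real endpoints, unlike rational ones, make it stable under preimages by
    invertible affine maps. *)
Definition boxes n : set (set (borel_rV R n)) :=
  [set box p.1 p.2 | p in [set: ('I_n -> R) * ('I_n -> R)]].

Lemma borel_rV_boxes n : @measurable _ (borel_rV R n) = <<s @boxes n >>.
Proof.
apply/seteqP; split.
  apply: smallest_sub; first exact: smallest_sigma_algebra.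
  move=> W oW; rewrite (open_rV_bigcup_box oW).
  pose T := g_sigma_algebraType (@boxes n).
  apply: (@countType_bigcup_measurable _ T) => p.
  by apply: sub_sigma_algebra; exists (fun i => ratr (p i).1, fun i => ratr (p i).2).
apply: smallest_sub; first exact: sigma_algebra_measurable.
by move=> _ [[a b] _ <-]; apply: measurable_open_rV; exact: open_box.
Qed.

Lemma setI_closed_boxes n : setI_closed (@boxes n).
Proof.
move=> _ _ [[a b] _ <-] [[c d] _ <-].
exists (fun i => Num.max (a i) (c i), fun i => Num.min (b i) (d i)) => //=.
apply/seteqP; split => v /=.
  by move=> H; split=> i; have := H i;
    rewrite gt_max lt_min => /andP[/andP[? ?] /andP[? ?]]; apply/andP.
by move=> [H1 H2] i; have /andP[? ?] := H1 i; have /andP[? ?] := H2 i;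
  rewrite gt_max lt_min; apply/andP; split; apply/andP.
Qed.

Lemma measurable_continuous_rV n m (f : 'rV[R]_n -> 'rV[R]_m) (A : set (borel_rV R n)) :
  measurable A -> {within (A : set 'rV[R]_n), continuous f} ->
  measurable_fun A (f : borel_rV R n -> borel_rV R m).
Proof.
move=> mA cf; apply: (@measurability _ _ (borel_rV R n) (borel_rV R m) A f (@open 'rV[R]_m) erefl).
move=> _ [W oW <-].
have /continuousP cf' := cf.
have /open_subspaceP [V oV VW] := cf' _ oW.
rewrite setIC -VW; apply: measurableI => //.
exact: measurable_open_rV.
Qed.

Lemma continuous_affine (V : normedModType R) (c : R) (b : V) :
  continuous (fun x : V => c *: x + b).
Proof. by move=> x; apply: cvgD; [exact: scaler_continuous|exact: cvg_cst]. Qed.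

Lemma measurable_affine_rV n (c : R) (b : 'rV[R]_n) :
  measurable_fun setT ((fun x : 'rV[R]_n => c *: x + b) : borel_rV R n -> borel_rV R n).
Proof.
apply: measurable_continuous_rV; first exact: measurableT.
by apply: continuous_subspaceT; exact: continuous_affine.
Qed.

Lemma affine_itvoo (c b p q v : R) : c != 0 -> p < q ->
  (p < c * v + b < q) =
  (Num.min ((p - b) / c) ((q - b) / c) < v < Num.max ((p - b) / c) ((q - b) / c)).
Proof.
move=> c0 pq; rewrite -ltrBlDr [X in _ && X]( _ : _ = (c * v < q - b)); last by rewrite ltrBrDr.
have : p - b < q - b by rewrite ltrD2r.
move: (p - b) (q - b) => p1 q1 pq1.
have [c1|c1] := boolP (c < 0).
  have pqc : q1 / c < p1 / c by rewrite ltr_nM2r ?invr_lt0.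
  rewrite (min_r (ltW pqc)) (max_l (ltW pqc)) ltr_ndivrMr// ltr_ndivlMr//.
  by rewrite andbC [c * v]mulrC.
have {}c1 : 0 < c by rewrite lt_def c0 leNgt.
have pqc : p1 / c < q1 / c by rewrite ltr_pM2r ?invr_gt0.
rewrite (min_l (ltW pqc)) (max_r (ltW pqc)) ltr_pdivrMr// ltr_pdivlMr//.
by rewrite [c * v]mulrC.
Qed.

Lemma affine_itvoo_length (c b p q : R) : c != 0 -> p < q ->
  Num.max (q - p) 0 = `|c| * Num.max (Num.max ((p - b) / c) ((q - b) / c) -
     Num.min ((p - b) / c) ((q - b) / c)) 0.
Proof.
move=> c0 pq; rewrite max_l ?subr_ge0 ?ltW//.
have -> : q - p = (q - b) - (p - b) by ring.
have : p - b < q - b by rewrite ltrD2r.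
move: (p - b) (q - b) => p1 q1 pq1.
have [c1|c1] := boolP (c < 0).
  have pqc : q1 / c < p1 / c by rewrite ltr_nM2r ?invr_lt0.
  rewrite (min_r (ltW pqc)) (max_l (ltW pqc)) max_l ?subr_ge0 ?ltW// ltr0_norm//.
  by field.
have {}c1 : 0 < c by rewrite lt_def c0 leNgt.
have pqc : p1 / c < q1 / c by rewrite ltr_pM2r ?invr_gt0.
rewrite (min_l (ltW pqc)) (max_r (ltW pqc)) max_l ?subr_ge0 ?ltW// gtr0_norm//.
by field.
Qed.

(** Both sides are measures in [X] that agree on boxes. Negative [c] occurs below as the inverse of
    a height whose sign is that of the time coordinate of [v0]. *)
Lemma lebesgue_rV_affine n (c : R) (b : 'rV[R]_n) (X : set (borel_rV R n)) :
  c != 0 -> measurable X ->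
  lebesgue_rV R n X =
  ((`|c| ^+ n)%:E * lebesgue_rV R n [set x : 'rV[R]_n | X (c *: x + b)%R])%E.
Proof.
move=> c0 mX.
have c0' : 0 <= `|c| ^+ n by exact: exprn_ge0.
pose m := mscale (NngNum c0') (pushforward_measure (lebesgue_rV R n) (measurable_affine_rV c b)).
apply: (@measure_unique _ _ _ (@boxes n) (fun k => ball (0 : 'rV[R]_n) k.+1%:R) _ _ _ _
  (lebesgue_rV R n) m) => //.
- exact: borel_rV_boxes.
- exact: setI_closed_boxes.
- by move=> k; exists (fun i => 0 - k.+1%:R, fun i => 0 + k.+1%:R) => //=;
   rewrite ball_box//; congr box; apply/funext => i; rewrite mxE.
- exact: bigcup_ball_nat.
- move=> _ [[p q] _ <-] /=; rewrite /m /mscale /= /pushforward.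
  pose p' i := Num.min ((p i - b 0 i) / c) ((q i - b 0 i) / c).
  pose q' i := Num.max ((p i - b 0 i) / c) ((q i - b 0 i) / c).
  have [pq|] := pselect (forall i, p i < q i); last first.
    move=> /existsNP[i /negP]; rewrite -leNgt => qp.
    have -> : box p q = set0.
      apply/seteqP; split => // v /(_ i) /andP[pv vq].
      by have := lt_le_trans (lt_trans pv vq) qp; rewrite ltxx.
    by rewrite preimage_set0 !measure0 mule0.
  have -> : (fun x : 'rV[R]_n => c *: x + b) @^-1` box p q = box p' q'.
    by apply/seteqP; split => v /= + i => /(_ i); rewrite !mxE affine_itvoo.
  rewrite !lebesgue_rV_box -EFinM; congr EFin.
  have -> : `|c| ^+ n = \prod_(i < n) `|c| by rewrite prodr_const card_ord.
  rewrite -big_split /=; apply: eq_bigr => i _.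
  exact: affine_itvoo_length.
by move=> k; rewrite lebesgue_rV_ball ?ltr0n// ltry.
Qed.
End lebesgue_box.

(** * Minkowski geometry *)

Section minkowski_algebra.
Variables (R : realType) (n : nat).
Notation L := 'rV[R]_n.+1.
Implicit Types u v w p q : L.

Lemma minkC u v : mink u v = mink v u.
Proof. by rewrite /mink mulrC; congr (_ + _); apply: eq_bigr => i _; rewrite mulrC. Qed.

Lemma minkDl u v w : mink (u + v) w = mink u w + mink v w.
Proof.
rewrite /mink mxE mulrDl opprD addrACA -big_split /=; congr (_ + _).
by apply: eq_bigr => i _; rewrite mxE mulrDl.
Qed.

Lemma minkZl c u v : mink (c *: u) v = c * mink u v.
Proof.
rewrite /mink mxE -mulrA mulrDr mulrN mulr_sumr; congr (_ + _).
by apply: eq_bigr => i _; rewrite mxE mulrA.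
Qed.

Lemma minkNl u v : mink (- u) v = - mink u v.
Proof. by rewrite -scaleN1r minkZl mulN1r. Qed.

Lemma minkBl u v w : mink (u - v) w = mink u w - mink v w.
Proof. by rewrite minkDl minkNl. Qed.

Lemma minkDr u v w : mink w (u + v) = mink w u + mink w v.
Proof. by rewrite minkC minkDl !(minkC w). Qed.

Lemma minkZr c u v : mink v (c *: u) = c * mink v u.
Proof. by rewrite minkC minkZl (minkC v). Qed.

Lemma mink_suml (I : Type) (r : seq I) (P : pred I) (F : I -> L) v :
  mink (\sum_(i <- r | P i) F i) v = \sum_(i <- r | P i) mink (F i) v.
Proof.
apply: (big_morph (fun u => mink u v)) => [u w|]; first exact: minkDl.
by rewrite -[0](scale0r 0) minkZl mul0r.
Qed.

Lemma sum_mul_sqr_le (I : finType) (a b : I -> R) :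
  (\sum_i a i * b i) ^+ 2 <= (\sum_i a i ^+ 2) * (\sum_i b i ^+ 2).
Proof.
set A := \sum_i a i ^+ 2; set B := \sum_i b i ^+ 2; set C := \sum_i a i * b i.
have A0 : 0 <= A by apply: sumr_ge0 => i _; exact: sqr_ge0.
have [A00|An0] := eqVneq A 0.
  suff -> : C = 0 by rewrite A00 mul0r expr0n.
  apply: big1 => i _; have /eqP := A00.
  rewrite psumr_eq0; last by move=> j _; exact: sqr_ge0.
  by move/allP => /(_ i (mem_index_enum _)) /=; rewrite sqrf_eq0 => /eqP ->; rewrite mul0r.
have : 0 <= \sum_i (A * b i - C * a i) ^+ 2 by apply: sumr_ge0 => i _; exact: sqr_ge0.
have -> : \sum_i (A * b i - C * a i) ^+ 2 = A * (A * B - C ^+ 2).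
  transitivity (\sum_i (A ^+ 2 * b i ^+ 2 - A * C * 2 * (a i * b i) + C ^+ 2 * a i ^+ 2)).
    by apply: eq_bigr => i _; ring.
  rewrite !big_split /= sumrN -!mulr_sumr -/A -/B -/C; ring.
by rewrite pmulr_rge0 ?lt_def ?An0// subr_ge0.
Qed.

Definition spatial_sqr v : R := \sum_(i < n) v 0 (lift ord0 i) ^+ 2.

Lemma spatial_sqr_ge0 v : 0 <= spatial_sqr v.
Proof. by apply: sumr_ge0 => i _; exact: sqr_ge0. Qed.

Lemma mink_sqr v : mink v v = - v 0 0 ^+ 2 + spatial_sqr v.
Proof. by rewrite /mink -expr2; congr (_ + _); apply: eq_bigr => i _; rewrite -expr2. Qed.

Lemma timelike_sqr v : timelike v -> spatial_sqr v < v 0 0 ^+ 2.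
Proof. by rewrite /timelike mink_sqr addrC subr_lt0. Qed.

Lemma timelike_time_neq0 v : timelike v -> v 0 0 != 0.
Proof.
move/timelike_sqr => h; apply: contraTneq h => ->.
by rewrite expr0n /= -leNgt spatial_sqr_ge0.
Qed.

(** By Cauchy-Schwarz the spatial part of the product is smaller in absolute value than the time
    part. Time orientation thus reduces to the sign of coordinate 0. *)
Lemma mink_timelike_lt0 v w : timelike v -> timelike w ->
  (mink v w < 0) = (0 < v 0 0 * w 0 0).
Proof.
move=> tv tw.
have h : `|\sum_(i < n) v 0 (lift ord0 i) * w 0 (lift ord0 i)| < `|v 0 0 * w 0 0|.
  rewrite -[ltLHS]sqrtr_sqr -[ltRHS]sqrtr_sqr ltr_sqrt; last first.
    by rewrite exprn_even_gt0//= mulf_neq0// timelike_time_neq0.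
  apply: le_lt_trans (sum_mul_sqr_le _ _) _; rewrite exprMn.
  by apply: ltr_pM; rewrite ?spatial_sqr_ge0//; exact: timelike_sqr.
have := mulf_neq0 (timelike_time_neq0 tv) (timelike_time_neq0 tw).
rewrite /mink; move: h; set S := \sum_(i < n) _; set T := _ * _ => h T0.
have [T1|T1] := ltP 0 T.
  by move: h; rewrite (gtr0_norm T1) => /(le_lt_trans (ler_norm _)); lra.
have T2 : T < 0 by rewrite lt_neqAle T0.
by apply/negbTE; rewrite -leNgt; move: h; rewrite (ltr0_norm T2) ltr_norml; lra.
Qed.

Lemma timelike_orthogonal v w : timelike v -> mink v w = 0 -> 0 <= mink w w.
Proof.
move=> tv vw; rewrite mink_sqr addrC subr_ge0.
move: vw => /eqP; rewrite /mink addrC subr_eq0 => /eqP vw.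
have v0 : 0 < v 0 0 ^+ 2 by rewrite exprn_even_gt0//= timelike_time_neq0.
rewrite -(ler_pM2l v0) -exprMn -vw; apply: le_trans (sum_mul_sqr_le _ _) _.
by apply: ler_wpM2r; [exact: spatial_sqr_ge0|exact/ltW/timelike_sqr].
Qed.

Lemma timelikeZ c v : c != 0 -> timelike v -> timelike (c *: v).
Proof.
move=> c0; rewrite /timelike minkZl minkZr mulrA -expr2 => tv.
by rewrite pmulr_rlt0// exprn_even_gt0.
Qed.

Lemma mnorm_sqr v : timelike v -> mnorm v ^+ 2 = - mink v v.
Proof. by move=> tv; rewrite /mnorm sqr_sqrtr// ltr0_norm. Qed.

Lemma mnorm_ge0 v : 0 <= mnorm v.
Proof. exact: sqrtr_ge0. Qed.

Lemma mnorm_gt0 v : timelike v -> 0 < mnorm v.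
Proof. by move=> tv; rewrite /mnorm sqrtr_gt0 normr_gt0 lt_eqF. Qed.

Lemma mnormZ c v : mnorm (c *: v) = `|c| * mnorm v.
Proof.
rewrite /mnorm minkZl minkZr mulrA -expr2 normrM sqrtrM ?normr_ge0//.
by rewrite ger0_norm ?sqr_ge0// sqrtr_sqr.
Qed.

Lemma hprojZ c v : 0 < c -> timelike v -> hproj (c *: v) = hproj v.
Proof.
move=> c0 tv; rewrite /hproj mnormZ gtr0_norm// scalerA; congr (_ *: _).
by field; rewrite !gt_eqF// mnorm_gt0.
Qed.

Lemma mnorm_hproj v : timelike v -> v = mnorm v *: hproj v.
Proof. by move=> tv; rewrite /hproj scalerA divff ?scale1r// gt_eqF// mnorm_gt0. Qed.

Lemma mink_hproj v : timelike v -> mink (hproj v) (hproj v) = -1.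
Proof.
move=> tv; rewrite /hproj minkZl minkZr mulrA -expr2 -[mink v v]opprK -mnorm_sqr//.
by rewrite exprVn mulrN mulVf// expf_neq0// gt_eqF// mnorm_gt0.
Qed.

Lemma hproj_id v : mink v v = -1 -> hproj v = v.
Proof. by move=> v1; rewrite /hproj /mnorm v1 normrN1 sqrtr1 invr1 scale1r. Qed.

Lemma mnorm1 v : mink v v = -1 -> mnorm v = 1.
Proof. by move=> v1; rewrite /mnorm v1 normrN1 sqrtr1. Qed.

Lemma mink_bound u v : `|mink u v| <= n.+1%:R * (`|u| * `|v|).
Proof.
have cb i : `|u 0 i * v 0 i| <= `|u| * `|v|.
  by rewrite normrM ler_pM// coord_le_norm.
rewrite /mink (le_trans (ler_normD _ _))// normrN -natr1 mulrDl mul1r addrC.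
rewrite lerD//; apply: le_trans (ler_norm_sum _ _ _) _.
have -> : n%:R * (`|u| * `|v|) = \sum_(i < n) `|u| * `|v|.
  by rewrite sumr_const card_ord mulr_natl.
exact: ler_sum.
Qed.

Lemma mnorm_lipschitz (m M : R) p q : 0 < m ->
  timelike p -> timelike q -> m <= mnorm p -> m <= mnorm q ->
  `|p| <= M -> `|q| <= M ->
  `|mnorm p - mnorm q| <= n.+1%:R * M / m * `|p - q|.
Proof.
move=> m0 tp tq mp mq pM qM.
have E : (mnorm p - mnorm q) * (mnorm p + mnorm q) = mink (q - p) (q + p).
  rewrite -subr_sqr !mnorm_sqr// minkBl !minkDr (minkC p q); ring.
have s0 : 0 < mnorm p + mnorm q by rewrite addr_gt0// mnorm_gt0.
have M0 : 0 <= M by exact: le_trans pM.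
have : `|mnorm p - mnorm q| * (mnorm p + mnorm q) <= n.+1%:R * (`|p - q| * (M + M)).
  rewrite -[in leLHS](gtr0_norm s0) -normrM E (le_trans (mink_bound _ _))//.
  rewrite ler_wpM2l// distrC ler_wpM2l// (le_trans (ler_normD _ _))// lerD//.
rewrite -ler_pdivlMr// => /le_trans; apply.
rewrite ler_pdivrMr//.
have -> : n.+1%:R * (`|p - q| * (M + M)) = n.+1%:R * M / m * `|p - q| * (m + m).
  by field; rewrite gt_eqF.
by apply: ler_wpM2l; [rewrite !mulr_ge0// invr_ge0 ltW|rewrite lerD].
Qed.

Lemma hproj_lipschitz (m M : R) p q : 0 < m ->
  timelike p -> timelike q -> m <= mnorm p -> m <= mnorm q ->
  `|p| <= M -> `|q| <= M ->
  `|hproj p - hproj q| <= (m^-1 + n.+1%:R * M / m * M / m ^+ 2) * `|p - q|.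
Proof.
move=> m0 tp tq mp mq pM qM.
have p0 := mnorm_gt0 tp; have q0 := mnorm_gt0 tq.
have M0 : 0 <= M by exact: le_trans pM.
have -> : hproj p - hproj q =
    (mnorm p)^-1 *: (p - q) + ((mnorm q - mnorm p) / (mnorm p * mnorm q)) *: q.
  have -> : (mnorm q - mnorm p) / (mnorm p * mnorm q) = (mnorm p)^-1 - (mnorm q)^-1.
    by field; rewrite !gt_eqF.
  by rewrite /hproj scalerBr scalerBl addrA subrK.
rewrite (le_trans (ler_normD _ _))// !normrZ mulrDl; apply: lerD.
  by rewrite ler_wpM2r// gtr0_norm ?invr_gt0// lef_pV2.
rewrite distrC normfV (gtr0_norm (mulr_gt0 p0 q0)).
have -> : n.+1%:R * M / m * M / m ^+ 2 * `|p - q| =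
   n.+1%:R * M / m * `|p - q| * (m * m)^-1 * M by field; rewrite gt_eqF.
have pq0 : 0 <= (mnorm p * mnorm q)^-1 by rewrite invr_ge0 mulr_ge0 ?mnorm_ge0.
apply: ler_pM => //; first by rewrite mulr_ge0.
apply: ler_pM => //; first exact: mnorm_lipschitz.
by rewrite lef_pV2 ?posrE ?mulr_gt0// ler_pM// ltW.
Qed.
End minkowski_algebra.

(** * Determinants of rank-one perturbations *)

Section rank_one_update.
Variable R : realType.

Definition psdmx n (H : 'M[R]_n) := forall x : 'cV_n, 0 <= (x^T *m H *m x) 0 0.

(** Reduces questions about determinants along a line of matrices to the intermediate value theorem
    and the continuity of a polynomial in one variable. *)
Lemma det_affine_poly n (A B : 'M[R]_n) :
  exists p : {poly R}, forall t, p.[t] = \det (A + t *: B).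
Proof.
exists (\det (map_mx polyC A + 'X *: map_mx polyC B)) => t.
rewrite -[LHS]/(horner_eval t _) -det_map_mx; congr (\det _).
by apply/matrixP => i j; rewrite !mxE /= /horner_eval !hornerE.
Qed.

(** The matrix determinant lemma: the bordered matrix with blocks [H], [a], [b^T], [1] is factored
    in two ways into block triangular matrices. *)
Lemma det_sub_rank1 n (H : 'M[R]_n) (a b : 'cV[R]_n) : H \in unitmx ->
  \det (H - a *m b^T) = \det H * (1 - (b^T *m invmx H *m a) 0 0).
Proof.
move=> Hu.
have E1 : block_mx 1%:M a 0 1%:M *m block_mx (H - a *m b^T) 0 b^T 1%:M
    = block_mx H a b^T 1%:M.
  by rewrite mulmx_block !(mul1mx, mulmx1, mul0mx, mulmx0, add0r) subrK.
have E2 : block_mx 1%:M 0 (b^T *m invmx H) 1%:M *m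
    block_mx H a 0 (1%:M - b^T *m invmx H *m a) = block_mx H a b^T 1%:M.
  rewrite mulmx_block !(mul1mx, mulmx1, mul0mx, mulmx0, addr0) -!mulmxA mulVmx//.
  by rewrite mulmx1 [X in block_mx _ _ _ X]addrC subrK.
move/(congr1 determinant): E1; move/(congr1 determinant): E2.
rewrite !det_mulmx !det_ublock !det_lblock !det1 !(mul1r, mulr1) => <- ->.
by rewrite det_mx11 !mxE.
Qed.

Lemma det_add_rank1 n (a : 'cV[R]_n) :
  \det (1%:M + a *m a^T) = 1 + \sum_i a i 0 ^+ 2.
Proof.
have -> : 1%:M + a *m a^T = 1%:M - a *m (- a)^T by rewrite linearN /= mulmxN opprK.
rewrite det_sub_rank1 ?unitmx1// det1 mul1r invmx1 mulmx1 linearN /= mulNmx mxE opprK.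
by congr (_ + _); rewrite mxE; apply: eq_bigr => i _; rewrite mxE expr2.
Qed.

Lemma sqnorm_gt0 n (x : 'cV[R]_n) : x != 0 -> 0 < (x^T *m x) 0 0.
Proof.
move=> x0; rewrite mxE lt_def; apply/andP; split; last first.
  by apply: sumr_ge0 => i _; rewrite mxE -expr2 sqr_ge0.
apply: contra x0; rewrite psumr_eq0; last by move=> i _; rewrite mxE -expr2 sqr_ge0.
move/allP => x0; apply/eqP/colP => i; rewrite [RHS]mxE.
have := x0 i (mem_index_enum _); rewrite mxE -expr2 sqrf_eq0.
by move/eqP.
Qed.

Lemma posdef_unitmx n (H : 'M[R]_n) :
  (forall x : 'cV_n, x != 0 -> 0 < (x^T *m H *m x) 0 0) -> H \in unitmx.
Proof.
move=> Hpd; rewrite unitmxE unitfE; apply/det0P => -[v v0 vH].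
have vT0 : v^T != 0.
  by apply: contra v0 => /eqP/(congr1 trmx); rewrite trmxK trmx0 => ->.
by have := Hpd _ vT0; rewrite trmxK vH mul0mx mxE ltxx.
Qed.

(* The determinant has no zero on the segment from the identity to [H], and it
   is polynomial along it. *)
Lemma det_posdef_gt0 n (H : 'M[R]_n) :
  (forall x : 'cV_n, x != 0 -> 0 < (x^T *m H *m x) 0 0) -> 0 < \det H.
Proof.
move=> Hpd; have [p pE] := det_affine_poly 1%:M (H - 1%:M).
have p0 : p.[0] = 1 by rewrite pE scale0r addr0 det1.
have p1 : p.[1] = \det H by rewrite pE scale1r addrC subrK.
rewrite -p1 ltNge; apply/negP => p1le.
have [t /andP[t0 t1] /rootP] : exists2 t, t \in `[0, 1] & root (- p) t.
  by apply: poly_ivt; rewrite ?ler01// !hornerN p0 oppr_le0 ler01 oppr_ge0.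
rewrite hornerN pE => /eqP; rewrite oppr_eq0 => /eqP dt.
have : (1%:M + t *: (H - 1%:M)) \in unitmx.
  apply: posdef_unitmx => x x0.
  have -> : 1%:M + t *: (H - 1%:M) = (1 - t) *: 1%:M + t *: H.
    by rewrite scalerBr scalerBl scale1r -addrA [- _ + _]addrC.
  rewrite mulmxDr mulmxDl -!scalemxAr -!scalemxAl mulmx1 !mxE.
  have xx := sqnorm_gt0 x0; have xHx := Hpd _ x0; rewrite !mxE in xx xHx.
  move: t0 t1; rewrite /= ?bnd_simp => t0 t1.
  have [->|tn0] := eqVneq t 0; first by rewrite subr0 mul1r mul0r addr0.
  by rewrite ltr_wpDl ?mulr_ge0 ?subr_ge0 ?(ltW xx)// mulr_gt0// lt_def tn0.
by rewrite unitmxE dt unitfE eqxx.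
Qed.

(* [H + e I] is positive definite for [e > 0]; the inequality for it is a
   polynomial inequality in [e], which passes to [e = 0]. *)
Lemma det_sub_rank1_le n (H : 'M[R]_n) (a : 'cV[R]_n) : H^T = H -> psdmx H ->
  \det (H - a *m a^T) <= \det H.
Proof.
move=> Hsym Hpsd.
have [p pE] := det_affine_poly H 1%:M.
have [q qE] := det_affine_poly (H - a *m a^T) 1%:M.
have pq (e : R) : 0 < e -> 0 <= (p - q).[e].
  move=> e0; rewrite hornerD hornerN pE qE subr_ge0.
  have pd (x : 'cV[R]_n) : x != 0 -> 0 < (x^T *m (H + e *: 1%:M) *m x) 0 0.
    move=> x0; rewrite mulmxDr mulmxDl -!scalemxAr -!scalemxAl mulmx1.
    rewrite [ltRHS](_ : _ = (x^T *m H *m x) 0 0 + e * (x^T *m x) 0 0).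
      by apply: ltr_wpDl; [exact: Hpsd|rewrite mulr_gt0// sqnorm_gt0].
    by rewrite !mxE.
  have Hu := posdef_unitmx pd.
  rewrite addrAC det_sub_rank1//.
  apply: ler_piMr; [by rewrite ltW// det_posdef_gt0|rewrite gerBl].
  (* In terms of [b], the quadratic form of the inverse at [a] is the form of [H + e *: 1%:M] at
     [b], which is known to be positive. *)
  set b := invmx (H + e *: 1%:M) *m a.
  have aE : a = (H + e *: 1%:M) *m b by rewrite mulKVmx.
  have -> : a^T *m invmx (H + e *: 1%:M) *m a = b^T *m (H + e *: 1%:M) *m b.
    by rewrite -mulmxA -/b {1}aE trmx_mul linearD /= Hsym linearZ /= trmx1.
  have [->|b0] := eqVneq b 0; first by rewrite mulmx0 mxE.
  exact/ltW/pd.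
suff : 0 <= (p - q).[0].
  by rewrite hornerD hornerN pE qE !scale0r !addr0 subr_ge0.
rewrite leNgt; apply/negP => pq0.
have cpq : {for 0, continuous (horner (p - q))}.
  by apply: differentiable_continuous; apply/derivable1_diffP; exact: derivable_horner.
have /cpq : nbhs (p - q).[0] [set y : R | y < 0].
  by apply: open_nbhs_nbhs; split => //; exact: open_lt.
rewrite -nbhs_ballE => -[e /= e0 He].
have := He (e / 2); rewrite /ball /= sub0r normrN gtr0_norm ?divr_gt0// ltr_pdivrMr//.
by rewrite ltr_pMr// ltr1n => /(_ isT); rewrite ltNge pq// divr_gt0.
Qed.
End rank_one_update.

(** * Lipschitz functions of one variable *)

Section lipschitz_derivable.
Variable R : realType.

Lemma lipschitz_continuousR (f : R -> R) (K : R) :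
  (forall x y, `|f x - f y| <= K * `|x - y|) -> continuous f.
Proof.
move=> fK x; apply/cvgrPdist_lt => e e0.
have K0 : 0 < `|K| + 1 by rewrite ltr_wpDl.
near=> y; apply: le_lt_trans (fK _ _) _.
have : `|x - y| < e / (`|K| + 1).
  by near: y; apply: cvgr_dist_lt; rewrite ?divr_gt0//; exact: cvg_id.
rewrite ltr_pdivlMr// => h.
apply: le_lt_trans h; rewrite mulrC ler_wpM2l// (le_trans (ler_norm _))// lerDl.
Unshelve. all: by end_near. Qed.

Lemma cumulative_of_lipschitz (f : R -> R) (K : R) :
  (forall x y, `|f x - f y| <= K * `|x - y|) -> {homo f : x y / x <= y} ->
  exists F : cumulative R R, F =1 f.
Proof.
move=> fK fnd.
have rc : right_continuous f.
  by move=> x; apply: cvg_at_right_filter; exact: (lipschitz_continuousR fK).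
pose m := isCumulative.Build R _ R f fnd rc.
pose F : cumulative R R := HB.pack f m.
by exists F.
Qed.

Lemma lebesgue_stieltjes_ocitv (F : cumulative R R) (a b : R) : a <= b ->
  lebesgue_stieltjes_measure F `]a, b]%classic = (F b - F a)%:E.
Proof.
move=> ab; rewrite /lebesgue_stieltjes_measure /measure_extension /= measurable_mu_extE; last exact: is_ocitv.
exact: wlength_itv_bnd.
Qed.

Lemma lebesgue_ocitv (a b : R) : a <= b ->
  lebesgue_measure (`]a, b]%classic : set R) = (b - a)%:E.
Proof.
move=> ab; rewrite lebesgue_measure_itv /= lte_fin; case: ltP => // ba.
by have -> : a = b; [apply/eqP; rewrite eq_le ab|rewrite subrr].
Qed.

(* [K x - F x] is nondecreasing too, so the Stieltjes measures of [F] and of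
   [K x - F x] add up to [K] times the Lebesgue measure. *)
Lemma lebesgue_stieltjes_lipschitz (F : cumulative R R) (K : R) : 0 <= K ->
  (forall x y, `|F x - F y| <= K * `|x - y|) ->
  forall A, measurable A ->
  (lebesgue_stieltjes_measure F A <= K%:E * lebesgue_measure A)%E.
Proof.
move=> K0 FK A mA.
have gK x y : `|(K * x - F x) - (K * y - F y)| <= (K + K) * `|x - y|.
  have -> : (K * x - F x) - (K * y - F y) = K * (x - y) - (F x - F y) by ring.
  by rewrite (le_trans (ler_normB _ _))// mulrDl normrM (ger0_norm K0) lerD.
have gnd : {homo (fun x => K * x - F x) : x y / x <= y}.
  move=> x y xy; rewrite -subr_ge0.
  have -> : K * y - F y - (K * x - F x) = K * (y - x) - (F y - F x) by ring.
  rewrite subr_ge0 (le_trans (ler_norm _))// (le_trans (FK _ _))//.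
  by rewrite ger0_norm// subr_ge0.
have hK x y : `|K * x - K * y| <= K * `|x - y|.
  by rewrite -mulrBr normrM (ger0_norm K0).
have hnd : {homo (fun x => K * x) : x y / x <= y} by move=> x y; exact: ler_wpM2l.
have [G GE] := cumulative_of_lipschitz gK gnd.
have [H HE] := cumulative_of_lipschitz hK hnd.
have E1 : lebesgue_stieltjes_measure H A =
    measure_add (lebesgue_stieltjes_measure F) (lebesgue_stieltjes_measure G) A.
  apply: lebesgue_stieltjes_measure_unique => // _ [[a b] _ <-].
  apply: etrans (esym (measure_addE _ _ _)); rewrite /=; have [ab|ba] := leP a b.
    by rewrite !lebesgue_stieltjes_ocitv// -EFinD !HE !GE; congr EFin; ring.
  by rewrite set_itv_ge ?measure0 ?adde0// bnd_simp -leNgt ltW.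
have E2 : lebesgue_stieltjes_measure H A =
    mscale (NngNum K0) lebesgue_measure A.
  apply: lebesgue_stieltjes_measure_unique => // _ [[a b] _ <-].
  transitivity (K%:E * lebesgue_measure (`]a, b]%classic : set R))%E; last by [].
  rewrite /=; have [ab|ba] := leP a b.
    by rewrite !lebesgue_stieltjes_ocitv// lebesgue_ocitv// !HE -EFinM; congr EFin; rewrite /=; ring.
  by rewrite set_itv_ge ?measure0 ?mule0// bnd_simp -leNgt ltW.
rewrite [X in (_ <= X)%E](_ : _ = mscale (NngNum K0) lebesgue_measure A)//.
rewrite -E2 E1 measure_addE.
by rewrite leeDl.
Qed.

(* [f] is a primitive of the Radon-Nikodym derivative of its Stieltjes
   measure. *)
Lemma nondecreasing_lipschitz_ae_derivable (f : R -> R) (K a b : R) :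
  (forall x y, `|f x - f y| <= K * `|x - y|) -> {homo f : x y / x <= y} -> a <= b ->
  {ae lebesgue_measure, forall x, x \in `]a, b[ -> derivable f x 1}.
Proof.
move=> fK fnd ab.
have K0 : 0 <= K.
  by have := fK 1 0; rewrite subr0 normr1 mulr1; apply: le_trans.
have [F FE] := cumulative_of_lipschitz fK fnd.
have FK x y : `|F x - F y| <= K * `|x - y| by rewrite !FE.
have mD : measurable (`]a, b]%classic : set (measurableTypeR R)) by exact: measurable_itv.
(* Restriction to a bounded interval makes the Stieltjes measure finite, so that it is a charge to
   which the Radon-Nikodym theorem applies. *)
have Dfin : (lebesgue_stieltjes_measure F `]a, b]%classic < +oo)%E.
  by rewrite lebesgue_stieltjes_ocitv// ltry.
pose nu : {finite_measure set (measurableTypeR R) -> \bar R} := mfrestr mD Dfin.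
pose nuc := charge_of_finite_measure nu.
have dom : nuc `<< (@lebesgue_measure R).
  apply/null_content_dominatesP => A mA A0.
  apply/eqP; rewrite eq_le; apply/andP; split; last exact: measure_ge0.
  rewrite /nuc /= /charge_of_finite_measure /nu /= /mfrestr /mrestr.
  apply: le_trans (lebesgue_stieltjes_lipschitz K0 FK _) _; first exact: measurableI.
  suff -> : lebesgue_measure (A `&` `]a, b]%classic) = 0%E by rewrite mule0.
  by apply: subset_measure0 A0 => //; exact: measurableI.
pose g := Radon_Nikodym nuc (@lebesgue_measure R).
have gint := Radon_Nikodym_integrable dom.
pose gf := fine \o g.
have gE : EFin \o gf = g.
  by apply/funext => x; rewrite /= fineK//; exact: Radon_Nikodym_fin_num.
have gfint : lebesgue_measure.-integrable [set: R] (EFin \o gf) by rewrite gE.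
have gfi (y : R) : lebesgue_measure.-integrable [set` Interval (BRight a) (BRight y)] (EFin \o gf).
  by apply: integrableS gfint => //; exact: measurable_itv.
have gfl : locally_integrable [set: R] gf.
  by apply: open_integrable_locally => //; exact: openT.
have := FTC1 gfi gfl.
apply: (@filterS _ _ (ae_filter_ringOfSetsType lebesgue_measure)) => x dx; rewrite in_itv /= => /andP[ax xb].
have ax1 : (BRight a < BRight x)%O by rewrite bnd_simp.
have {dx}[dx _] := dx ax1.
have {}dx : derivable (fun y => \int[lebesgue_measure]_(t in `]a, y]) gf t) x 1 := dx.
suff fE y : y \in `]a, b[ -> f y = (\int[lebesgue_measure]_(t in `]a, y]) gf t) + f a.
  have h := @derivableD _ _ _ _ _ _ _ dx (@derivable_cst _ _ _ (f a) x 1).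
  apply: near_eq_derivable h.
  have := @near_in_itvoo R a b x; rewrite in_itv /= ax xb => /(_ isT) h.
  by apply: filterS h => y /fE ->.
rewrite in_itv /= => /andP[ay yb].
have mI : measurable (`]a, y]%classic : set (measurableTypeR R)) by exact: measurable_itv.
have nuE : nuc `]a, y]%classic = (f y - f a)%:E.
  rewrite /nuc /= /charge_of_finite_measure /nu /= /mfrestr /mrestr.
  rewrite setIidl; first by rewrite lebesgue_stieltjes_ocitv ?ltW// !FE.
  by move=> z /=; rewrite !in_itv /= => /andP[-> /= zy]; rewrite (le_trans zy)// ltW.
have E := etrans (esym nuE) (Radon_Nikodym_integral dom mI).
rewrite /Rintegral.
have -> : (\int[lebesgue_measure]_(t in `]a, y]) (gf t)%:E = (f y - f a)%:E)%E.
  by rewrite E; apply: eq_integral => t _; exact: (congr1 (@^~ t) gE).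
by rewrite /= subrK.
Qed.

(** Adding the linear function [K * x] makes [f] nondecreasing and keeps it Lipschitz. *)
Lemma lipschitz_ae_derivable_itv (f : R -> R) (K a b : R) :
  (forall x y, `|f x - f y| <= K * `|x - y|) -> a <= b ->
  {ae lebesgue_measure, forall x, x \in `]a, b[ -> derivable f x 1}.
Proof.
move=> fK ab.
have K0 : 0 <= K.
  by have := fK 1 0; rewrite subr0 normr1 mulr1; apply: le_trans.
have gK x y : `|(f x + K * x) - (f y + K * y)| <= (K + K) * `|x - y|.
  have -> : (f x + K * x) - (f y + K * y) = (f x - f y) + K * (x - y) by ring.
  by rewrite (le_trans (ler_normD _ _))// mulrDl normrM (ger0_norm K0) lerD.
have gnd : {homo (fun x => f x + K * x) : x y / x <= y}.
  move=> x y xy; rewrite -subr_ge0.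
  have -> : f y + K * y - (f x + K * x) = K * (y - x) - (f x - f y) by ring.
  rewrite subr_ge0 (le_trans (ler_norm _))// (le_trans (fK _ _))//.
  by rewrite distrC ger0_norm// subr_ge0.
have := nondecreasing_lipschitz_ae_derivable gK gnd ab.
apply: (@filterS _ _ (ae_filter_ringOfSetsType lebesgue_measure)) => x dx /dx{}dx.
have -> : f = (fun x => f x + K * x) - (fun x => K * x).
  by apply/funext => y; rewrite /GRing.sub_fun /= addrK.
apply: derivableB => //.
Qed.
End lipschitz_derivable.

(** * Directional derivatives of maps into row vectors *)

Section derive_rV.
Variable R : realType.

Lemma is_derive_coord (V : normedModType R) n (F : V -> 'rV[R]_n) x v dF i :
  is_derive x v F dF -> is_derive x v (fun y => F y 0 i) (dF 0 i).
Proof.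
move=> [dFx dFE]; have dFi := (derivable_mxP F x v).1 dFx.
by apply: DeriveDef => //; rewrite -dFE derive_mx// mxE.
Qed.

Lemma is_derive_sum_fun (V : normedModType R) n (h : 'I_n -> V -> R) x v dh :
  (forall i, is_derive x v (h i) (dh i)) ->
  is_derive x v (fun y => \sum_(i < n) h i y) (\sum_(i < n) dh i).
Proof.
move=> H; have -> : (fun y => \sum_(i < n) h i y) = \sum_(i < n) h i.
  by apply/funext => y; rewrite fct_sumE.
exact: is_derive_sum.
Qed.

Lemma is_derive_mink (V : normedModType R) n (F G : V -> 'rV[R]_n.+1) x v dF dG :
  is_derive x v F dF -> is_derive x v G dG ->
  is_derive x v (fun y => mink (F y) (G y)) (mink dF (G x) + mink (F x) dG).
Proof.
move=> HF HG.
have H0 : is_derive x v (fun y => - (F y 0 0 * G y 0 0))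
    (- (dF 0 0 * G x 0 0 + F x 0 0 * dG 0 0)).
  have h := is_deriveN (is_deriveM (is_derive_coord 0 HF) (is_derive_coord 0 HG)).
  by apply: (is_derive_eq h); rewrite /GRing.scale /=; ring.
have HS i : is_derive x v (fun y => F y 0 (lift ord0 i) * G y 0 (lift ord0 i))
    (dF 0 (lift ord0 i) * G x 0 (lift ord0 i) + F x 0 (lift ord0 i) * dG 0 (lift ord0 i)).
  have h := is_deriveM (is_derive_coord (lift ord0 i) HF) (is_derive_coord (lift ord0 i) HG).
  by apply: (is_derive_eq h); rewrite /GRing.scale /=; ring.
have h := is_deriveD H0 (is_derive_sum_fun HS).
apply: (is_derive_eq h); rewrite /mink big_split /=; ring.
Qed.

Lemma is_derive_norm_le (V : normedModType R) n (F : V -> 'rV[R]_n) x v dF L :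
  is_derive x v F dF -> (\forall h \near 0^', `|F (h *: v + x) - F x| <= L * `|h|) ->
  `|dF| <= L.
Proof.
move=> [dFx <-] FL.
apply: (closed_cvg (fun y => `|y| <= L) _ _ _ dFx).
  apply: (@closed_comp _ _ (fun y : 'rV[R]_n => `|y|) [set r | r <= L]).
    by move=> y _; exact: norm_continuous.
  exact: closed_le.
near=> h.
rewrite normrZ normfV ler_pdivrMl; last first.
  rewrite normr_gt0; near: h. exact: nbhs_dnbhs_neq.
rewrite mulrC; near: h; exact: FL.
Unshelve. all: by end_near. Qed.

Lemma is_derive_rV (V : normedModType R) n (F : V -> 'rV[R]_n) x v (dF : 'rV[R]_n) :
  (forall i, is_derive x v (fun y => F y 0 i) (dF 0 i)) -> is_derive x v F dF.
Proof.
move=> H; have dFx : derivable F x v.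
  by apply/derivable_mxP => i j; rewrite (ord1 i); have [] := H j.
apply: DeriveDef => //; rewrite derive_mx//; apply/rowP => i; rewrite mxE.
by have [_ ->] := H i.
Qed.

Lemma is_derive_scale (V : normedModType R) n (r : V -> R) (F : V -> 'rV[R]_n) x v dr dF :
  is_derive x v r dr -> is_derive x v F dF ->
  is_derive x v (fun y => r y *: F y) (dr *: F x + r x *: dF).
Proof.
move=> Hr HF; apply: is_derive_rV => i.
have h := is_deriveM Hr (is_derive_coord i HF).
have -> : (fun y => (r y *: F y) 0 i) = r * (fun y => F y 0 i).
  by apply/funext => y; rewrite mxE.
by apply: (is_derive_eq h); rewrite !mxE /GRing.scale /=; ring.
Qed.

Lemma lipschitz_onP (V W : normedModType R) (f : V -> W) (A : set V) :
  [lipschitz f x | x in A] <->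
  exists2 K : R, 0 <= K & forall x y, A x -> A y -> `|f x - f y| <= K * `|x - y|.
Proof.
split.
  move=> /pinfty_ex_gt0[K K0 HK]; exists K; first exact: ltW.
  by move=> x y Ax Ay; exact: (HK (x, y)).
move=> [K K0 HK]; rewrite /lipschitz_on; near=> k; move=> [x y] [/= Ax Ay].
rewrite /self_sub /=; apply: (le_trans (HK _ _ Ax Ay)); apply: ler_wpM2r => //.
Unshelve. all: by end_near. Qed.
End derive_rV.

(** * Achronal sets are graphs *)

Section achronal_curves.
Variables (R : realType) (n : nat) (v0 : 'rV[R]_n.+1).
Hypothesis hv0 : timelike v0.
Notation L := 'rV[R]_n.+1.
Implicit Types (S M : set L).

Lemma hyperbolic_space_mink w : hyperbolic_space v0 w -> mink w w = -1.
Proof. by case. Qed.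

Lemma hyperbolic_space_timelike w : hyperbolic_space v0 w -> timelike w.
Proof. by move=> /hyperbolic_space_mink; rewrite /timelike => ->; rewrite ltrN10. Qed.

Lemma timelike_future w z : timelike w -> timelike z ->
  future_directed v0 w -> mink z w < 0 -> future_directed v0 z.
Proof.
move=> tw tz [_ fw] zw; split; first by move/(lt_trans tz); rewrite ltxx.
move: fw zw; rewrite !mink_timelike_lt0// => wv zw.
have : 0 < (z 0 0 * v0 0 0) * w 0 0 ^+ 2.
  by have := mulr_gt0 wv zw; congr (0 < _); ring.
by rewrite pmulr_lgt0// exprn_even_gt0//= timelike_time_neq0.
Qed.

(* If the bound failed, [s |-> (a + s (b - a)) *: g s] would be a timelike curve
   of [M] joining two points of [S]. *)
Lemma achronal_curve_le M S (g : R -> L) (l B a b : R) : achronal v0 M S ->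
  (forall s t, `|g s - g t| <= l * `|s - t|) ->
  (forall s, hyperbolic_space v0 (g s)) -> (forall s, `|g s| <= B) ->
  0 < a -> a <= b -> (forall s r, 0 < r -> M (r *: g s)) ->
  S (a *: g 0) -> S (b *: g 1) ->
  b - a <= n.+1%:R * (2 * B + 1) * b * l.
Proof.
move=> achS gl gH gB a0 ab gM Sa Sb; rewrite leNgt; apply/negP => lt_ba.
have l0 : 0 <= l by have := gl 1 0; rewrite subr0 normr1 mulr1; apply: le_trans.
have B0 : 0 <= B by exact: le_trans (gB 0).
have b0 : 0 < b by exact: lt_le_trans ab.
set N : R := n.+1%:R in lt_ba; have N1 : 1 <= N by rewrite ler1n.
pose rho s := a + s * (b - a).
pose c s := rho s *: g s.
have rhoI (s : R) : 0 <= s <= 1 -> a <= rho s <= b.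
  move=> /andP[s0 s1]; rewrite /rho lerDl mulr_ge0 ?subr_ge0//=.
  by rewrite -lerBrDl ler_piMl ?subr_ge0.
have drho (s : R) : is_derive s 1 rho (b - a).
  have h := is_deriveD (is_derive_cst a s 1) (is_deriveM (is_derive_id s 1) (is_derive_cst (b - a) s 1)).
  by apply: (is_derive_eq h); rewrite /GRing.scale /=; ring.
have Dc (s : R) : s \in `]0, 1[ -> derivable g s 1 ->
    derivable c s 1 /\ (timelike ('D_1 c s) /\ future_directed v0 ('D_1 c s)).
  move=> sI dgs.
  have sI' : 0 <= s <= 1 by move: sI; rewrite in_itv /= => /andP[/ltW -> /ltW ->].
  have /andP[ras rsb] := rhoI _ sI'.
  have r0 : 0 < rho s by exact: lt_le_trans ras.
  have dg : is_derive s 1 g ('D_1 g s) by exact: DeriveDef.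
  have [dcs ->] := is_derive_scale (drho s) dg.
  split=> //; set g' := 'D_1 g s.
  have g'l : `|g'| <= l.
    apply: is_derive_norm_le dg _; near=> h.
    by have := gl (h *: 1 + s) s; rewrite addrK /GRing.scale /= mulr1.
  have m1 : `|mink g' g'| <= N * (l * l).
    by rewrite (le_trans (mink_bound _ _))// ler_wpM2l// ler_pM.
  have m2 : `|mink g' (g s)| <= N * (l * B).
    by rewrite (le_trans (mink_bound _ _))// ler_wpM2l// ler_pM.
  have gg := hyperbolic_space_mink (gH s).
  have e0 : 0 <= b * l by rewrite mulr_ge0// ltW.
  have rm2 : `|rho s * mink g' (g s)| <= N * B * (b * l).
    rewrite normrM (gtr0_norm r0).
    have -> : N * B * (b * l) = b * (N * (l * B)) by ring.
    by rewrite ler_pM// ltW.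
  have rm1 : `|rho s ^+ 2 * mink g' g'| <= N * (b * l) ^+ 2.
    rewrite normrM (ger0_norm (sqr_ge0 _)).
    have -> : N * (b * l) ^+ 2 = b ^+ 2 * (N * (l * l)) by ring.
    by rewrite ler_pM ?sqr_ge0// lerXn2r ?nnegrE// ltW.
  have d0 : 0 < b - a.
    apply: le_lt_trans lt_ba; rewrite -mulrA mulr_ge0// mulr_ge0 ?ler0n//.
    by rewrite addr_ge0// mulr_ge0.
  have NB0 : 0 <= N * B by rewrite mulr_ge0// ler0n.
  have lt_ba' : 2 * (N * B * (b * l)) + N * (b * l) < b - a.
    by apply: le_lt_trans lt_ba; rewrite le_eqVlt; apply/orP; left; apply/eqP; ring.
  have NBe : 0 <= N * B * (b * l) by rewrite mulr_ge0.
  have Ne : b * l <= N * (b * l) by rewrite ler_peMl.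
  (* With [d = b - a] and [e = b * l], the square of the velocity is at most [- d ^+ 2 + 2 * d * (N
     * B * e) + N * e ^+ 2]. As [e <= d], the last two terms are at most
     [d * (N * (2 * B + 1) * e)], which is less than [d ^+ 2] by the negated conclusion: this is
     where its constant comes from. *)
  have tc : timelike ((b - a) *: g s + rho s *: g').
    rewrite /timelike minkDl !minkDr !minkZl !minkZr gg (minkC (g s)).
    set m := mink g' (g s) in m2 rm2 *; set k := mink g' g' in m1 rm1 *.
    set d := b - a in d0 lt_ba' *; set e := b * l in e0 rm1 rm2 lt_ba' NBe Ne *.
    have -> : d * (d * -1) + d * (rho s * m) + (rho s * (d * m) + rho s * (rho s * k)) =
      - d * d + 2 * d * (rho s * m) + rho s ^+ 2 * k by ring.
    move: rm2 rm1; rewrite !ler_norml => /andP[_ h2] /andP[_ h1].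
    have h3 : 2 * d * (rho s * m) <= 2 * d * (N * B * e).
      by rewrite ler_wpM2l// mulr_ge0// ltW.
    have h4 : N * e * e <= N * e * d.
      rewrite ler_wpM2l; [by []|by rewrite mulr_ge0// ler0n|lra].
    have h5 : d * (2 * (N * B * e) + N * e) < d * d by rewrite ltr_pM2l.
    nra.
  split=> //; apply: timelike_future (gH s).1.2 _ => //.
    exact: hyperbolic_space_timelike.
  rewrite minkDl !minkZl gg.
  by move: rm2; rewrite ler_norml => /andP[_ h2]; have := Ne; lra.
have aeD : {ae lebesgue_measure, forall t, `[0, 1]%classic t ->
    derivable c t 1 /\ (timelike ('D_1 c t) /\ future_directed v0 ('D_1 c t))}.
  have ae_g : {ae lebesgue_measure, forall t, t \in `]0, 1[ -> derivable g t 1}.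
    have aei (i : 'I_n.+1) : {ae lebesgue_measure, forall t, t \in `]0, 1[ ->
        derivable (fun s => g s 0 i) t 1}.
      apply: (@lipschitz_ae_derivable_itv _ _ l) => // s t.
      by rewrite (le_trans _ (gl s t))//; have := coord_le_norm (g s - g t) i; rewrite !mxE.
    have := filter_forall (ae_filter_ringOfSetsType lebesgue_measure) aei.
    apply: (@filterS _ _ (ae_filter_ringOfSetsType lebesgue_measure)) => t Ht tI.
    by apply/derivable_mxP => i j; rewrite (ord1 i); exact: Ht.
  (* The parameter interval has to be closed, since the curve meets [S] at its two ends;
     derivability is known only inside, but the ends form a null set. *)
  have ae_01 : {ae lebesgue_measure, forall t : R, ~ [set 0; 1] t}.
    exists [set 0; 1]; split; first by apply: measurableU; exact: measurable_set1.
      apply/eqP; rewrite eq_le measure_ge0 andbT.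
      apply: le_trans (measureU2 _ _ _) _; [exact: measurable_set1|exact: measurable_set1|].
      rewrite [X in (X <= _)%E](_ : _ = 0%E)// -[RHS]adde0.
      by congr (_ + _)%E; exact: lebesgue_measure_set1.
    by move=> t /= /contrapT.
  apply: (@filterS2 _ _ (ae_filter_ringOfSetsType lebesgue_measure) _ _ _ _ ae_g ae_01).
  move=> t dg t01; rewrite /= in_itv /= => /andP[t0 t1].
  have tI : t \in `]0, 1[.
    rewrite in_itv /= !lt_neqAle t0 t1 !andbT; apply/andP; split.
      by apply/eqP => t00; apply: t01; left; rewrite /= t00.
    by apply/eqP => t11; apply: t01; right; rewrite /= t11.
  by apply: Dc => //; exact: dg.
have : 0 = 1 :> R.
  apply: (achS `[0, 1]%classic c) => //=.
  - split.
    + exact: interval_is_interval.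
    + apply: lipschitz_locally; apply/lipschitz_onP.
      exists (b * l + (b - a) * B).
        by rewrite addr_ge0// mulr_ge0// ?subr_ge0// ltW.
      move=> s t; rewrite /= !in_itv /= => sI tI.
      have -> : c s - c t = rho s *: (g s - g t) + (rho s - rho t) *: g t.
        by rewrite scalerBr scalerBl addrA subrK.
      rewrite (le_trans (ler_normD _ _))// !normrZ mulrDl lerD//.
        have /andP[ra rb] := rhoI _ sI.
        rewrite -mulrA ler_pM// ger0_norm//.
        by rewrite (le_trans _ ra)// ltW.
      have -> : rho s - rho t = (b - a) * (s - t) by rewrite /rho; ring.
      by rewrite normrM ger0_norm ?subr_ge0// mulrAC ler_wpM2r// ler_wpM2l// subr_ge0.
    + apply: (@filterS _ _ (ae_filter_ringOfSetsType lebesgue_measure) _ _ _ aeD).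
      by move=> t Ht tI; have [? []] := Ht tI.
    + left; apply: (@filterS _ _ (ae_filter_ringOfSetsType lebesgue_measure) _ _ _ aeD).
      by move=> t Ht tI; have [? []] := Ht tI.
  - move=> t; rewrite in_itv /= => tI; apply: gM.
    by have /andP[ra _] := rhoI _ tI; exact: lt_le_trans ra.
  - by rewrite in_itv /= lexx ler01.
  - by rewrite in_itv /= lexx ler01.
  - by rewrite /c /rho mul0r addr0.
  - by rewrite /c /rho mul1r addrC subrK.
by move/eqP; rewrite eq_sym oner_eq0.
Unshelve. all: by end_near. Qed.
End achronal_curves.

Section achronal_graph.
Variables (R : realType) (n : nat) (v0 : 'rV[R]_n.+1).
Hypothesis hv0 : timelike v0.
Notation L := 'rV[R]_n.+1.
Implicit Types (S M Omega : set L) (p q w : L).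

Lemma Rplus_coneP Omega p : Omega `<=` hyperbolic_space v0 -> Rplus_cone Omega p ->
  [/\ timelike p, chronological_future v0 p & Omega (hproj p)].
Proof.
move=> OH [t [w [t0 Ow pE]]].
have Hw := OH _ Ow; have tw := hyperbolic_space_timelike Hw.
have tp : timelike p by rewrite pE; apply: timelikeZ => //; rewrite gt_eqF.
have [[_ [_ wv]] ww] := Hw.
split=> //; last by rewrite pE hprojZ// hproj_id.
split=> //; split; first by move/(lt_trans tp); rewrite ltxx.
by rewrite pE minkZl pmulr_rlt0.
Qed.

(** A ray from the origin through a point of [Omega] is itself a timelike curve of the cone, so it
    meets [S] at most once. *)
Lemma achronal_hproj_inj Omega S p q : Omega `<=` hyperbolic_space v0 ->
  S `<=` Rplus_cone Omega -> achronal v0 (Rplus_cone Omega) S ->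
  S p -> S q -> hproj p = hproj q -> p = q.
Proof.
move=> OH SM achS Sp Sq pq.
have [tp _ Op] := Rplus_coneP OH (SM _ Sp).
have [tq _ Oq] := Rplus_coneP OH (SM _ Sq).
have Hw := OH _ Op; have tw := hyperbolic_space_timelike Hw.
set w := hproj p in pq Op Hw tw.
have pE : p = mnorm p *: w by exact: mnorm_hproj.
have qE : q = mnorm q *: w by rewrite pq; exact: mnorm_hproj.
suff : mnorm p = mnorm q by move=> E; rewrite pE qE E.
have dw (t : R) : is_derive t 1 (fun s : R => s *: w) w.
  have h := is_derive_scale (is_derive_id t 1) (is_derive_cst w t 1).
  by apply: (is_derive_eq h); rewrite scale1r scaler0 addr0.
apply: (achS `]0, +oo[%classic (fun t => t *: w)) => //=.
- split.
  + exact: interval_is_interval.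
  + apply: lipschitz_locally; apply/lipschitz_onP; exists `|w| => // s t _ _.
    by rewrite -scalerBl normrZ mulrC.
  + by apply: (@filterE _ _ (ae_filter_ringOfSetsType lebesgue_measure)) => t _; have [? ->] := dw t.
  + left; apply: (@filterE _ _ (ae_filter_ringOfSetsType lebesgue_measure)) => t _.
    by have [_ ->] := dw t; exact: Hw.1.2.
- by move=> t; rewrite in_itv /= andbT => t0; exists t, w.
- by rewrite in_itv /= andbT mnorm_gt0.
- by rewrite in_itv /= andbT mnorm_gt0.
- by rewrite -pE.
- by rewrite -qE.
Qed.

Lemma timelike_nbhd p0 : timelike p0 -> exists e K : R, [/\ 0 < e, 0 <= K
  & forall p, `|p - p0| < e -> [/\ timelike p, mnorm p0 / 2 <= mnorm p <= 2 * mnorm p0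
  & forall q, `|q - p0| < e -> `|mnorm p - mnorm q| <= K * `|p - q| /\
      `|hproj p - hproj q| <= K * `|p - q|]].
Proof.
move=> tp0; have u0 := mnorm_gt0 tp0; set u := mnorm p0 in u0 *.
have N0 : (0 : R) < n.+1%:R by rewrite ltr0n.
have u0' := ltW u0.
have P0 : 0 < 2 * `|p0| + 1 by rewrite ltr_wpDl// mulr_ge0.
(* A change of [mink p p] by at most [3 / 4 * u ^+ 2] leaves [mnorm p ^+ 2] above [u ^+ 2 / 4],
   whence the lower bound [u / 2]. *)
pose d := 3 / 4 * u ^+ 2 / (n.+1%:R * (2 * `|p0| + 1)).
have d0 : 0 < d by rewrite divr_gt0 ?mulr_gt0// ?divr_gt0// exprn_gt0.
pose e := Num.min 1 d.
have e0 : 0 < e by rewrite lt_min ltr01.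
have bnd p : `|p - p0| < e -> `|p| <= `|p0| + 1.
  move=> pe; rewrite -[p in leLHS](subrK p0) addrC (le_trans (ler_normD _ _))// lerD2l.
  by rewrite ltW// (lt_le_trans pe)// ge_min lexx.
have main p : `|p - p0| < e -> timelike p /\ u / 2 <= mnorm p <= 2 * u.
  move=> pe.
  have : `|mink p p - mink p0 p0| <= 3 / 4 * u ^+ 2.
    have -> : mink p p - mink p0 p0 = mink (p - p0) (p + p0).
      by rewrite minkBl !minkDr (minkC p0 p); ring.
    rewrite (le_trans (mink_bound _ _))//.
    have -> : 3 / 4 * u ^+ 2 = n.+1%:R * (d * (2 * `|p0| + 1)).
      by rewrite /d; field; rewrite !gt_eqF.
    apply: ler_wpM2l; [exact: ltW|apply: ler_pM => //].
      by rewrite ltW// (lt_le_trans pe)// ge_min lexx orbT.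
    by rewrite (le_trans (ler_normD _ _))//; have := bnd _ pe; lra.
  have := mnorm_sqr tp0; rewrite -/u ler_norml => uE /andP[h1 h2].
  have u2 : 0 < u ^+ 2 by rewrite exprn_gt0.
  have tp : timelike p by rewrite /timelike; lra.
  split=> //; have := mnorm_sqr tp => pE; apply/andP; split.
    rewrite -(@ler_pXn2r _ 2) ?nnegrE ?mnorm_ge0 ?divr_ge0//.
    by rewrite pE exprMn exprVn; lra.
  rewrite -(@ler_pXn2r _ 2) ?nnegrE ?mnorm_ge0 ?mulr_ge0//.
  by rewrite pE exprMn; lra.
pose m := u / 2; have m0 : 0 < m by rewrite divr_gt0.
pose B := `|p0| + 1.
have B0 : 0 <= B by rewrite addr_ge0.
pose K1 := n.+1%:R * B / m; pose K2 := m^-1 + n.+1%:R * B / m * B / m ^+ 2.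
have K10 : 0 <= K1 by rewrite divr_ge0 ?mulr_ge0// ltW.
have K20 : 0 <= K2.
  by rewrite addr_ge0 ?invr_ge0 ?(ltW m0)// !divr_ge0 ?mulr_ge0 ?invr_ge0 ?exprn_ge0 ?(ltW m0)//.
exists e, (K1 + K2); split=> //; first exact: addr_ge0.
move=> p pe; have [tp pu] := main _ pe; split=> // q qe; have [tq qu] := main _ qe.
have [/andP[mp _] /andP[mq _]] := (pu, qu).
split.
  apply: le_trans (mnorm_lipschitz m0 tp tq mp mq (bnd _ pe) (bnd _ qe)) _.
  by rewrite ler_wpM2r// lerDl.
apply: le_trans (hproj_lipschitz m0 tp tq mp mq (bnd _ pe) (bnd _ qe)) _.
by rewrite ler_wpM2r// lerDr.
Qed.

(** Extends a segment of chart points, constantly beyond its ends, to a Lipschitz map on the whole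
    line, which is what [achronal_curve_le] asks of [g]. *)
Definition clamp01 (s : R) := Num.max 0 (Num.min s 1).

Lemma clamp01_itv s : 0 <= clamp01 s <= 1.
Proof. by rewrite /clamp01 le_max lexx /= ge_max ler01 ge_min lexx orbT. Qed.

Lemma clamp01_lipschitz s t : `|clamp01 s - clamp01 t| <= `|s - t|.
Proof.
wlog st : s t / s <= t => [H|].
  by have [|/ltW] := leP s t; [exact: H|move=> /H; rewrite distrC (distrC t)].
rewrite /clamp01 distrC (distrC s) [leRHS]ger0_norm ?subr_ge0// ger0_norm ?subr_ge0.
  have H1 : Num.min t 1 - Num.min s 1 <= t - s.
    by case: (leP t 1) => t1; case: (leP s 1) => s1; lra.
  apply: le_trans H1; have : Num.min s 1 <= Num.min t 1.
    by rewrite le_min !ge_min st lexx !orbT.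
  move: (Num.min s 1) (Num.min t 1) => a b ab.
  by case: (leP 0 b) => b1; case: (leP 0 a) => a1; lra.
by rewrite ge_max !le_max lexx /= le_min !ge_min st lexx !orbT.
Qed.

Lemma clamp01_0 : clamp01 0 = 0. Proof. by rewrite /clamp01 min_l ?ler01// maxxx. Qed.
Lemma clamp01_1 : clamp01 1 = 1. Proof. by rewrite /clamp01 minxx max_r ?ler01. Qed.

Lemma ball_segment (V : normedModType R) (x0 x y : V) (r s : R) : 0 <= s <= 1 ->
  `|x - x0| < r -> `|y - x0| < r -> `|(1 - s) *: x + s *: y - x0| < r.
Proof.
move=> /andP[s0 s1] xr yr.
have -> : (1 - s) *: x + s *: y - x0 = (1 - s) *: (x - x0) + s *: (y - x0).
  by rewrite !scalerBr addrACA -opprD -scalerDl subrK scale1r.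
rewrite (le_lt_trans (ler_normD _ _))// !normrZ (ger0_norm s0) ger0_norm ?subr_ge0//.
have [->|s1'] := eqVneq s 1; first by rewrite subrr mul0r add0r mul1r.
have : 0 < 1 - s by rewrite subr_gt0 lt_neqAle s1'.
by nra.
Qed.

Lemma halfspace_segment k (x y : 'rV[R]_k) (s : R) : 0 <= s <= 1 ->
  @halfspace R k x -> @halfspace R k y -> @halfspace R k ((1 - s) *: x + s *: y).
Proof.
move=> /andP[s0 s1] hx hy i i0; rewrite !mxE.
by rewrite addr_ge0// mulr_ge0 ?subr_ge0//; [exact: hx|exact: hy].
Qed.

(** In a chart of [Omega] the coordinates of the two projections are joined by a segment, as a ball
    cut by a half-space is convex. Its image is a curve in [Omega] whose Lipschitz constant is
    comparable to the distance of the projections, and [achronal_curve_le] applies to it. *)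
Lemma achronal_local_lipschitz Omega S p0 : domain v0 Omega ->
  S `<=` Rplus_cone Omega -> achronal v0 (Rplus_cone Omega) S -> S p0 ->
  exists e K : R, [/\ 0 < e, 0 <= K & forall p q, S p -> S q ->
    `|p - p0| < e -> `|q - p0| < e ->
    `|mnorm p - mnorm q| <= K * `|hproj p - hproj q|].
Proof.
move=> [_ OH lipO] SM achS Sp0.
have [tp0 _ Op0] := Rplus_coneP OH (SM _ Sp0).
have [W [U [F [G [[oW Wp0] [W' oW' UE] FU FK
  [/lipschitz_onP[L1 L10 FL] /lipschitz_onP[L2 L20 GL]]]]]]] := lipO _ Op0.
have FUp0 : (F @` U) (hproj p0) by rewrite FU.
have [x0 Ux0 Fx0] := FUp0.
have W'x0 : W' x0 by move: Ux0; rewrite UE => -[].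
have /nbhs_ballP[r /= r0 rW'] : nbhs x0 W' by exact: open_nbhs_nbhs.
have /nbhs_ballP[r1 /= r10 rW] : nbhs (hproj p0) W by exact: open_nbhs_nbhs.
have [e1 [K [e10 K0 near_p0]]] := timelike_nbhd tp0.
have [_ _ near_p0'] := near_p0 p0 (ltac:(by rewrite subrr normr0)).
set u := mnorm p0 in near_p0.
have u0 : 0 < u by exact: mnorm_gt0.
(* The three bounds keep [p] where [timelike_nbhd] applies, its projection in the chart
   neighbourhood [W], and the coordinates of the projection in the ball of radius [r]. *)
pose e := Num.min e1 (Num.min (r1 / (K + 1)) (r / (K * L2 + 1))).
have K1 : 0 < K + 1 by rewrite ltr_wpDl.
have KL2 : 0 < K * L2 + 1 by rewrite ltr_wpDl// mulr_ge0.
have e0 : 0 < e by rewrite !lt_min e10 !divr_gt0.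
pose B := `|hproj p0| + L1 * r.
have B0 : 0 <= B by rewrite addr_ge0// mulr_ge0// ltW.
exists e, (n.+1%:R * (2 * B + 1) * (2 * u) * (L1 * L2)); split=> //.
  by rewrite !mulr_ge0 ?ler0n// ?(ltW u0)// addr_ge0// mulr_ge0.
have near p : S p -> `|p - p0| < e ->
    [/\ mnorm p <= 2 * u, 0 < mnorm p, (F @` U) (hproj p) & `|G (hproj p) - x0| < r].
  move=> Sp pe; have [tp _ Op] := Rplus_coneP OH (SM _ Sp).
  have pe1 : `|p - p0| < e1 by rewrite (lt_le_trans pe)// ge_min lexx.
  have [_ /andP[_ pu] /(_ p0)] := near_p0 _ pe1.
  rewrite subrr normr0 => /(_ e10) [_ hp].
  have FUp : (F @` U) (hproj p).
    rewrite FU; split=> //; apply: rW; rewrite -ball_normE /= distrC.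
    apply: le_lt_trans hp _; have : `|p - p0| < r1 / (K + 1).
      by rewrite (lt_le_trans pe)// !ge_min lexx orbT.
    rewrite ltr_pdivlMr//; have := normr_ge0 (p - p0); nra.
  split=> //; first exact: mnorm_gt0.
  have -> : x0 = G (hproj p0) by rewrite -Fx0 FK// inE.
  apply: le_lt_trans (GL _ _ FUp FUp0) _.
  have : `|p - p0| < r / (K * L2 + 1).
    by rewrite (lt_le_trans pe)// !ge_min lexx !orbT.
  rewrite ltr_pdivlMr//; have := normr_ge0 (p - p0).
  have : L2 * `|hproj p - hproj p0| <= L2 * (K * `|p - p0|) by rewrite ler_wpM2l.
  by nra.
move=> p q.
wlog pq : p q / mnorm p <= mnorm q => [H|] Sp Sq pe qe.
  have [|/ltW] := leP (mnorm p) (mnorm q); first by move=> /H; apply.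
  by move=> /H{}H; rewrite distrC (distrC (hproj p)); apply: H.
have [pu p_gt0 FUp Gp] := near _ Sp pe; have [qu q_gt0 FUq Gq] := near _ Sq qe.
rewrite distrC ger0_norm ?subr_ge0//.
set x := G (hproj p) in Gp; set y := G (hproj q) in Gq.
have GF z : (F @` U) z -> U (G z) /\ F (G z) = z.
  by move=> [z' Uz' <-]; rewrite FK ?inE.
have [Ux Fx] := GF _ FUp; have [Uy Fy] := GF _ FUq.
pose xs s := (1 - clamp01 s) *: x + clamp01 s *: y.
have xsr s : `|xs s - x0| < r by apply: ball_segment => //; exact: clamp01_itv.
have Uxs s : U (xs s).
  rewrite UE; split.
    by apply: rW'; rewrite -ball_normE /= distrC; exact: xsr.
  move: Ux Uy; rewrite UE => -[_ hx] [_ hy].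
  by apply: halfspace_segment => //; exact: clamp01_itv.
have gO s : Omega (F (xs s)).
  have : (F @` U) (F (xs s)) by exists (xs s).
  by rewrite FU => -[].
have := @achronal_curve_le _ _ _ hv0 _ _ (F \o xs) (L1 * `|x - y|) B (mnorm p) (mnorm q) achS.
move=> H; apply: le_trans (H _ _ _ _ _ _ _ _) _ => //.
- move=> s t /=; apply: le_trans (FL _ _ (Uxs s) (Uxs t)) _.
  rewrite -mulrA ler_wpM2l//.
  have -> : xs s - xs t = (clamp01 t - clamp01 s) *: (x - y).
    by apply/rowP => i; rewrite /xs !mxE; ring.
  by rewrite normrZ mulrC ler_wpM2l// distrC clamp01_lipschitz.
- by move=> s /=; exact: OH.
- move=> s /=; rewrite /B -[F _](subrK (hproj p0)) addrC.
  rewrite (le_trans (ler_normD _ _))// lerD2l -Fx0.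
  apply: le_trans (FL _ _ (Uxs s) Ux0) _.
  by rewrite ler_wpM2l// ltW.
- by move=> s t t0; exists t, (F (xs s)).
- rewrite /= /xs clamp01_0 subr0 scale1r scale0r addr0 Fx -mnorm_hproj//.
  by have [] := Rplus_coneP OH (SM _ Sp).
- rewrite /= /xs clamp01_1 subrr scale1r scale0r add0r Fy -mnorm_hproj//.
  by have [] := Rplus_coneP OH (SM _ Sq).
have N0 : 0 <= n.+1%:R * (2 * B + 1) by rewrite mulr_ge0// addr_ge0// mulr_ge0.
have xy : L1 * `|x - y| <= L1 * L2 * `|hproj p - hproj q|.
  by rewrite -mulrA ler_wpM2l// GL.
rewrite -[leRHS]mulrA; apply: ler_pM => //.
- by rewrite mulr_ge0// ltW.
- by rewrite mulr_ge0.
- by rewrite ler_wpM2l.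
Qed.
End achronal_graph.

(** * Positivity of the volume *)

Section expanding.
Variable R : realType.

Lemma compact_closed_normed (V : normedModType R) (A : set V) : compact A -> closed A.
Proof. by apply: compact_closed; exact: norm_hausdorff. Qed.

(** The base point is a corner and not the centre, so that the cube at a boundary point of the
    half-space lies in the half-space. *)
Definition cube m (x0 : 'rV[R]_m) (s : R) : set 'rV[R]_m :=
  [set x | forall i, `[x0 0 i, x0 0 i + s]%classic (x 0 i)].

Lemma cube_compact m (x0 : 'rV[R]_m) s : compact (cube x0 s).
Proof.
apply: (@rV_compact R m (fun i => `[x0 0 i, x0 0 i + s]%classic)) => i.
exact: segment_compact.
Qed.

Lemma natr_dist_ge1 (a b : nat) : a != b -> 1 <= `|a%:R - b%:R| :> R.
Proof.
case: (ltngtP a b) => // ab _.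
  by rewrite distrC -natrB ?(ltnW ab)// ger0_norm// ler1n subn_gt0.
by rewrite -natrB ?(ltnW ab)// ger0_norm// ler1n subn_gt0.
Qed.

(* The images of the [N ^ m] points of a grid in the cube are the centers of
   disjoint balls contained in [U], of total measure [(c s) ^ m]. *)
Lemma expanding_balls_measure m (F : 'rV[R]_m -> 'rV[R]_m) (x0 : 'rV[R]_m) (s c : R)
    (N : nat) (U : set (borel_rV R m)) : 0 < s -> 0 < c -> (0 < N)%N ->
  (forall x y, cube x0 s x -> cube x0 s y -> c * `|x - y| <= `|F x - F y|) ->
  measurable U ->
  (forall x, cube x0 s x -> ball (F x) (c * s / N%:R / 2) `<=` U) ->
  (((c * s) ^+ m)%:E <= lebesgue_rV R m U)%E.
Proof.
move=> s0 c0 N0 Fc mU FU.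
have N0' : 0 < N%:R :> R by rewrite ltr0n.
have sN : 0 < s / N%:R by rewrite divr_gt0.
pose T := {ffun 'I_m -> 'I_N}.
pose pt (f : T) : 'rV[R]_m := \row_i (x0 0 i + (f i)%:R * (s / N%:R)).
have ptQ f : cube x0 s (pt f).
  move=> i; rewrite /= in_itv /= !mxE; apply/andP; split.
    by rewrite lerDl mulr_ge0// ltW.
  by rewrite lerD2l mulrCA ger_pMr// ler_pdivrMr// mul1r ler_nat ltnW.
(* Distinct grid points are at least [s / N%:R] apart, so their images are at least [r + r] apart.
   Balls of the sup norm are cubes of side [r + r], hence the exact total measure. *)
pose r := c * s / N%:R / 2.
have r0 : 0 < r by rewrite !divr_gt0// mulr_gt0.
pose B (k : 'I_#|T|) : set (borel_rV R m) := ball (F (pt (enum_val k))) r.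
have mB k : measurable (B k) by apply: measurable_open_rV; exact: ball_open.
have tB : trivIset [set: 'I_#|T|] B.
  move=> k l _ _ [z [zk zl]]; apply: enum_val_inj; apply/eqP; apply/negPn/negP => kl.
  have [i ki] : exists i : 'I_m, enum_val k i != enum_val l i.
    apply/existsP; rewrite -negb_forall; apply: contra kl => /forallP H.
    by apply/eqP/ffunP => i; apply/eqP.
  have h1 : s / N%:R <= `|pt (enum_val k) - pt (enum_val l)|.
    apply: le_trans (coord_le_norm _ i); rewrite !mxE.
    have -> : forall a b d e : R, a + b * e - (a + d * e) = (b - d) * e by move=> *; ring.
    by rewrite normrM [`|s / _|]gtr0_norm// ler_peMl ?natr_dist_ge1// ltW.
  have := Fc _ _ (ptQ (enum_val k)) (ptQ (enum_val l)).
  move: zk zl; rewrite /B -!ball_normE /= => zk zl.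
  have h2 : `|F (pt (enum_val k)) - F (pt (enum_val l))| < r + r.
    rewrite -(subrK z (F (pt (enum_val k)))) -addrA.
    by rewrite (le_lt_trans (ler_normD _ _))// ltrD// distrC.
  have h3 : c * (s / N%:R) <= c * `|pt (enum_val k) - pt (enum_val l)|.
    by rewrite ler_pM2l.
  have h4 : r + r = c * (s / N%:R) by rewrite /r; field; rewrite gt_eqF.
  by move=> h; have := le_lt_trans (le_trans h3 h) h2; rewrite h4 ltxx.
have -> : (((c * s) ^+ m)%:E = \sum_(k < #|T|) lebesgue_rV R m (B k))%E.
  under eq_bigr do rewrite lebesgue_rV_ball//.
  rewrite sumEFin sumr_const card_ord card_ffun !card_ord -mulr_natl natrX -exprMn.
  by congr (_ ^+ _)%:E; rewrite /r mulr2n; field; rewrite gt_eqF.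
rewrite -(measure_bigsetU_ord _ xpredT mB tB); apply: le_measure; rewrite ?inE//.
  exact: bigsetU_measurable.
apply: (big_ind (fun A => A `<=` U)) => [|A1 A2 ? ?|k _]; [exact: sub0set|by rewrite subUset|exact: FU].
Qed.

(** The image of the cube is compact, hence the decreasing intersection of its neighbourhoods [U k].
    The ball packing with [k.+1] grid steps bounds the measure of [U k] below independently of [k],
    and continuity from above carries the bound to the image. *)
Lemma expanding_measure_gt0 m (F : 'rV[R]_m -> 'rV[R]_m) (x0 : 'rV[R]_m) (s c : R)
    (X : set (borel_rV R m)) : 0 < s -> 0 < c ->
  (forall x y, cube x0 s x -> cube x0 s y -> c * `|x - y| <= `|F x - F y|) ->
  {within cube x0 s, continuous F} -> F @` (cube x0 s) `<=` X -> measurable X ->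
  (0 < lebesgue_rV R m X)%E.
Proof.
move=> s0 c0 Fc cF FX mX.
have cK : compact (F @` cube x0 s) by apply: continuous_compact => //; exact: cube_compact.
pose K : set 'rV[R]_m := F @` cube x0 s.
have clK : closed K by exact: compact_closed_normed.
pose d k : R := c * s / k.+1%:R / 2.
have d0 k : 0 < d k by rewrite !divr_gt0// mulr_gt0.
pose U k : set (borel_rV R m) := \bigcup_(y in K) ball y (d k).
have oU k : open (U k : set 'rV[R]_m).
  by apply: bigcup_open => y _; exact: ball_open.
have capU : \bigcap_k U k = K.
  apply/seteqP; split => [z Uz|z Kz k _]; last by exists z => //; exact: ballxx.
  apply: clK => A /nbhs_ballP[e /= e0 eA].
  have [k ke] : exists k, d k <= e.
    exists (Num.truncn (c * s / e)).
    rewrite /d ler_pdivrMr// ler_pdivrMr//.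
    have := ltW (Num.Theory.truncnS_gt (c * s / e)); rewrite ler_pdivrMr// => h.
    have : 0 <= (Num.truncn (c * s / e)).+1%:R * e by rewrite mulr_ge0// ltW.
    by move: h; set T := _.+1%:R => h T0; nra.
  have [y Ky yz] := Uz k I.
  exists y; split=> //; apply: eA; apply: le_ball ke _ _.
  exact: ball_sym.
have mK : measurable (K : set (borel_rV R m)) by exact: measurable_closed_rV.
apply: (@lt_le_trans _ _ (lebesgue_rV R m K)); last by apply: le_measure; rewrite ?inE.
apply: (@lt_le_trans _ _ ((c * s) ^+ m)%:E); first by rewrite lte_fin exprn_gt0// mulr_gt0.
have Uk k : (((c * s) ^+ m)%:E <= lebesgue_rV R m (U k))%E.
  apply: (@expanding_balls_measure _ F x0 s c k.+1) => //.
    exact: measurable_open_rV.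
  by move=> x Qx w xw; exists (F x) => //; exists x.
have U0 : (lebesgue_rV R m (U 0%N) < +oo)%E.
  have [M [_ HM]] := compact_bounded cK.
  pose B : R := `|M| + 1 + d 0%N.
  have B0 : 0 < B by rewrite addr_gt0// ltr_wpDl.
  apply: (@le_lt_trans _ _ (lebesgue_rV R m (ball (0 : 'rV[R]_m) B))); last first.
    by rewrite lebesgue_rV_ball// ltry.
  apply: le_measure; rewrite ?inE; [exact: measurable_open_rV|apply: measurable_open_rV; exact: ball_open|].
  move=> z [y Ky]; rewrite -!ball_normE /= sub0r normrN => yz.
  have yM : `|y| <= `|M| + 1 by apply: HM Ky; rewrite (le_lt_trans (ler_norm M))// ltrDl.
  rewrite -(subKr y z) (le_lt_trans (ler_normB _ _))//.
  by rewrite /B ler_ltD.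
have cvgU := @nonincreasing_cvg_mu _ _ _ (lebesgue_rV R m) U U0 _ _ _.
have {}cvgU : (lebesgue_rV R m \o U) x @[x --> \oo] --> lebesgue_rV R m K.
  rewrite -capU; apply: cvgU.
  - by move=> k; exact: measurable_open_rV.
  - by rewrite capU.
  - move=> k l kl; apply/subsetPset => z [y Ky yz]; exists y => //.
    apply: le_ball yz; rewrite /d ler_wpM2r// ler_wpM2l//; first by rewrite mulr_ge0// ltW.
    by rewrite lef_pV2 ?posrE// ler_nat.
rewrite -(cvg_lim _ cvgU)//; apply: lime_ge; first by apply/cvg_ex; exists (lebesgue_rV R m K).
by apply: nearW => k; exact: Uk.
Qed.
End expanding.

(** * Continuity, compactness and countable covers *)

Section topology.
Variable R : realType.

Lemma locally_lipschitz_within_continuous (V W : normedModType R) (f : V -> W) (A : set V) :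
  (forall x, A x -> exists e K : R, [/\ 0 < e, 0 <= K &
     forall y, A y -> `|y - x| < e -> `|f x - f y| <= K * `|x - y|]) ->
  {within A, continuous f}.
Proof.
move=> H; apply/subspace_continuousP => x Ax; apply/cvgrPdist_lt => e e0.
have [d [K [d0 K0 fK]]] := H x Ax.
have K1 : 0 < K + 1 by rewrite ltr_wpDl.
apply/nbhs_ballP; exists (Num.min d (e / (K + 1))).
  by rewrite /= lt_min d0 divr_gt0.
move=> y; rewrite -ball_normE /= lt_min => /andP[yd ye] Ay.
apply: le_lt_trans (fK _ Ay _) _; first by rewrite distrC.
by move: ye; rewrite ltr_pdivlMr//; have := normr_ge0 (x - y); nra.
Qed.

Lemma lipschitz_within_continuous (V W : normedModType R) (f : V -> W) (A : set V) (K : R) :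
  0 <= K -> (forall x y, A x -> A y -> `|f x - f y| <= K * `|x - y|) ->
  {within A, continuous f}.
Proof.
move=> K0 fK; apply: locally_lipschitz_within_continuous => x Ax.
by exists 1, K; split=> // y Ay _; exact: fK.
Qed.

Lemma bernoulli (x : R) (m : nat) : 0 <= x <= 1 -> 1 - x *+ m <= (1 - x) ^+ m.
Proof.
move=> /andP[x0 x1]; elim: m => [|m IH]; first by rewrite mulr0n subr0 expr0.
rewrite exprS; have : (1 - x) * (1 - x *+ m) <= (1 - x) * (1 - x) ^+ m.
  by rewrite ler_wpM2l// subr_ge0.
apply: le_trans; rewrite mulrS; have : 0 <= x *+ m by rewrite mulrn_wge0.
by set y := x *+ m; nra.
Qed.

Lemma compact_scale (V : normedModType R) (T : set R) (K : set V) :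
  compact T -> compact K -> compact [set w | exists t v, [/\ T t, K v & w = t *: v]].
Proof.
move=> cT cK; have := compact_setX cT cK.
have -> : [set w | exists t v, [/\ T t, K v & w = t *: v]] =
    (fun z : R * V => z.1 *: z.2) @` (T `*` K).
  apply/seteqP; split=> [w [t [v [Tt Kv ->]]]|w [[t v] [/= Tt Kv] <-]].
    by exists (t, v).
  by exists t, v.
apply: continuous_compact; apply: continuous_subspaceT.
exact: scale_continuous.
Qed.

(** A Lindelof argument: for each rational box one piece is chosen that covers the part of [S] in
    the box, if there is any. Nonemptiness of [S] provides the default piece [K0] for the other
    indices. *)
Lemma countable_cover m (S : set 'rV[R]_m) (P : set 'rV[R]_m -> Prop) : S !=set0 ->
  (forall p, S p -> exists2 K, P K & exists2 e : R, 0 < e & S `&` ball p e `<=` K) ->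
  exists2 K_ : nat -> set 'rV[R]_m, (forall i, P (K_ i)) & S `<=` \bigcup_i K_ i.
Proof.
move=> [p0 Sp0] H; have [K0 PK0 _] := H _ Sp0.
pose I := {ffun 'I_m -> rat * rat}.
pose bx (p : I) : set 'rV[R]_m := box (fun i => ratr (p i).1) (fun i => ratr (p i).2).
have H1 (p : I) : exists K, P K /\ ((exists2 K', P K' & S `&` bx p `<=` K') -> S `&` bx p `<=` K).
  have [[K PK SK]|h] := pselect (exists2 K', P K' & S `&` bx p `<=` K').
    by exists K.
  by exists K0; split.
have [f fP] := choice H1.
exists (fun k => if unpickle k is Some p then f p else K0).
  by move=> k; case: unpickle => // p; have [] := fP p.
move=> p Sp; have [K PK [e e0 SK]] := H _ Sp.
have : ball p e p by exact: ballxx.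
have ob : open (ball p e) by exact: ball_open.
rewrite (open_rV_bigcup_box ob) => -[q qe pq].
exists (pickle q) => //; rewrite pickleK; apply: (fP q).2; last by split.
by exists K => // z [Sz zq]; apply: SK; split=> //; exact: qe.
Qed.
End topology.

(** * Measurability and scaling of cones *)

Section cones.
Variables (R : realType) (n : nat).
Notation L := 'rV[R]_n.+1.
Notation borel := (borel_rV R n.+1).
Implicit Types (A B S K X : set L) (p q w : L) (r s : R).

Lemma hproj_within_continuous A : (forall p, A p -> timelike p) ->
  {within A, continuous (@hproj R n)}.
Proof.
move=> At; apply: locally_lipschitz_within_continuous => p /At tp.
have [e [K [e0 K0 H]]] := timelike_nbhd tp.
exists e, K; split=> // q _ qe; have [|_ _ /(_ q qe)[]//] := H p.
by rewrite subrr normr0.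
Qed.

Lemma compact_hproj K : (forall p, K p -> timelike p) -> compact K ->
  compact (@hproj R n @` K).
Proof. by move=> Kt; apply: continuous_compact; exact: hproj_within_continuous. Qed.

Lemma measurable_compact_rV m (K : set 'rV[R]_m) :
  compact K -> measurable (K : set (borel_rV R m)).
Proof. by move=> cK; apply: measurable_closed_rV; exact: compact_closed_normed. Qed.

(** The factor 0 is excluded from [truncated_cone], so the cone over a compact set need not be
    compact; with factors bounded away from 0 it is. *)
Lemma truncated_cone_slabs K : truncated_cone K =
  \bigcup_m [set w | exists t v, [/\ `[m.+1%:R^-1, 1]%classic t, K v & w = t *: v]].
Proof.
apply/seteqP; split=> [w [t [v [t0 t1 Kv ->]]]|w [m _ [t [v [+ Kv ->]]]]].
  exists (Num.truncn t^-1) => //; exists t, v; split=> //.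
  rewrite /= in_itv /= t1 andbT -[leRHS]invrK lef_pV2 ?posrE ?invr_gt0//.
  by rewrite ltW// Num.Theory.truncnS_gt.
rewrite /= in_itv /= => /andP[t0 t1]; exists t, v; split=> //.
by apply: lt_le_trans t0.
Qed.

Lemma measurable_truncated_cone_compact K : compact K ->
  measurable (truncated_cone K : set borel).
Proof.
move=> cK; rewrite truncated_cone_slabs; apply: bigcupT_measurable => m.
by apply: measurable_compact_rV; apply: compact_scale => //; exact: segment_compact.
Qed.

Lemma truncated_cone_bigcup (F : nat -> set L) :
  truncated_cone (\bigcup_i F i) = \bigcup_i truncated_cone (F i).
Proof.
apply/seteqP; split=> [w [t [v [t0 t1 [i _ Fv] ->]]]|w [i _ [t [v [t0 t1 Fv ->]]]]].
  by exists i => //; exists t, v.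
by exists t, v; split=> //; exists i.
Qed.

Lemma truncated_cone_hproj w X : (forall p, X p -> timelike p) ->
  truncated_cone X w -> timelike w /\ exists2 p, X p & hproj w = hproj p.
Proof.
move=> Xt [t [p [t0 t1 Xp ->]]]; split; first by apply: timelikeZ; rewrite ?gt_eqF//; exact: Xt.
by exists p => //; rewrite hprojZ//; exact: Xt.
Qed.

(** On subsets of a set that each ray meets at most once, both the truncated cone and the projection
    commute with set difference. This lets a disjoint decomposition of [S] pass to its cone and its
    projection. *)
Definition radial S := (forall p, S p -> timelike p) /\
  (forall p q, S p -> S q -> hproj p = hproj q -> p = q).

Lemma truncated_cone_setD S A B : radial S -> A `<=` S -> B `<=` S ->
  truncated_cone (A `\` B) = truncated_cone A `\` truncated_cone B.
Proof.
move=> [St Si] AS BS; apply/seteqP; split=> w.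
  move=> [t [v [t0 t1 [Av Bv] ->]]]; split; first by exists t, v.
  have tv := St _ (AS _ Av).
  move=> /truncated_cone_hproj[|_ [q Bq]]; first by move=> q /BS/St.
  by rewrite hprojZ// => vq; apply: Bv; have -> : v = q by apply: Si => //; [exact: AS|exact: BS].
move=> [[t [v [t0 t1 Av wE]]] Bw]; exists t, v; split=> //; split=> // Bv.
by apply: Bw; exists t, v.
Qed.

Lemma hproj_setD S A B : radial S -> A `<=` S -> B `<=` S ->
  @hproj R n @` (A `\` B) = (@hproj R n @` A) `\` (@hproj R n @` B).
Proof.
move=> [St Si] AS BS; apply/seteqP; split=> w.
  move=> [v [Av Bv] <-]; split; first by exists v.
  move=> [q Bq qv]; apply: Bv.
  by have -> : v = q by apply: Si => //; [exact: AS|exact: BS].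
move=> [[v Av vw] Bw]; exists v => //; split=> // Bv.
by apply: Bw; exists v.
Qed.

Definition dilation (s : R) X : set L := [set x | X (s^-1 *: x)].

Lemma measurable_dilation s X : s != 0 -> measurable (X : set borel) ->
  measurable (dilation s X : set borel).
Proof.
move=> s0 mX; have := @measurable_affine_rV R n.+1 s^-1 0.
move=> /(_ measurableT _ mX); rewrite setTI.
by congr measurable; apply/funext => x; rewrite /dilation /= addr0.
Qed.

Lemma volume_dilation s X : 0 < s -> measurable (X : set borel) ->
  volume (dilation s X) = ((s ^+ n.+1)%:E * volume X)%E.
Proof.
move=> s0 mX; rewrite /volume [in RHS](@lebesgue_rV_affine _ _ s^-1 0 X)//; last first.
  by rewrite invr_eq0 gt_eqF.
rewrite muleA -EFinM gtr0_norm ?invr_gt0// -exprMn divff ?gt_eqF// expr1n mul1e.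
by congr (lebesgue_rV R n.+1 _); apply/funext => x; rewrite /dilation /= addr0.
Qed.

(** The cone ball omits [mnorm v = r], whereas the cone over the projection contains its top, so the
    ball is not itself a dilation of that cone. It lies between the dilations by [s < r] and by [r],
    and [s] tends to [r]. The factor [r / 2] shows that a finite ball makes the cone finite, after
    which the limit is taken in the reals. *)
Lemma volume_cone_ball S r : 0 < r -> (forall p, S p -> timelike p) ->
  measurable (truncated_cone (@hproj R n @` S) : set borel) ->
  measurable (cone_ball r S : set borel) /\
  ((volume (cone_ball r S) < +oo)%E ->
   volume (cone_ball r S) = ((r ^+ n.+1)%:E * volume (truncated_cone (@hproj R n @` S)))%E).
Proof.
move=> r0 St mC; set C := truncated_cone _ in mC *.
have sub1 : cone_ball r S `<=` dilation r C.
  move=> w [[t [v [t0 Sv ->]]]]; have tv := St _ Sv.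
  rewrite mnormZ gtr0_norm// => tr.
  exists (r^-1 * t * mnorm v), (hproj v); split.
  - by rewrite !mulr_gt0 ?invr_gt0// mnorm_gt0.
  - by rewrite -mulrA ler_pdivrMl// mulr1 ltW.
  - by exists v.
  - by rewrite {1}(mnorm_hproj tv) !scalerA.
have sub2 s : 0 < s -> s < r -> dilation s C `<=` cone_ball r S.
  move=> s0 sr w [t [_ [t0 t1 [v Sv <-] wE]]]; have tv := St _ Sv.
  have -> : w = (s * t) *: hproj v by rewrite -scalerA -wE scalerA divff ?gt_eqF// scale1r.
  split.
    exists (s * t / mnorm v), v; split=> //; last by rewrite /hproj scalerA.
    by rewrite divr_gt0 ?mulr_gt0// mnorm_gt0.
  rewrite mnormZ gtr0_norm ?mulr_gt0// mnorm1 ?mink_hproj// mulr1.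
  by rewrite (le_lt_trans _ sr)// ler_piMr// ltW.
have mB : measurable (cone_ball r S : set borel).
  have -> : cone_ball r S = \bigcup_k dilation (r * (1 - k.+2%:R^-1)) C.
    apply/seteqP; split=> [w Bw|w [k _]]; last first.
      apply: sub2; rewrite ?mulr_gt0 ?subr_gt0 ?invf_lt1 ?ltr1n//.
      by rewrite gtr_pMr// gtrBl invr_gt0.
    have [[t [v [t0 Sv wE]]] wr] := Bw; have tv := St _ Sv.
    have w0 : 0 < mnorm w by rewrite wE mnormZ mulr_gt0 ?mnorm_gt0// normr_gt0 gt_eqF.
    have e0 : 0 < 1 - mnorm w / r by rewrite subr_gt0 ltr_pdivrMr// mul1r.
    exists (Num.truncn (1 - mnorm w / r)^-1) => //.
    set k := Num.truncn _; have hk : (k.+2%:R)^-1 <= 1 - mnorm w / r.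
      rewrite -[leRHS]invrK lef_pV2 ?posrE ?invr_gt0//.
      by apply/ltW/(lt_le_trans (Num.Theory.truncnS_gt _)); rewrite ler_nat.
    set s := r * _; have s0 : 0 < s by rewrite mulr_gt0// subr_gt0 invf_lt1 ?ltr1n.
    exists (s^-1 * mnorm w), (hproj v); split.
    - by rewrite mulr_gt0 ?invr_gt0.
    - rewrite ler_pdivrMl// mulr1 /s mulrC -ler_pdivrMr//.
      by rewrite lerBrDr addrC -lerBrDr.
    - by exists v.
    - by rewrite -scalerA; congr (_ *: _); rewrite wE -(hprojZ t0 tv) -mnorm_hproj// timelikeZ// gt_eqF.
  apply: bigcupT_measurable => k; apply: measurable_dilation => //.
  by rewrite gt_eqF// mulr_gt0// subr_gt0 invf_lt1 ?ltr1n.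
split=> // Vfin; apply/eqP; rewrite eq_le; apply/andP; split.
  rewrite -volume_dilation//; apply: le_measure; rewrite ?inE//.
  by apply: measurable_dilation; rewrite ?gt_eqF.
have lower s : 0 < s -> s < r -> ((s ^+ n.+1)%:E * volume C <= volume (cone_ball r S))%E.
  move=> s0 sr; rewrite -volume_dilation//; apply: le_measure; rewrite ?inE//.
    by apply: measurable_dilation; rewrite ?gt_eqF.
  exact: sub2.
have Cfin : volume C \is a fin_num.
  rewrite ge0_fin_numE ?measure_ge0// ltNge leye_eq; apply/negP => /eqP CE.
  have := lower (r / 2); rewrite CE gt0_muley ?lte_fin ?exprn_gt0 ?divr_gt0// => /(_ isT).
  rewrite ltr_pdivrMr// ltr_pMr// ltr1n => /(_ isT).
  by rewrite leye_eq => /eqP E; move: Vfin; rewrite E.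
have Bfin : volume (cone_ball r S) \is a fin_num by rewrite ge0_fin_numE ?measure_ge0.
move: lower; rewrite -(fineK Cfin) -(fineK Bfin).
set c := fine (volume C); set b := fine _ => lower.
have c0 : 0 <= c by rewrite fine_ge0// measure_ge0.
rewrite -EFinM lee_fin leNgt; apply/negP => lt_b.
have D0 : 0 < r ^+ n.+1 * c by apply: le_lt_trans lt_b; rewrite fine_ge0// measure_ge0.
(* Bernoulli's inequality costs [n.+1] times [e] of the relative gap between [r ^+ n.+1 * c] and
   [b]; dividing the gap by [n.+2] leaves one more [e] for a strict contradiction. *)
pose e := Num.min 2^-1 ((r ^+ n.+1 * c - b) / (r ^+ n.+1 * c) / n.+2%:R).
have e0 : 0 < e by rewrite lt_min invr_gt0 ltr0n /= !divr_gt0// ?subr_gt0// ltr0n.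
have e1 : e <= 2^-1 by rewrite ge_min lexx.
have := lower (r * (1 - e)).
rewrite mulr_gt0// ?subr_gt0; last by apply: le_lt_trans e1 _; rewrite invf_lt1 ?ltr1n.
rewrite gtr_pMr// gtrBl e0 => /(_ isT isT); rewrite -EFinM lee_fin leNgt => /negP; apply.
have eI : 0 <= e <= 1 by rewrite (ltW e0) (le_trans e1)// invf_le1// ler1n.
have bern := bernoulli n.+1 eI.
have : e * n.+2%:R <= (r ^+ n.+1 * c - b) / (r ^+ n.+1 * c).
  by rewrite -ler_pdivlMr// ge_min lexx orbT.
rewrite ler_pdivlMr// exprMn => he.
rewrite mulrAC; set D := r ^+ n.+1 * c in D0 he *; set X := (1 - e) ^+ n.+1 in bern *.
have : (1 - e *+ n.+1) * D <= X * D by rewrite ler_wpM2r// ltW.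
have : 0 < e * D by exact: mulr_gt0.
move: he; rewrite -[n.+2%:R]natr1 -mulr_natr; set N := n.+1%:R => he h1 h2.
by nra.
Qed.
End cones.

Section cone_volume.
Variables (R : realType) (n : nat) (v0 : 'rV[R]_n.+1).
Hypothesis hv0 : timelike v0.
Notation L := 'rV[R]_n.+1.
Notation borel := (borel_rV R n.+1).
Implicit Types (S M Omega : set L) (p q w z : L).

(** The chart is cut down so that its domain contains a whole half-space ball around [x0] and its
    image stays close to [p0]. The last clause makes the compact half-space ball of radius [rho / 2]
    already cover a neighbourhood of [p0] in [S]. *)
Lemma chart_shrink S p0 (e : R) : lipschitz_submanifold n S -> S p0 -> 0 < e ->
  exists (x0 : 'rV[R]_n) (U : set 'rV[R]_n) (F : 'rV[R]_n -> L) (rho L1 L2 : R),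
  [/\ halfspace_open U /\ (forall x, @halfspace R n x -> `|x - x0| < rho -> U x),
   [/\ U x0, F x0 = p0, 0 < rho, 0 <= L1 & 0 <= L2],
   (forall x, U x -> [/\ @halfspace R n x, S (F x) & `|F x - p0| < e]),
   (forall x y, U x -> U y -> `|F x - F y| <= L1 * `|x - y| /\
                              `|x - y| <= L2 * `|F x - F y|)
   & exists2 d : R, 0 < d & forall q, S q -> `|q - p0| < d ->
       exists2 x, U x & F x = q /\ `|x - x0| < rho / 2 ].
Proof.
move=> lipS Sp0 e0.
have [W [U [F [G [[oW Wp0] [W' oW' UE] FU FK
  [/lipschitz_onP[L1 L10 FL] /lipschitz_onP[L2 L20 GL]]]]]]] := lipS _ Sp0.
have FUp0 : (F @` U) p0 by rewrite FU.
have [x0 Ux0 Fx0] := FUp0.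
have W'x0 : W' x0 by move: Ux0; rewrite UE => -[].
have hx0 : @halfspace R n x0 by move: Ux0; rewrite UE => -[].
have /nbhs_ballP[r /= r0 rW'] : nbhs x0 W' by exact: open_nbhs_nbhs.
have /nbhs_ballP[r1 /= r10 rW] : nbhs p0 W by exact: open_nbhs_nbhs.
have L11 : 0 < L1 + 1 by rewrite ltr_wpDl.
have L21 : 0 < L2 + 1 by rewrite ltr_wpDl.
pose rho := Num.min r (e / (L1 + 1)).
have rho0 : 0 < rho by rewrite lt_min r0 divr_gt0.
exists x0, ((W' `&` ball x0 rho) `&` @halfspace R n), F, rho, L1, L2.
have U1U x : ((W' `&` ball x0 rho) `&` @halfspace R n) x -> U x.
  by move=> [[Wx _] hx]; rewrite UE.
have U1P x : @halfspace R n x -> `|x - x0| < rho -> ((W' `&` ball x0 rho) `&` @halfspace R n) x.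
  move=> hx xr; do 2?split=> //; last by rewrite -ball_normE /= distrC.
  apply: rW'; rewrite -ball_normE /= distrC (lt_le_trans xr)// ge_min lexx//.
split=> //.
- split=> //; exists (W' `&` ball x0 rho) => //; apply: openI => //; exact: ball_open.
- by split=> //; apply: U1P => //; rewrite subrr normr0.
- move=> x U1x; have [[W'x xr] hx] := U1x; have Ux := U1U _ U1x.
  have FUx : (F @` U) (F x) by exists x.
  split=> //; first by move: FUx; rewrite FU => -[].
  rewrite -Fx0; apply: le_lt_trans (FL _ _ Ux Ux0) _.
  move: xr; rewrite -ball_normE /= distrC => xr.
  have : `|x - x0| < e / (L1 + 1) by rewrite (lt_le_trans xr)// ge_min lexx orbT.
  by rewrite ltr_pdivlMr//; have := normr_ge0 (x - x0); nra.
- move=> x y U1x U1y; have Ux := U1U _ U1x; have Uy := U1U _ U1y.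
  split; first exact: FL.
  have FUx : (F @` U) (F x) by exists x.
  have FUy : (F @` U) (F y) by exists y.
  by have := GL _ _ FUx FUy; rewrite !FK// inE.
exists (Num.min r1 (rho / 2 / (L2 + 1))); first by rewrite lt_min r10 !divr_gt0.
move=> q Sq; rewrite lt_min => /andP[q1 q2].
have FUq : (F @` U) q by rewrite FU; split=> //; apply: rW; rewrite -ball_normE /= distrC.
have [x Ux Fx] := FUq.
have xr : `|x - x0| < rho / 2.
  have := GL _ _ FUq FUp0; rewrite -{1}Fx -{1}Fx0 !FK ?inE// => h.
  by move: q2; rewrite ltr_pdivlMr//; have := normr_ge0 (q - p0); nra.
exists x; last by [].
apply: U1P; first by move: Ux; rewrite UE => -[].
by rewrite (lt_trans xr)// ltr_pdivrMr// ltr_pMr// ltr1n.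
Qed.

Definition row_tail (z : L) : 'rV[R]_n := \row_i z 0 (lift ord0 i).

Lemma row_tail_lipschitz (z z' : L) : `|row_tail z - row_tail z'| <= `|z - z'|.
Proof.
apply: norm_rV_le => // i; have := coord_le_norm (z - z') (lift ord0 i).
by rewrite !mxE.
Qed.

Lemma norm_row_tail_le (z : L) (e : R) : 0 <= e -> `|z 0 0| <= e -> `|row_tail z| <= e -> `|z| <= e.
Proof.
move=> e0 z0 zt; apply: norm_rV_le => // i.
have [j ->|->//] := unliftP ord0 i.
by apply: le_trans zt; have := coord_le_norm (row_tail z) j; rewrite mxE.
Qed.

Lemma row_tailB (z z' : L) : row_tail (z - z') = row_tail z - row_tail z'.
Proof. by apply/rowP => i; rewrite !mxE. Qed.

(* A chart [F] of [S] near a point gives the map [(t, x) |-> t *: F x], which is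
   expanding on a small cube because [S] is a Lipschitz graph. *)
Lemma truncated_cone_volume_gt0 Omega S : domain v0 Omega ->
  S `<=` Rplus_cone Omega -> achronal v0 (Rplus_cone Omega) S -> S !=set0 ->
  lipschitz_submanifold n S -> measurable (truncated_cone S : set borel) ->
  (0 < volume (truncated_cone S))%E.
Proof.
move=> dO SM achS [p0 Sp0] lipS mC.
have OH : Omega `<=` hyperbolic_space v0 by case: dO.
have St p : S p -> timelike p by move=> /SM/(Rplus_coneP OH)[].
have tp0 := St _ Sp0; have u0 := mnorm_gt0 tp0.
have [e1 [K [e10 K0 near_p0]]] := timelike_nbhd tp0.
have [e2 [K2 [e20 K20 graph]]] := achronal_local_lipschitz hv0 dO SM achS Sp0.
pose e := Num.min e1 e2; have e0 : 0 < e by rewrite lt_min e10.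
have e_half : 0 < e / 2 by rewrite divr_gt0.
have [x0 [U [F [rho [L1 [L2 [[hU Uball] [Ux0 Fx0 rho0 L10 L20] UP FL _]]]]]]] :=
  chart_shrink lipS Sp0 e_half.
have hx0 : @halfspace R n x0 by have [] := UP _ Ux0.
pose Bp := `|p0| + e; have Bp0 : 0 < Bp by rewrite ltr_wpDl.
(* The three bounds keep the cube in the chart domain, the factor [t] in [[1 - s, 1]] positive, and
   [t *: F x] within [e] of [p0]. *)
pose s := Num.min (rho / 2) (Num.min 2^-1 (e / 2 / Bp)).
have s0 : 0 < s by rewrite !lt_min (divr_gt0 rho0)//= invr_gt0 ltr0n /= divr_gt0.
have s1 : s <= 2^-1 by rewrite !ge_min lexx orbT.
have s1' : s < 1 by apply: le_lt_trans s1 _; rewrite invf_lt1 ?ltr1n.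
have s2 : s < rho.
  by apply: (@le_lt_trans _ _ (rho / 2)); rewrite ?ge_min ?lexx// ltr_pdivrMr// ltr_pMr// ltr1n.
have s3 : s * Bp <= e / 2 by rewrite -ler_pdivlMr// !ge_min lexx !orbT.
pose z0 : L := cons_rV ((1 - s) : measurableTypeR R, x0 : borel_rV R n).
have cubeP (z : L) : cube z0 s z -> [/\ 1 - s <= z 0 0, z 0 0 <= 1 & U (row_tail z)].
  move=> zc; have := zc 0; rewrite cons_rV0 /= in_itv /= subrK => /andP[za zb].
  have zt i : x0 0 i <= row_tail z 0 i <= x0 0 i + s.
    by have := zc (lift ord0 i); rewrite cons_rV_lift /= in_itv /= mxE.
  split=> //; apply: Uball.
    by move=> i i0; have /andP[+ _] := zt i; apply: le_trans; exact: hx0.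
  apply: le_lt_trans s2; apply: norm_rV_le; first exact: ltW.
  move=> i; have := zt i; rewrite !mxE => /andP[h1 h2].
  by rewrite ger0_norm ?subr_ge0// lerBlDl.
pose Phi (z : L) : L := z 0 0 *: F (row_tail z).
have FB x : U x -> `|F x| <= Bp.
  move=> Ux; have [_ _ Fe] := UP _ Ux.
  rewrite -[F x](subrK p0) addrC (le_trans (ler_normD _ _))// lerD2l.
  by rewrite ltW// (lt_trans Fe)// ltr_pdivrMr// ltr_pMr// ltr1n.
have Fnear x (t : R) : U x -> 1 - s <= t <= 1 -> `|t *: F x - p0| < e.
  move=> Ux /andP[t0 t1]; have [_ _ Fe] := UP _ Ux.
  have -> : t *: F x - p0 = (F x - p0) - (1 - t) *: F x.
    by apply/rowP => i; rewrite !mxE; ring.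
  apply: le_lt_trans (ler_normB _ _) _; rewrite normrZ ger0_norm ?subr_ge0//.
  have : (1 - t) * `|F x| <= s * Bp by rewrite ler_pM ?subr_ge0// ?FB// lerBlDr -lerBlDl.
  by lra.
pose Bh := `|hproj p0| + K * e; have Bh0 : 0 <= Bh by rewrite addr_ge0// mulr_ge0// ltW.
pose C0 := 2 * mnorm p0 * K + K2 * K * Bh.
pose C1 := L2 * C0. pose C2 := (K + K2 * K) / (mnorm p0 / 2).
have C00 : 0 <= C0 by rewrite addr_ge0 ?mulr_ge0// ltW.
have C10 : 0 <= C1 by rewrite mulr_ge0.
have C20 : 0 <= C2 by apply: divr_ge0; [rewrite addr_ge0 ?mulr_ge0|rewrite divr_ge0// ltW].
have lt1 (t : R) : t < e -> t < e1 /\ t < e2.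
  by move=> te; split; apply: lt_le_trans te _; rewrite ge_min lexx ?orbT.
(* The factor [t] does not affect the direction, so [Phi z] controls [hproj p]; the graph estimate
   then controls [mnorm p], hence [p] and its chart coordinates. Finally [t] is recovered from
   [t * mnorm p], as [mnorm p] is bounded below. *)
have expand (z z' : L) : cube z0 s z -> cube z0 s z' ->
    `|z - z'| <= (C1 + C2) * `|Phi z - Phi z'|.
  move=> /cubeP[za zb Uz] /cubeP[za' zb' Uz'].
  set t := z 0 0 in za zb *; set t' := z' 0 0 in za' zb' *.
  set x := row_tail z in Uz *; set x' := row_tail z' in Uz' *.
  have t0 : 0 < t by apply: lt_le_trans za; rewrite subr_gt0.
  have t0' : 0 < t' by apply: lt_le_trans za'; rewrite subr_gt0.
  have [_ Sp Fp] := UP _ Uz; have [_ Sq Fq] := UP _ Uz'.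
  set p := F x in Sp Fp *; set q := F x' in Sq Fq *.
  have tp := St _ Sp; have tq := St _ Sq.
  have pe : `|p - p0| < e by rewrite (lt_trans Fp)// ltr_pdivrMr// ltr_pMr// ltr1n.
  have qe : `|q - p0| < e by rewrite (lt_trans Fq)// ltr_pdivrMr// ltr_pMr// ltr1n.
  have Pe : `|t *: p - p0| < e by apply: Fnear => //; rewrite za.
  have Qe : `|t' *: q - p0| < e by apply: Fnear => //; rewrite za'.
  have [pe1 pe2] := lt1 _ pe; have [qe1 qe2] := lt1 _ qe.
  have [Pe1 _] := lt1 _ Pe; have [Qe1 _] := lt1 _ Qe.
  set D := `|Phi z - Phi z'|.
  have [_ _ /(_ _ Qe1)[]] := near_p0 _ Pe1.
  rewrite !mnormZ !hprojZ// (gtr0_norm t0) (gtr0_norm t0') -/D => nPQ hPQ.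
  have gpq : `|mnorm p - mnorm q| <= K2 * (K * D).
    by apply: le_trans (graph _ _ Sp Sq pe2 qe2) _; rewrite ler_wpM2l.
  have [_ /andP[pu1 pu2] _] := near_p0 _ pe1.
  have [_ _ /(_ _ (_ : `|p0 - p0| < e1))] := near_p0 _ qe1.
  rewrite subrr normr0 => /(_ e10)[_ hq].
  have hqB : `|hproj q| <= Bh.
    rewrite -[hproj q](subrK (hproj p0)) addrC (le_trans (ler_normD _ _))// lerD2l.
    by apply: le_trans hq _; rewrite ler_wpM2l// ltW.
  have pq : `|p - q| <= C0 * D.
    have -> : p - q = mnorm p *: (hproj p - hproj q) + (mnorm p - mnorm q) *: hproj q.
      by rewrite scalerBr scalerBl addrA subrK -!mnorm_hproj.
    rewrite (le_trans (ler_normD _ _))// (normrZ (mnorm p)) (normrZ (mnorm p - mnorm q)).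
    rewrite mulrDl lerD//.
      by rewrite -[leRHS]mulrA ger0_norm ?mnorm_ge0// ler_pM// ?mnorm_ge0.
    have -> : K2 * K * Bh * D = K2 * (K * D) * Bh by ring.
    by rewrite ler_pM.
  have xx : `|x - x'| <= C1 * D.
    have [_ h] := FL _ _ Uz Uz'; apply: le_trans h _.
    by rewrite -mulrA ler_wpM2l.
  have tt : `|t - t'| <= C2 * D.
    rewrite /C2 mulrAC ler_pdivlMr ?divr_gt0//.
    apply: (@le_trans _ _ (`|t - t'| * mnorm p)); first by rewrite ler_wpM2l.
    rewrite -[X in _ * X]ger0_norm ?mnorm_ge0// -normrM.
    have -> : (t - t') * mnorm p = (t * mnorm p - t' * mnorm q) + t' * (mnorm q - mnorm p).
      by ring.
    rewrite (le_trans (ler_normD _ _))// mulrDl lerD// normrM distrC.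
    rewrite -[leRHS]mul1r -mulrA ler_pM// gtr0_norm//.
  have D0 : 0 <= D by exact: normr_ge0.
  apply: norm_row_tail_le; first by rewrite mulr_ge0// addr_ge0.
    rewrite mxE mxE -/t -/t'; apply: le_trans tt _.
    by rewrite ler_wpM2r// lerDr.
  rewrite row_tailB; apply: le_trans xx _.
  by rewrite ler_wpM2r// lerDl.
have C1' : 0 < C1 + C2 + 1 by rewrite ltr_wpDl// addr_ge0.
apply: (@expanding_measure_gt0 _ _ Phi z0 s (C1 + C2 + 1)^-1) => //.
- by rewrite invr_gt0.
- move=> z z' zc zc'; rewrite ler_pdivrMl//; apply: le_trans (expand _ _ zc zc') _.
  by rewrite ler_wpM2r// lerDl.
- apply: (@lipschitz_within_continuous _ _ _ _ _ (L1 + Bp)); first by rewrite addr_ge0// ltW.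
  move=> z z' /cubeP[za zb Uz] /cubeP[za' zb' Uz'].
  have -> : Phi z - Phi z' = z 0 0 *: (F (row_tail z) - F (row_tail z')) +
     (z 0 0 - z' 0 0) *: F (row_tail z').
    by rewrite scalerBr scalerBl addrA subrK.
  rewrite (le_trans (ler_normD _ _))// !normrZ mulrDl lerD//.
    have [h _] := FL _ _ Uz Uz'; rewrite ger0_norm; last by apply: le_trans za; rewrite subr_ge0 ltW.
    rewrite -[leRHS]mul1r ler_pM//; first by apply: le_trans za; rewrite subr_ge0 ltW.
    by apply: le_trans h _; rewrite ler_wpM2l// row_tail_lipschitz.
  rewrite mulrC ler_pM// ?FB//.
  by have := coord_le_norm (z - z') 0; rewrite !mxE.
- move=> _ [z /cubeP[za zb Uz] <-]; exists (z 0 0), (F (row_tail z)); split=> //.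
    by apply: lt_le_trans za; rewrite subr_gt0.
  by have [] := UP _ Uz.
Qed.
End cone_volume.

(** * Area densities *)

Section derive_hproj.
Variables (R : realType) (n : nat).
Notation L := 'rV[R]_n.+1.

Lemma derivable_line (V W : normedModType R) (f : V -> W) (a v : V) :
  (fun h : R => h^-1 *: ((f \o shift a) (h *: v) - f a)) =
  (fun h : R => h^-1 *: (((fun h : R => f (h *: v + a)) \o shift 0) (h *: 1) -
      (fun h : R => f (h *: v + a)) 0)).
Proof.
apply/funext => h /=; rewrite scale0r add0r addr0.
by rewrite /GRing.scale /= mulr1.
Qed.

(** Only partial derivatives of a parametrization are at hand; restricted to coordinate lines, it
    becomes a curve to which the chain rule for [hproj] applies. *)
Lemma is_derive_line (V W : normedModType R) (f : V -> W) (a v : V) df :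
  is_derive a v f df <-> is_derive (0 : R) 1 (fun h : R => f (h *: v + a)) df.
Proof.
split=> -[d1 d2]; apply: DeriveDef.
- by rewrite /derivable -derivable_line.
- by rewrite /derive -derivable_line.
- by rewrite /derivable derivable_line.
- by rewrite /derive derivable_line.
Qed.

Lemma is_derive_mnorm (g : R -> L) dg : is_derive (0 : R) 1 g dg ->
  (\forall h \near (0 : R), timelike (g h)) ->
  is_derive (0 : R) 1 (fun h => mnorm (g h)) (- (mink (g 0) dg / mnorm (g 0))).
Proof.
move=> Hg near_t; have t0 := nbhs_singleton near_t.
have m0 : 0 < - mink (g 0) (g 0) by rewrite oppr_gt0.
have h1 : is_derive (0 : R) 1 (fun h => - mink (g h) (g h))
  (- (mink dg (g 0) + mink (g 0) dg)) := is_deriveN (is_derive_mink Hg Hg).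
have h2 := @is_derive1_comp R Num.sqrt (fun h => - mink (g h) (g h)) 0 _ _ (is_derive1_sqrt m0) h1.
have {}h2 : is_derive (0 : R) 1 (fun h => Num.sqrt (- mink (g h) (g h)))
    (- (mink (g 0) dg / mnorm (g 0))).
  apply: (is_derive_eq h2); rewrite /mnorm ltr0_norm// (minkC dg).
  by field; rewrite sqrtr_eq0 -ltNge m0.
apply: near_eq_is_derive h2.
by apply: filterS near_t => h th; rewrite /mnorm ltr0_norm.
Qed.

Lemma is_derive_hproj (g : R -> L) dg : is_derive (0 : R) 1 g dg ->
  (\forall h \near (0 : R), timelike (g h)) ->
  is_derive (0 : R) 1 (fun h => hproj (g h))
    ((mink (g 0) dg / mnorm (g 0) ^+ 3) *: g 0 + (mnorm (g 0))^-1 *: dg).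
Proof.
move=> Hg near_t; have t0 := nbhs_singleton near_t.
have u0 := mnorm_gt0 t0.
have h1 := is_derive_mnorm Hg near_t.
have h2 := @is_deriveV R (fun h => mnorm (g h)) 0 _ 1 (lt0r_neq0 u0) h1.
apply: (is_derive_eq (is_derive_scale h2 Hg)); congr (_ *: _ + _).
by rewrite /GRing.scale /=; field; rewrite gt_eqF.
Qed.

Lemma derivable_near_neq0 (V : normedModType R) (g : R -> V) : derivable g 0 1 -> g 0 != 0 ->
  \forall h \near (0 : R), g h != 0.
Proof.
move=> /derivable1_diffP/differentiable_continuous cg g0.
exact: (@cvgr_neq0 _ _ _ _ _ g (g 0) cg g0).
Qed.
End derive_hproj.

Section area_density.
Variables (R : realType) (n : nat).
Notation L := 'rV[R]_n.+1.
Implicit Types (F : 'rV[R]_n -> L) (x : 'rV[R]_n).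

Definition partial F x j : L := 'D_(delta_mx 0 j) F x.

Definition gram F x : 'M[R]_n := \matrix_(j, k) mink (partial F x j) (partial F x k).

Lemma gram_sym F x : (gram F x)^T = gram F x.
Proof. by apply/matrixP => j k; rewrite [LHS]mxE [LHS]mxE [RHS]mxE; exact: minkC. Qed.

Lemma mink_hproj_derive (p v w : L) : timelike p ->
  mnorm p ^+ 2 * mink ((mink p v / mnorm p ^+ 3) *: p + (mnorm p)^-1 *: v)
                      ((mink p w / mnorm p ^+ 3) *: p + (mnorm p)^-1 *: w) =
  mink v w + mink p v / mnorm p * (mink p w / mnorm p).
Proof.
move=> tp; have u0 := mnorm_gt0 tp.
have pp : mink p p = - mnorm p ^+ 2 by rewrite mnorm_sqr// opprK.
rewrite minkDl !minkDr !minkZl !minkZr (minkC v p) pp.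
by field; rewrite gt_eqF.
Qed.

(** The derivative of [hproj] removes the component along [F x] and divides by [mnorm (F x)]. As
    that component is timelike, removing it adds to the Gram matrix the squares and products of the
    radial components [a]. *)
Lemma gram_hproj F x :
  (forall j, derivable F x (delta_mx 0 j)) -> timelike (F x) ->
  (forall j, \forall h \near (0 : R), timelike (F (h *: delta_mx 0 j + x))) ->
  let a : 'cV[R]_n := \col_j (mink (F x) (partial F x j) / mnorm (F x)) in
  mnorm (F x) ^+ 2 *: gram (@hproj R n \o F) x = gram F x + a *m a^T.
Proof.
move=> dF tF nearF a; have u0 := mnorm_gt0 tF.
have pE j : partial (@hproj R n \o F) x j =
    (mink (F x) (partial F x j) / mnorm (F x) ^+ 3) *: F x +
    (mnorm (F x))^-1 *: partial F x j.
  have d : is_derive x (delta_mx 0 j) F (partial F x j) by exact: DeriveDef.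
  have := is_derive_hproj ((is_derive_line _ _ _ _).1 d) (nearF j).
  rewrite scale0r add0r => d'.
  by have [_ <-] := (is_derive_line (@hproj R n \o F) x _ _).2 d'.
apply/matrixP => j k; rewrite !mxE big_ord1 !mxE !pE.
exact: mink_hproj_derive.
Qed.

(** The quadratic form at [c] is the square of the component [w'] of the tangent vector [w]
    orthogonal to the timelike vector [F x]. *)
Lemma psd_gram_add F x : timelike (F x) ->
  let a : 'cV[R]_n := \col_j (mink (F x) (partial F x j) / mnorm (F x)) in
  psdmx (gram F x + a *m a^T).
Proof.
move=> tF a c; have u0 := mnorm_gt0 tF.
pose w := \sum_j c j 0 *: partial F x j.
have E1 : (c^T *m gram F x *m c) 0 0 = mink w w.
  rewrite mink_suml mxE; apply: eq_bigr => k _.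
  rewrite minkZl minkC mink_suml mxE mulr_suml mulr_sumr; apply: eq_bigr => j _.
  by rewrite !mxE minkZl; ring.
have E2 : (a^T *m c) 0 0 = mink (F x) w / mnorm (F x).
  rewrite minkC mink_suml mxE mulr_suml; apply: eq_bigr => j _.
  by rewrite !mxE minkZl minkC; ring.
have -> : (c^T *m (gram F x + a *m a^T) *m c) 0 0 = mink w w + (mink (F x) w / mnorm (F x)) ^+ 2.
  rewrite mulmxDr mulmxDl [LHS]mxE E1; congr (_ + _).
  rewrite -E2 mulmxA -[_ *m a *m _ *m _]mulmxA mxE big_ord1 expr2; congr (_ * _).
  by rewrite -[c^T *m a]trmxK trmx_mul trmxK mxE.
have FF : mink (F x) (F x) = - mnorm (F x) ^+ 2 by rewrite mnorm_sqr// opprK.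
pose w' := w + (mink (F x) w / mnorm (F x) ^+ 2) *: F x.
have : 0 <= mink w' w'.
  apply: (timelike_orthogonal tF); rewrite /w' minkDr minkZr FF.
  by field; rewrite gt_eqF.
congr (0 <= _); rewrite /w' minkDl !minkDr !minkZl !minkZr FF (minkC w).
by field; rewrite gt_eqF.
Qed.

(* Where ['D] takes its junk value 0, so does the density: this makes
   Rademacher's theorem unnecessary. *)
Lemma area_density_nd F x j : ~ derivable F x (delta_mx 0 j) -> area_density F x = 0.
Proof.
move=> nd; have p0 : partial F x j = 0.
  by rewrite /partial /derive dvgP//; apply/rowP => i; rewrite !mxE.
rewrite /area_density (_ : \det _ = 0) ?sqrtr0//.
rewrite (expand_det_row _ j) big1// => k _; rewrite mxE -/(partial F x j) p0.
by rewrite -[0](scale0r 0) minkZl !mul0r.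
Qed.

(* By [gram_hproj], the Gram matrix of [F] is that of [hproj \o F], scaled, minus
   a rank-one matrix. *)
Lemma area_density_hproj_le F x : timelike (F x) ->
  (forall y, F y != 0 -> timelike (F y)) ->
  area_density F x <= mnorm (F x) ^+ n * area_density (@hproj R n \o F) x.
Proof.
move=> tF tFy; have u0 := mnorm_gt0 tF.
have [dF|] := pselect (forall j, derivable F x (delta_mx 0 j)); last first.
  move=> /existsNP[j nd]; rewrite (area_density_nd nd) mulr_ge0//.
    by rewrite exprn_ge0// ltW.
  exact: sqrtr_ge0.
(* Derivability along a line gives continuity along it, so [F] stays nonzero near [x] on that line.
   At a boundary point where [F] jumps to 0 the derivative does not exist, and the previous case
   applies. *)
have nearF j : \forall h \near (0 : R), timelike (F (h *: delta_mx 0 j + x)).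
  have d : is_derive x (delta_mx 0 j) F (partial F x j) by exact: DeriveDef.
  have [d0 _] := (is_derive_line _ _ _ _).1 d.
  have : \forall h \near (0 : R), F (h *: delta_mx 0 j + x) != 0.
    apply: (derivable_near_neq0 d0); rewrite scale0r add0r.
    by apply: contraTneq tF => ->; rewrite /timelike -[0](scale0r 0) minkZl mul0r ltxx.
  by apply: filterS => h /tFy.
have := gram_hproj dF tF nearF; set a := \col_j _ => /= E.
have gE : gram F x = mnorm (F x) ^+ 2 *: gram (@hproj R n \o F) x - a *m a^T.
  by rewrite E addrK.
rewrite /area_density -/(gram F x) -/(gram (@hproj R n \o F) x) gE.
rewrite -[X in X * _]ger0_norm ?exprn_ge0 ?(ltW u0)// -sqrtr_sqr -sqrtrM ?sqr_ge0//.
apply: ler_wsqrtr; rewrite -exprM mulnC exprM -detZ.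
apply: det_sub_rank1_le; first by rewrite linearZ /= gram_sym.
by rewrite E; exact: psd_gram_add.
Qed.
End area_density.

(** * The Klein model *)

Section integral_scale.
Local Open Scope ereal_scope.
Import HBNNSimple.
Context d (T : measurableType d) (R : realType) (mu : {measure set T -> \bar R}).

(* The densities to which this applies may fail to be measurable; one argues with
   the simple functions below them, whose integrals have the integral as
   supremum. *)
Lemma ge0_le_integral_scale (D : set T) (f g : T -> R) (c : R) : (0 < c)%R ->
  (forall x, D x -> (0 <= f x)%R) -> (forall x, D x -> (f x <= c * g x)%R) ->
  \int[mu]_(x in D) (f x)%:E <= c%:E * \int[mu]_(x in D) (g x)%:E.
Proof.
move=> c0 f0 fg.
have g0 x : D x -> (0 <= g x)%R.
  by move=> Dx; rewrite -(pmulr_rge0 _ c0) (le_trans (f0 _ Dx))// fg.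
rewrite !ge0_integralE; last 2 first.
- by move=> x Dx; rewrite lee_fin g0.
- by move=> x Dx; rewrite lee_fin f0.
apply/ge_ereal_sup => _ [h /= hf <-].
have ci0 : (0 <= c^-1)%R by rewrite invr_ge0 ltW.
pose h' := scale_nnsfun h ci0.
have -> : sintegral mu h = c%:E * sintegral mu h'.
  rewrite (_ : sintegral mu h' = (c^-1)%:E * sintegral mu h).
    by rewrite muleA -EFinM divff ?gt_eqF// mul1e.
  by rewrite -sintegralrM; apply: eq_sintegral => x /=; rewrite mulrC.
apply: lee_wpmul2l; first by rewrite lee_fin ltW.
apply: ereal_sup_ubound; exists h' => //= x; have := hf x.
rewrite /patch; case: ifPn => xD; rewrite !lee_fin => hx.
  by rewrite ler_pdivrMl// (le_trans hx)// fg// -in_setE.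
by rewrite mulr_ge0_le0.
Qed.
End integral_scale.

Lemma near_line (R : realType) (V : normedModType R) (y v : V) (P : V -> Prop) :
  (\forall z \near y, P z) -> \forall h \near (0 : R), P (h *: v + y).
Proof.
move=> /nbhs_ballP[e /= e0 eP]; have v1 : 0 < `|v| + 1 by rewrite ltr_wpDl.
apply/nbhs_ballP; exists (e / (`|v| + 1)); first by rewrite /= divr_gt0.
move=> h; rewrite -ball_normE /= sub0r normrN ltr_pdivlMr// => hv.
apply: eP; rewrite -ball_normE /= opprD addrCA subrr addr0 normrN normrZ.
by apply: le_lt_trans hv; rewrite ler_wpM2l// lerDl.
Qed.

Section klein.
Variables (R : realType) (n : nat) (v0 : 'rV[R]_n.+1).
Hypothesis hv0 : timelike v0.
Notation L := 'rV[R]_n.+1.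
Notation borel := (borel_rV R n.+1).
Implicit Types (S M Omega D : set L) (p q w : L) (y : 'rV[R]_n).

(** The time coordinate of [v0] may be negative; this sign places the chart on the sheet that [v0]
    declares to be the future. *)
Let sigma : R := Num.sg (v0 0 0).

Lemma sigma_sqr : sigma * sigma = 1.
Proof. by rewrite -expr2 sqr_sg timelike_time_neq0. Qed.

Lemma sigma_future p : timelike p -> chronological_future v0 p -> `|p 0 0| = sigma * p 0 0.
Proof.
move=> tp [_ [_]]; rewrite mink_timelike_lt0// => pv.
have := timelike_time_neq0 hv0; rewrite neq_lt => /orP[v0n|v0p]; rewrite /sigma.
  by rewrite ltr0_sg// mulN1r ltr0_norm//; move: pv; rewrite nmulr_lgt0.
by rewrite gtr0_sg// mul1r gtr0_norm//; move: pv; rewrite pmulr_lgt0.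
Qed.

(* [hproj \o klein_pt] is the Klein chart; the shift by 1 moves its domain into
   the open half-space, as [lipschitz_parametrization] requires. *)
Definition klein_pt (y : 'rV[R]_n) : L :=
  cons_rV (sigma : measurableTypeR R, (sigma *: (y - const_mx 1)) : borel_rV R n).

Lemma klein_pt0 y : klein_pt y 0 0 = sigma.
Proof. by rewrite /klein_pt cons_rV0. Qed.

Lemma klein_pt_lift y i : klein_pt y 0 (lift ord0 i) = sigma * (y 0 i - 1).
Proof. by rewrite /klein_pt cons_rV_lift /= !mxE. Qed.

Lemma klein_pt_sqr y : mink (klein_pt y) (klein_pt y) = -1 + \sum_(i < n) (y 0 i - 1) ^+ 2.
Proof.
rewrite mink_sqr klein_pt0 expr2 sigma_sqr; congr (_ + _); apply: eq_bigr => i _.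
by rewrite klein_pt_lift exprMn expr2 sigma_sqr mul1r.
Qed.

Lemma klein_pt_lipschitz y y' : `|klein_pt y - klein_pt y'| <= `|y - y'|.
Proof.
have E (A B : L) i : (A - B) 0 i = A 0 i - B 0 i by rewrite !mxE.
apply: norm_rV_le => // i; have [j ->|->] := unliftP ord0 i; rewrite E.
  rewrite !klein_pt_lift -mulrBr normrM.
  have -> : `|sigma| = 1 by rewrite normr_sg timelike_time_neq0.
  rewrite mul1r; have -> : y 0 j - 1 - (y' 0 j - 1) = (y - y') 0 j by rewrite !mxE; ring.
  exact: coord_le_norm.
by rewrite !klein_pt0 subrr normr0.
Qed.

Lemma partial_klein_pt y j :
  is_derive y (delta_mx 0 j) klein_pt
   (cons_rV (0 : measurableTypeR R, (sigma *: delta_mx 0 j) : borel_rV R n)).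
Proof.
apply: is_derive_rV => i; have [k ->|->] := unliftP ord0 i.
  have -> : (fun y => klein_pt y 0 (lift ord0 k)) = (fun y => sigma * (y 0 k - 1)).
    by apply/funext => z; rewrite klein_pt_lift.
  rewrite cons_rV_lift /= mxE.
  have h := is_derive_coord k (is_derive_id y (delta_mx 0 j)).
  have h2 := is_deriveZ sigma (is_deriveB h (is_derive_cst (1 : R) y (delta_mx 0 j))).
  by apply: (is_derive_eq h2); rewrite subr0.
have -> : (fun y => klein_pt y 0 0) = cst sigma.
  by apply/funext => z; rewrite klein_pt0.
by rewrite cons_rV0 /=; exact: is_derive_cst.
Qed.

Lemma gram_klein_pt y : gram klein_pt y = 1%:M.
Proof.
apply/matrixP => j k; rewrite [LHS]mxE [RHS]mxE /partial.
have [_ ->] := partial_klein_pt y j; have [_ ->] := partial_klein_pt y k.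
rewrite /mink !cons_rV0 /= mul0r oppr0 add0r.
under eq_bigr do rewrite !cons_rV_lift /= !mxE.
rewrite (bigD1 j)//= big1 => [|i ij]; last by rewrite (negbTE ij) mulr0 mul0r.
by rewrite addr0 eqxx mulr1 mulrA sigma_sqr mul1r.
Qed.

(** The points [klein_pt y] fill a Euclidean plane, with Gram matrix 1. With
    [u = mnorm (klein_pt y)] the radial components have square sum [(1 - u ^+ 2) / u ^+ 2], so the
    rank-one update has determinant [u ^- 2], and the factor [u ^+ 2] in each of the [n] dimensions
    contributes the rest. *)
Lemma area_density_klein y : timelike (klein_pt y) ->
  (\forall z \near y, timelike (klein_pt z)) ->
  area_density (@hproj R n \o klein_pt) y = mnorm (klein_pt y) ^- n.+1.
Proof.
move=> ty near_t; have u0 := mnorm_gt0 ty; set u := mnorm (klein_pt y) in u0 *.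
have nearj j : \forall h \near (0 : R), timelike (klein_pt (h *: delta_mx 0 j + y)).
  exact: near_line near_t.
have dj j : derivable klein_pt y (delta_mx 0 j) by have [] := partial_klein_pt y j.
have := gram_hproj dj ty nearj; set a := \col_j _ => /= E.
have aE i : a i 0 ^+ 2 = (y 0 i - 1) ^+ 2 / u ^+ 2.
  rewrite mxE expr_div_n; congr (_ / _); rewrite /partial.
  have [_ ->] := partial_klein_pt y i.
  rewrite /mink cons_rV0 /= mulr0 oppr0 add0r.
  under eq_bigr do rewrite klein_pt_lift cons_rV_lift /= !mxE.
  rewrite (bigD1 i)//= big1 => [|k ki]; last by rewrite (negbTE ki) !mulr0.
  by rewrite !eqxx addr0 mulr1 mulrAC sigma_sqr mul1r.
have uE : u ^+ 2 = 1 - \sum_(i < n) (y 0 i - 1) ^+ 2.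
  by rewrite /u mnorm_sqr// klein_pt_sqr opprD opprK.
have D : (u ^+ 2) ^+ n * \det (gram (@hproj R n \o klein_pt) y) = (u ^+ 2)^-1.
  rewrite -detZ E gram_klein_pt det_add_rank1 (eq_bigr _ (fun i _ => aE i)) -mulr_suml.
  have -> : \sum_(i < n) (y 0 i - 1) ^+ 2 = 1 - u ^+ 2 by rewrite uE; ring.
  by field; rewrite gt_eqF.
rewrite /area_density -/(gram (@hproj R n \o klein_pt) y).
have -> : \det (gram (@hproj R n \o klein_pt) y) = (u ^- n.+1) ^+ 2.
  apply: (@mulfI _ ((u ^+ 2) ^+ n)); first by rewrite !expf_neq0// gt_eqF.
  rewrite D exprVn -[(u ^+ n.+1) ^+ 2]exprM mulnC exprM [(u ^+ 2) ^+ n.+1]exprS.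
  have : (u ^+ 2) ^+ n != 0 by rewrite !expf_neq0// gt_eqF.
  by move: ((u ^+ 2) ^+ n) => X X0; field; rewrite X0 gt_eqF.
by rewrite sqrtr_sqr ger0_norm// invr_ge0 exprn_ge0// ltW.
Qed.

(* The points of the hyperbolic space with time coordinate less than [5 a]. *)
Definition klein_domain (a : R) : set 'rV[R]_n :=
  [set y | mink (klein_pt y) (klein_pt y) < - (5 * a) ^- 2].

Lemma klein_domainP a y : 0 < a -> klein_domain a y ->
  [/\ timelike (klein_pt y), (5 * a)^-1 <= mnorm (klein_pt y) & forall i, `|y 0 i - 1| < 1].
Proof.
move=> a0 yU; have a5 : 0 < (5 * a)^-1 by rewrite invr_gt0 mulr_gt0.
have ty : timelike (klein_pt y).
  by apply: lt_trans yU _; rewrite oppr_lt0 -exprVn exprn_gt0.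
split=> //.
  rewrite -(@ler_pXn2r _ 2) ?nnegrE ?mnorm_ge0 ?(ltW a5)// mnorm_sqr// exprVn.
  by rewrite lerNr ltW.
move=> i; rewrite -(@ltr_pXn2r _ 2) ?nnegrE// expr1n -normrX ger0_norm ?sqr_ge0//.
apply: (@le_lt_trans _ _ (\sum_(i < n) (y 0 i - 1) ^+ 2)).
  by rewrite (bigD1 i)//= lerDl sumr_ge0// => j _; exact: sqr_ge0.
by have := ty; rewrite /timelike klein_pt_sqr addrC subr_lt0.
Qed.

Lemma klein_pt_norm_le a y : 0 < a -> klein_domain a y -> `|klein_pt y| <= 1.
Proof.
move=> a0 /(klein_domainP a0)[_ _ yi]; have s1 : `|sigma| = 1 by rewrite normr_sg timelike_time_neq0.
apply: norm_rV_le => // i; have [j ->|->] := unliftP ord0 i.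
  by rewrite klein_pt_lift normrM s1 mul1r ltW.
by rewrite klein_pt0 s1.
Qed.

Lemma open_klein_domain a : open (klein_domain a).
Proof.
have cf : {within setT, continuous (fun y => mink (klein_pt y) (klein_pt y))}.
  apply: (@locally_lipschitz_within_continuous _ 'rV[R]_n R) => y _.
  exists 1, (n.+1%:R * (2 * `|klein_pt y| + 1)); split=> //.
  move=> z _ zy.
  have -> : mink (klein_pt y) (klein_pt y) - mink (klein_pt z) (klein_pt z) =
      mink (klein_pt y - klein_pt z) (klein_pt y + klein_pt z).
    by rewrite minkBl !minkDr (minkC (klein_pt z) (klein_pt y)); ring.
  apply: le_trans (mink_bound _ _) _; rewrite -mulrA ler_wpM2l// mulrC.
  apply: ler_pM => //; last exact: klein_pt_lipschitz.
  have := klein_pt_lipschitz z y; rewrite (_ : klein_pt y + klein_pt z =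
     2 *: klein_pt y + (klein_pt z - klein_pt y)); last first.
    by move: (klein_pt y) (klein_pt z) => A B; apply/rowP => i; rewrite !mxE; ring.
  move=> h; rewrite (le_trans (ler_normD _ _))// normrZ ger0_norm// lerD2l.
  by rewrite (le_trans h)// ltW.
have /continuousP cf' := cf.
have /open_subspaceP [V oV VW] := cf' _ (@open_lt R (- (5 * a) ^- 2)).
by rewrite !setIT in VW; rewrite /klein_domain -[X in open X]VW.
Qed.

Lemma klein_lipschitz a : 0 < a -> exists2 K : R, 0 <= K &
  forall x y, klein_domain a x -> klein_domain a y ->
  `|(@hproj R n \o klein_pt) x - (@hproj R n \o klein_pt) y| <= K * `|x - y|.
Proof.
move=> a0; have a5 : 0 < (5 * a)^-1 by rewrite invr_gt0 mulr_gt0.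
pose K := ((5 * a)^-1)^-1 + n.+1%:R * 1 / (5 * a)^-1 * 1 / (5 * a)^-1 ^+ 2.
have K0 : 0 <= K.
  by rewrite addr_ge0 ?divr_ge0 ?mulr_ge0 ?invr_ge0 ?exprn_ge0 ?mulr_ge0 ?(ltW a0).
exists K => // x y Ux Uy.
have [tx nx _] := klein_domainP a0 Ux; have [ty ny _] := klein_domainP a0 Uy.
have h := hproj_lipschitz a5 tx ty nx ny (klein_pt_norm_le a0 Ux) (klein_pt_norm_le a0 Uy).
by apply: le_trans h _; rewrite ler_wpM2l// klein_pt_lipschitz.
Qed.

Definition klein_set (a : R) (X : set L) : set 'rV[R]_n :=
  klein_domain a `&` [set y | X (hproj (klein_pt y))].

Lemma measurable_klein_set a X : 0 < a -> measurable (X : set borel) ->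
  measurable (klein_set a X : set (borel_rV R n)).
Proof.
move=> a0 mX.
have mU : measurable (klein_domain a : set (borel_rV R n)).
  by apply: measurable_open_rV; exact: open_klein_domain.
have cpsi : {within klein_domain a, continuous (@hproj R n \o klein_pt)}.
  have [K K0 HK] := klein_lipschitz a0.
  exact: (@lipschitz_within_continuous _ _ _ _ _ K).
exact: (measurable_continuous_rV mU cpsi mU mX).
Qed.

Lemma klein_set_image a X : 0 < a ->
  (forall w, X w -> hyperbolic_space v0 w /\ `|w 0 0| <= 4 * a) ->
  (@hproj R n \o klein_pt) @` klein_set a X = X.
Proof.
move=> a0 XH; apply/seteqP; split=> [_ [y [_ Xy] <-]//|w Xw].
have [Hw wa] := XH _ Xw; have tw := hyperbolic_space_timelike Hw.
have sw := sigma_future tw Hw.1.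
have w0 : 0 < `|w 0 0| by rewrite normr_gt0 timelike_time_neq0.
(* The ray through [w] meets the plane of the chart at [w] divided by its absolute time
   coordinate. *)
have yE : klein_pt (const_mx 1 + (w 0 0)^-1 *: row_tail w) = `|w 0 0|^-1 *: w.
  apply/rowP => i; have [j ->|->] := unliftP ord0 i.
    rewrite klein_pt_lift !mxE [1 + _]addrC addrK mulrA; congr (_ * _).
    rewrite sw invfM; congr (_ * _); apply: (@mulfI _ sigma).
      by have := sigma_sqr; apply: contra_eq_neq => ->; rewrite mul0r eq_sym oner_eq0.
    rewrite sigma_sqr mulfV//.
    by have := sigma_sqr; apply: contra_eq_neq => ->; rewrite mul0r eq_sym oner_eq0.
  rewrite klein_pt0 mxE; apply: (@mulfI _ `|w 0 0|); first by rewrite gt_eqF.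
  rewrite mulVKf ?gt_eqF// sw mulrC mulrA sigma_sqr mul1r//.
exists (const_mx 1 + (w 0 0)^-1 *: row_tail w); last first.
  by rewrite /= yE hprojZ ?invr_gt0// hproj_id//; exact: hyperbolic_space_mink Hw.
split; last by rewrite /= yE hprojZ ?invr_gt0// hproj_id//; exact: hyperbolic_space_mink Hw.
rewrite /klein_domain /= yE minkZl minkZr (hyperbolic_space_mink Hw) mulrA mulrN1 ltrN2.
rewrite -expr2 exprVn ltf_pV2 ?posrE ?exprn_gt0 ?mulr_gt0//.
rewrite ltr_pXn2r ?nnegrE//; last by rewrite mulr_ge0// ltW.
(* The gap between 4 and 5 supplies the strict inequality that the open set [klein_domain a]
   demands. *)
by apply: le_lt_trans wa _; rewrite ltr_pM2r// ltr_nat.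
Qed.

Lemma halfspace_open_klein a : 0 < a -> halfspace_open (klein_domain a).
Proof.
move=> a0; exists (klein_domain a); first exact: open_klein_domain.
apply/esym/setIidPl => y Uy i _; have [_ _ /(_ i)] := klein_domainP a0 Uy.
by rewrite ltr_norml => /andP[h _]; lra.
Qed.

Lemma hproj_hyperbolic p : timelike p -> chronological_future v0 p ->
  hyperbolic_space v0 (hproj p).
Proof.
move=> tp [_ [_ pv]]; have u0 := mnorm_gt0 tp.
split; last exact: mink_hproj.
have th : timelike (hproj p) by rewrite /timelike mink_hproj// ltrN10.
split=> //; split; first by move/(lt_trans th); rewrite ltxx.
by rewrite minkZl pmulr_rlt0// invr_gt0.
Qed.

Lemma klein_hyperbolic a y : 0 < a -> klein_domain a y ->
  hyperbolic_space v0 (hproj (klein_pt y)).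
Proof.
move=> a0 Uy; have [ty _ _] := klein_domainP a0 Uy.
apply: hproj_hyperbolic => //; split=> //; split; first by move/(lt_trans ty); rewrite ltxx.
rewrite mink_timelike_lt0// klein_pt0 /sigma -normrEsg normr_gt0.
exact: timelike_time_neq0.
Qed.

Lemma klein_parametrization a : 0 < a ->
  lipschitz_parametrization (hyperbolic_space v0) (klein_domain a) (@hproj R n \o klein_pt).
Proof.
move=> a0; split.
- exact: halfspace_open_klein.
- apply: lipschitz_locally; apply/lipschitz_onP.
  exact: klein_lipschitz.
- move=> x y /set_mem Ux /set_mem Uy /= E.
  have [tx _ _] := klein_domainP a0 Ux; have [ty _ _] := klein_domainP a0 Uy.
  have s0 : sigma != 0 by rewrite sgr_eq0 timelike_time_neq0.
  have m0 : mnorm (klein_pt x) = mnorm (klein_pt y).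
    have sE (c : R) (v : L) i : (c *: v) 0 i = c * v 0 i by rewrite mxE.
    have := congr1 (fun v : L => v 0 0) E; rewrite /hproj !sE !klein_pt0.
    by move/(mulIf s0)/invr_inj.
  have := mnorm_hproj tx; rewrite E m0 -mnorm_hproj// => kxy.
  apply/rowP => i; have := congr1 (fun v : L => v 0 (lift ord0 i)) kxy.
  by rewrite /= !klein_pt_lift => /(mulfI s0)/addIr.
- by move=> _ [y Uy <-]; exact: klein_hyperbolic Uy.
Qed.

(** On [klein_domain a] one has [mnorm (klein_pt y) >= (5 * a)^-1], which bounds the Klein
    density. *)
Lemma klein_measure_le (mu : {measure set borel -> \bar R}) a X :
  is_area_measure (hyperbolic_space v0) mu -> 0 < a -> measurable (X : set borel) ->
  (forall w, X w -> hyperbolic_space v0 w /\ `|w 0 0| <= 4 * a) ->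
  (mu X <= ((5 * a) ^+ n.+1)%:E * lebesgue_rV R n (klein_set a X))%E.
Proof.
move=> [_ hmu] a0 mX XH; have a50 : 0 < 5 * a by rewrite mulr_gt0.
have mB := measurable_klein_set a0 mX.
rewrite -{1}(klein_set_image a0 XH) (hmu _ _ _ (klein_parametrization a0) mB); last first.
  by move=> y [].
apply: le_trans (@ge0_le_integral_scale _ _ _ _ _ _ (cst 1) ((5 * a) ^+ n.+1) _ _ _) _.
- by rewrite exprn_gt0.
- by move=> y _; exact: sqrtr_ge0.
- move=> y [Uy _]; rewrite /= mulr1; have [ty ny _] := klein_domainP a0 Uy.
  rewrite area_density_klein//.
    rewrite -exprVn -[5 * a]invrK; apply: lerXn2r;
      rewrite ?nnegrE ?invr_ge0 ?mnorm_ge0 ?invr_ge0 ?(ltW a50)//.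
    by rewrite lef_pV2 ?posrE ?invr_gt0// mnorm_gt0.
  have : nbhs y (klein_domain a) by apply: open_nbhs_nbhs; split=> //; exact: open_klein_domain.
  by apply: filterS => z Uz; have [] := klein_domainP a0 Uz.
rewrite (_ : (\int[lebesgue_rV R n]_(x in klein_set a X) (cst 1 x)%:E)%E = lebesgue_rV R n (klein_set a X))//.
by apply: etrans (integral_cst (lebesgue_rV R n) mB 1%E) _; rewrite mul1e.
Qed.

End klein.

Section integral_ge.
Local Open Scope ereal_scope.
Import HBNNSimple.
Context d (T : measurableType d) (R : realType) (mu : {measure set T -> \bar R}).

(** The simple function equal to [k] on [J] and to 0 elsewhere lies below [f], and the integral is
    the supremum over such functions. *)
Lemma integral_ge_cst (J : set T) (f : T -> \bar R) (k : R) : measurable J ->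
  (0 <= k)%R -> (forall x, 0 <= f x) -> (forall x, J x -> k%:E <= f x) ->
  k%:E * mu J <= \int[mu]_x f x.
Proof.
move=> mJ k0 f0 fJ; rewrite ge0_integralTE//.
rewrite -(sintegral_indic mu) -[X in _ * X]/(sintegral mu (indic_nnsfun R mJ)) -sintegralrM.
apply: ereal_sup_ubound; exists (scale_nnsfun (indic_nnsfun R mJ) k0) => /=.
  move=> x; rewrite measurable_realfun.mindicE; have [/set_mem xJ|xJ] := boolP (x \in J).
    by rewrite mulr1 fJ.
  by rewrite mulr0 f0.
by [].
Qed.
End integral_ge.

Lemma lebesgue_measure_sg_itv (R : realType) (s a b : R) : s != 0 -> a <= b ->
  let J := [set t : R | `[a, b]%classic (Num.sg s * t)] in
  measurable (J : set (measurableTypeR R)) /\ lebesgue_measure J = (b - a)%:E.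
Proof.
move=> s0 ab /=.
rewrite (_ : mkset _ = [set` if Num.sg s == 1 then `[a, b] else `[- b, - a]]).
  split; first exact: measurable_itv.
  have [ab'|] := ltP a b; last first.
    by move=> ba; rewrite (le_anti (introT andP (conj ab ba))) subrr; case: ifP => _;
       rewrite lebesgue_measure_itv /= lte_fin ltxx.
  case: ifP => _; rewrite lebesgue_measure_itv /= lte_fin ?ltrN2 ab' -EFinB//.
  by rewrite opprK addrC.
apply/seteqP; split=> t /=; case: sgrP s0 => // _ _.
- by rewrite eqxx mul1r.
- by rewrite eq_sym -subr_eq0 opprK paddr_eq0// oner_eq0 /= mulN1r !in_itv /= lerNr (lerNl t) andbC.
- by rewrite eqxx mul1r.
- by rewrite eq_sym -subr_eq0 opprK paddr_eq0// oner_eq0 /= mulN1r !in_itv /= lerNr (lerNl t) andbC.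
Qed.

Section klein_volume.
Variables (R : realType) (n : nat) (v0 : 'rV[R]_n.+1).
Hypothesis hv0 : timelike v0.
Notation L := 'rV[R]_n.+1.
Notation borel := (borel_rV R n.+1).
Notation sigma := (Num.sg (v0 0 0)).
Notation klein_pt := (@klein_pt R n v0).
Notation klein_set := (@klein_set R n v0).
Notation klein_domain := (@klein_domain R n v0).

(* [C(D)] contains the points [w] on the rays through [D] for which [`|w 0 0|] is
   between [c a / 2] and [c a]; the slice of this set at height [t] is a copy of
   [klein_set a X], scaled by [`|t|]. *)
Lemma klein_volume_ge (a c : R) D X : 0 < a -> 0 < c -> measurable (X : set borel) ->
  measurable (truncated_cone D : set borel) ->
  X = @hproj R n @` D ->
  (forall p, D p -> [/\ timelike p, chronological_future v0 p, c <= mnorm p & a <= `|hproj p 0 0|]) ->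
  (((c * a / 2) ^+ n.+1)%:E * lebesgue_rV R n (klein_set a X) <= volume (truncated_cone D))%E.
Proof.
move=> a0 c0 mX mC XD Dp; have ca0 : 0 < c * a by rewrite mulr_gt0.
have s1 : `|sigma| = 1 by rewrite normr_sg timelike_time_neq0.
have s0 : sigma != 0 by rewrite sgr_eq0 timelike_time_neq0.
set B := klein_set a X; have mB := measurable_klein_set hv0 a0 mX.
pose W0 : set L := [set w | `[c * a / 2, c * a]%classic (sigma * w 0 0)].
(* The Klein coordinate of the ray through [w], with the shift by 1 of the chart. *)
pose kap (w : L) : 'rV[R]_n := (w 0 0)^-1 *: row_tail w + const_mx 1.
pose Z : set borel := W0 `&` kap @^-1` B.
have m0 : 0 < c * a / 2 by rewrite divr_gt0.
have W0P w : W0 w -> c * a / 2 <= `|w 0 0| <= c * a /\ `|w 0 0| = sigma * w 0 0.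
  rewrite /W0 /= in_itv /= => /andP[w1 w2].
  have -> : `|w 0 0| = sigma * w 0 0.
    by rewrite -[LHS]mul1r -s1 -normrM ger0_norm// (le_trans (ltW m0)).
  by rewrite w1 w2.
have mW0 : measurable (W0 : set borel).
  have cw : {within setT, continuous (fun w : L => sigma * w 0 0)}.
    apply: (@lipschitz_within_continuous _ L R _ _ 1) => // x y _ _.
    rewrite -mulrBr normrM s1 !mul1r; have := coord_le_norm (x - y) 0; rewrite !mxE; exact.
  apply: measurable_closed_rV; apply: (@closed_comp _ _ _ `[c * a / 2, c * a]%classic).
    by move=> w _; exact: ((continuous_subspace_setT _).2 cw w).
  exact: itv_closed.
have mZ : measurable Z.
  have ck : {within W0, continuous kap}.
    apply: locally_lipschitz_within_continuous => w Ww.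
    have [/andP[w1 w2] _] := W0P _ Ww; set m := c * a / 2 in m0 w1.
    have w0 : 0 < `|w 0 0| by exact: lt_le_trans w1.
    exists 1, (m^-1 + `|w| / m ^+ 2); split=> //.
      by rewrite addr_ge0 ?divr_ge0 ?invr_ge0 ?exprn_ge0 ?(ltW m0).
    move=> z Wz _; have [/andP[z1 z2] _] := W0P _ Wz.
    have z0 : 0 < `|z 0 0| by exact: lt_le_trans z1.
    have -> : kap w - kap z = (z 0 0)^-1 *: (row_tail w - row_tail z) +
       ((z 0 0 - w 0 0) / (w 0 0 * z 0 0)) *: row_tail w.
      have -> : (z 0 0 - w 0 0) / (w 0 0 * z 0 0) = (w 0 0)^-1 - (z 0 0)^-1.
        by field; rewrite -!normr_gt0 w0 z0.
      by rewrite /kap; apply/rowP => i; rewrite !mxE; ring.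
    rewrite (le_trans (ler_normD _ _))// !normrZ mulrDl lerD//.
      rewrite normfV ler_pM ?invr_ge0 ?row_tail_lipschitz//.
      by rewrite lef_pV2 ?posrE.
    have -> : `|w| / m ^+ 2 * `|w - z| = `|w - z| / (m * m) * `|w| by rewrite expr2; ring.
    apply: ler_pM => //; last first.
      by apply: norm_rV_le => // i; rewrite mxE coord_le_norm.
    rewrite normfV normrM; apply: ler_pM => //.
      by rewrite distrC; have := coord_le_norm (w - z) 0; rewrite !mxE.
    by rewrite lef_pV2 ?posrE ?mulr_gt0// ler_pM// ltW.
  exact: (measurable_continuous_rV mW0 ck mW0 mB).
have ZC : Z `<=` truncated_cone D.
  move=> w [/W0P[/andP[w1 w2] ws] [Uy]]; rewrite /= {1}XD => -[p Dpp pE].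
  have [tp fp cp ap] := Dp _ Dpp; have up := mnorm_gt0 tp.
  have [ty _ _] := klein_domainP hv0 a0 Uy; have uy := mnorm_gt0 ty.
  have w0 : 0 < `|w 0 0| by exact: lt_le_trans w1.
  have wn0 : w 0 0 != 0 by rewrite -normr_gt0.
  have kE : klein_pt (kap w) = `|w 0 0|^-1 *: w.
    apply/rowP => i; rewrite [RHS]mxE; have [j ->|->] := unliftP ord0 i.
      rewrite klein_pt_lift !mxE addrK mulrA; congr (_ * _).
      rewrite ws invfM; congr (_ * _); apply: (mulfI s0).
      by rewrite (sigma_sqr hv0) mulfV.
    rewrite klein_pt0; apply: (@mulfI _ `|w 0 0|); first by rewrite gt_eqF.
    by rewrite mulVKf ?gt_eqF// ws mulrC mulrA (sigma_sqr hv0) mul1r.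
  (* The ratio of [mnorm w] to [mnorm p], as [w] and [p] lie on one ray. Since
     [a <= (mnorm (klein_pt (kap w)))^-1] and [c <= mnorm p], the height bound [c * a] gives
     [t <= 1]. *)
  pose t := `|w 0 0| * mnorm (klein_pt (kap w)) / mnorm p.
  have t0 : 0 < t by rewrite divr_gt0// mulr_gt0.
  exists t, p; split=> //.
    have sE (l : R) (v : L) i : (l *: v) 0 i = l * v 0 i by rewrite mxE.
    have hp : `|hproj p 0 0| = `|(mnorm (klein_pt (kap w)))^-1|.
      by rewrite pE /hproj sE klein_pt0 normrM s1 mulr1.
    rewrite /t ler_pdivrMr// mul1r (le_trans (ler_wpM2r (ltW uy) w2))//.
    rewrite -ler_pdivlMr// ler_pM ?(ltW a0) ?(ltW c0)//.
    by rewrite (le_trans ap)// hp ger0_norm// invr_ge0 ltW.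
  rewrite (mnorm_hproj tp) scalerA /t mulfVK ?gt_eqF// pE -scalerA -mnorm_hproj// kE.
  by rewrite scalerA mulfV ?scale1r// gt_eqF.
apply: (@le_trans _ _ (volume Z)); last by apply: le_measure; rewrite ?inE.
have Bfin : lebesgue_rV R n B \is a fin_num.
  rewrite ge0_fin_numE//; apply: (@le_lt_trans _ _ (lebesgue_rV R n (ball (const_mx 1 : 'rV[R]_n) (1 : R)))).
    apply: le_measure; [exact: mem_set| |].
      by rewrite ball_box//; apply: mem_set; apply: measurable_open_rV; exact: open_box.
    move=> y [Uy _]; have [_ _ h] := klein_domainP hv0 a0 Uy.
    rewrite ball_box// => i; rewrite mxE; have := h i; rewrite ltr_norml => /andP[h1 h2].
    by apply/andP; split; lra.
  by rewrite lebesgue_rV_ball// ltry.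
rewrite /volume lebesgue_rV_xsection//.
pose J : set (measurableTypeR R) := [set t | `[c * a / 2, c * a]%classic (sigma * t)].
have [mJ lJ] : measurable J /\ lebesgue_measure J = (c * a / 2)%:E.
  have := @lebesgue_measure_sg_itv R (v0 0 0) (c * a / 2) (c * a) (timelike_time_neq0 hv0).
  have -> : c * a - c * a / 2 = c * a / 2 by field.
  by apply; rewrite ler_pdivrMr// ler_peMr ?ler1n// ltW.
(* Over a set [J] of heights of length [c * a / 2], each slice has measure at least
   [(c * a / 2) ^+ n] times that of [B]. *)
apply: le_trans (@integral_ge_cst _ _ _ lebesgue_measure J _
  ((c * a / 2) ^+ n * fine (lebesgue_rV R n B)) mJ _ _ _) => //.
- suff : (((c * a / 2) ^+ n.+1)%:E * lebesgue_rV R n B <=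
     ((c * a / 2) ^+ n * fine (lebesgue_rV R n B))%:E * (c * a / 2)%:E)%E by rewrite -lJ; exact.
  by rewrite -[X in (_ * X <= _)%E](fineK Bfin) -!EFinM lee_fin exprSr mulrAC.
- by rewrite mulr_ge0 ?exprn_ge0 ?(ltW m0)// fine_ge0.
move=> t Jt; have t0 : t != 0.
  by apply/eqP => t0; move: Jt; rewrite /J /= t0 mulr0 in_itv /= leNgt m0.
have nt : `|t| = sigma * t.
  move: Jt; rewrite /J /= in_itv /= => /andP[h _].
  by rewrite -[LHS]mul1r -s1 -normrM ger0_norm// (le_trans (ltW m0)).
rewrite (_ : [set v | _] = [set v : 'rV[R]_n | B (t^-1 *: v + const_mx 1)]); last first.
  apply/seteqP; split=> v; rewrite /Z /W0 /kap /= !cons_rV0 /=.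
    move=> [_]; congr (B _); congr (_ *: _ + _).
    by apply/rowP => i; rewrite mxE cons_rV_lift.
  move=> Bv; split=> //; move: Bv; congr (B _); congr (_ *: _ + _).
  by apply/rowP => i; rewrite mxE cons_rV_lift.
rewrite EFinM fineK// (@lebesgue_rV_affine _ _ t^-1 (const_mx 1) _ _ mB) ?invr_eq0//.
rewrite muleA -EFinM -[leRHS]mul1e; apply: lee_wpmul2r => //.
rewrite lee_fin normfV exprVn ler_pdivrMr ?exprn_gt0 ?normr_gt0// mul1r.
apply: lerXn2r; rewrite ?nnegrE ?(ltW m0)// nt.
by move: Jt; rewrite /J /= in_itv /= => /andP[].
Qed.
End klein_volume.

(** * Finiteness of the area *)

Lemma closed_halfspace (R : realType) k : closed (@halfspace R k).
Proof.
rewrite (_ : @halfspace R k =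
  \bigcap_(i : 'I_k) [set x : 'rV[R]_k | i = 0%N :> nat -> 0 <= x 0 i]); last first.
  by apply/seteqP; split=> x h i; [move=> _; exact: h|exact: (h i I)].
apply: closed_bigI => i _; have [i0|i0] := pselect (i = 0%N :> nat); last first.
  rewrite (_ : mkset _ = setT); first exact: closedT.
  by apply/seteqP; split=> // x _ /i0.
rewrite (_ : mkset _ = (fun x : 'rV[R]_k => x 0 i) @^-1` [set y | 0 <= y]).
  by apply: closed_comp; [move=> x _; exact: coord_continuous|exact: closed_ge].
by apply/seteqP; split=> x /= h; [exact: h i0|move=> _].
Qed.

Section pieces.
Variables (R : realType) (n : nat) (v0 : 'rV[R]_n.+1).
Hypothesis hv0 : timelike v0.
Notation L := 'rV[R]_n.+1.
Notation borel := (borel_rV R n.+1).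
Notation hproj := (@hproj R n).
Implicit Types (S M Omega D K : set L) (p q w : L).

(** The two Klein estimates carry [(5 * a) ^+ n.+1] and [(c * a / 2) ^+ n.+1]; [a] cancels in their
    quotient, so the bound is uniform however far out in hyperbolic space the piece lies. *)
Lemma hyperbolic_measure_le_volume (mu : {measure set borel -> \bar R}) (a c : R) D :
  is_area_measure (hyperbolic_space v0) mu -> 0 < a -> 0 < c ->
  measurable (hproj @` D : set borel) -> measurable (truncated_cone D : set borel) ->
  (forall p, D p -> [/\ timelike p, chronological_future v0 p, c <= mnorm p &
     a <= `|hproj p 0 0| <= 4 * a]) ->
  (mu (hproj @` D) <= ((10 / c) ^+ n.+1)%:E * volume (truncated_cone D))%E.
Proof.
move=> hmu a0 c0 mD mC Dp.
apply: le_trans (klein_measure_le hv0 hmu a0 mD _) _.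
  move=> _ [p /Dp[tp fp _ /andP[_ ap]] <-]; split=> //.
  exact: hproj_hyperbolic.
have ca0 : 0 < c * a / 2 by rewrite divr_gt0// mulr_gt0.
have -> : (5 * a) ^+ n.+1 = (10 / c) ^+ n.+1 * (c * a / 2) ^+ n.+1.
  by rewrite -exprMn; congr (_ ^+ _); field; rewrite gt_eqF.
rewrite EFinM -muleA; apply: lee_wpmul2l.
  by rewrite lee_fin exprn_ge0// divr_ge0// ltW.
apply: (klein_volume_ge hv0 a0 c0 mD mC erefl) => p /Dp[tp fp cp /andP[ap _]].
by split.
Qed.

(* A compact part of a chart on which [mnorm p] and the time coordinate of
   [hproj p] vary by a factor of at most 4; [F] is 0 wherever it is not timelike,
   so that [area_density_hproj_le] applies at boundary points of [U]. *)
Definition area_piece S K := exists (U Q : set 'rV[R]_n) (F : 'rV[R]_n -> L) (a c : R),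
  [/\ lipschitz_parametrization S U F,
      lipschitz_parametrization (hyperbolic_space v0) U (hproj \o F),
      {within Q, continuous F} /\ (forall y, F y != 0 -> timelike (F y)),
      [/\ compact Q, Q `<=` U & K = F @` Q]
    & [/\ 0 < a, 0 < c & forall p, K p -> [/\ timelike p, chronological_future v0 p,
        c <= mnorm p <= 4 * c & a <= `|hproj p 0 0| <= 4 * a]]].

Lemma area_piece_compact S K : area_piece S K -> compact K.
Proof.
move=> [U [Q [F [a [c [_ _ [cF _] [cQ _ ->] _]]]]]].
exact: continuous_compact.
Qed.

Lemma area_piece_sub S K : area_piece S K -> K `<=` S.
Proof.
move=> [U [Q [F [a [c [[_ _ _ FS] _ _ [_ QU ->] _]]]]]] _ [x Qx <-].
by apply: FS; exists x => //; exact: QU.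
Qed.

(** For [c <= 1] the factor [(4 * c) ^+ n] in front of [mu] is at most [4 ^+ n]. For [c >= 1]
    passing to the volume turns it into [(4 * c) ^+ n * (10 / c) ^+ n.+1], that is
    [4 ^+ n * 10 ^+ n.+1 / c]. The constant covers both cases and does not depend on the piece. *)
Lemma area_piece_le S K D (mu area : {measure set borel -> \bar R}) :
  is_area_measure (hyperbolic_space v0) mu -> is_area_measure S area ->
  area_piece S K -> D `<=` K -> measurable (D : set borel) ->
  measurable (hproj @` D : set borel) -> measurable (truncated_cone D : set borel) ->
  (area D <= (4 ^+ n * 10 ^+ n.+1)%:E *
     (mu (hproj @` D) + volume (truncated_cone D)))%E.
Proof.
move=> hmu [_ ha] [U [Q [F [a [c [pF ph [cF tF] [cQ QU KE] [a0 c0 Kp]]]]]]] DK mD mpD mCD.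
have c40 : 0 < (4 * c) ^+ n by rewrite exprn_gt0// mulr_gt0.
have le1 : (area D <= ((4 * c) ^+ n)%:E * mu (hproj @` D))%E.
  pose B := Q `&` F @^-1` D.
  have BU : B `<=` U by move=> x [/QU].
  have mB : measurable (B : set (borel_rV R n)).
    by have mQ := measurable_compact_rV cQ; exact: (measurable_continuous_rV mQ cF mQ mD).
  have FB : F @` B = D.
    apply/seteqP; split=> [_ [x [_ Dx] <-]//|p Dp].
    by have := DK _ Dp; rewrite KE => -[x Qx xp]; exists x => //; split=> //=; rewrite xp.
  have hB : (hproj \o F) @` B = hproj @` D by rewrite -FB image_comp.
  rewrite -{1}FB (ha _ _ _ pF mB BU) -hB (hmu.2 _ _ _ ph mB BU).
  apply: ge0_le_integral_scale => // x Bx; first exact: sqrtr_ge0.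
  have [tp _ /andP[_ pc] _] := Kp _ (DK _ Bx.2).
  apply: le_trans (area_density_hproj_le tp tF) _.
  rewrite ler_wpM2r ?sqrtr_ge0//.
  by apply: lerXn2r; rewrite ?nnegrE ?mnorm_ge0// mulr_ge0// ltW.
have mu0 := measure_ge0 mu (hproj @` D).
have v00 : (0 <= volume (truncated_cone D))%E by exact: measure_ge0.
apply: le_trans le1 _; have [c1|/ltW c1] := leP c 1.
  apply: lee_pmul => //; rewrite ?lee_fin ?(ltW c40)//; last by rewrite leeDl.
  rewrite exprMn ler_wpM2l ?exprn_ge0// (@le_trans _ _ 1) ?exprn_ege1 ?ler1n//.
  by rewrite exprn_ile1// ltW.
have le2 := hyperbolic_measure_le_volume hmu a0 c0 mpD mCD.
apply: (@le_trans _ _ (((4 * c) ^+ n)%:E * (((10 / c) ^+ n.+1)%:E * volume (truncated_cone D)))%E).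
  apply: lee_wpmul2l; first by rewrite lee_fin ltW.
  by apply: le2 => p /DK/Kp[tp fp /andP[cp _] ap].
rewrite muleA -EFinM; apply: lee_pmul => //; last by rewrite leeDr.
  by rewrite lee_fin mulr_ge0 ?(ltW c40)// exprn_ge0// divr_ge0// ltW.
rewrite lee_fin exprMn expr_div_n mulrACA -[leRHS]mulr1 ler_wpM2l ?mulr_ge0 ?exprn_ge0//.
by rewrite ler_pdivrMr ?exprn_gt0// mul1r exprS ler_peMl// exprn_ge0// ltW.
Qed.

Lemma area_piece_local Omega S p0 : domain v0 Omega -> S `<=` Rplus_cone Omega ->
  achronal v0 (Rplus_cone Omega) S -> lipschitz_submanifold n S -> S p0 ->
  exists2 K, area_piece S K & exists2 e : R, 0 < e & S `&` ball p0 e `<=` K.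
Proof.
move=> dO SO aS lS Sp0; have [_ OH _] := dO.
have [tp0 fp0 _] := Rplus_coneP OH (SO _ Sp0).
have [e [k [e0 k0 He]]] := timelike_nbhd tp0.
have tph : timelike (hproj p0) by rewrite /timelike mink_hproj// ltrN10.
pose a := `|hproj p0 0 0| / 2; have h0 : 0 < `|hproj p0 0 0|.
  by rewrite normr_gt0 timelike_time_neq0.
have a0 : 0 < a by rewrite divr_gt0.
have u0 := mnorm_gt0 tp0; pose c := mnorm p0 / 2.
have c0 : 0 < c by rewrite divr_gt0.
have k1 : 0 < k + 1 by rewrite ltr_wpDl.
(* The bound [a / (k + 1)] lets the time coordinate of the projection move by at most [a] from its
   size [2 * a] at [p0], so it stays between [a] and [3 * a]. Likewise [mnorm p0 = 2 * c], and
   [timelike_nbhd] gives the range from [c] to [4 * c]. *)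
pose e' := Num.min e (a / (k + 1)).
have e'0 : 0 < e' by rewrite lt_min e0 divr_gt0.
have [x0 [U [F [rho [L1 [L2 [[oU Ux] [Ux0 F0 rho0 L10 L20] UF FL [d d0 dS]]]]]]]] :=
  chart_shrink lS Sp0 e'0.
pose F' x : L := if x \in U then F x else 0.
have F'E x : U x -> F' x = F x by move=> Ux'; rewrite /F' mem_set.
pose Q := @halfspace R n `&` cube (x0 - const_mx (rho / 2)) rho.
have QP x : Q x <-> halfspace x /\ `|x - x0| <= rho / 2.
  have E i : (x0 - const_mx (rho / 2)) 0 i = x0 0 i - rho / 2 by rewrite !mxE.
  split=> -[hx xr]; split=> //.
    apply: norm_rV_le => [|i]; first by rewrite divr_ge0// ltW.
    have := xr i; rewrite E !mxE /= in_itv /= ler_norml => /andP[? ?].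
    by apply/andP; split; lra.
  move=> i; have := le_trans (coord_le_norm (x - x0) i) xr.
  rewrite E !mxE /= in_itv /= ler_norml => /andP[? ?].
  by apply/andP; split; lra.
have QU : Q `<=` U.
  move=> x /QP[hx xr]; apply: Ux => //.
  by rewrite (le_lt_trans xr)// ltr_pdivrMr// ltr_pMr// ltr1n.
have Fe x : U x -> `|F x - p0| < e by move=> /UF[_ _]; rewrite lt_min => /andP[].
have bF p : `|p - p0| < e' -> [/\ timelike p, c <= mnorm p <= 4 * c & a <= `|hproj p 0 0| <= 4 * a].
  rewrite lt_min => /andP[pe pa]; have [tp pm hp] := He _ pe; split=> //.
    by have -> : 4 * c = 2 * mnorm p0 by rewrite /c; field.
  have [|_ hq] := hp p0; first by rewrite subrr normr0.
  have hc : `|hproj p 0 0 - hproj p0 0 0| <= a.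
    have E (A B : L) i : (A - B) 0 i = A 0 i - B 0 i by rewrite !mxE.
    rewrite -E; apply: le_trans (coord_le_norm _ _) _; apply: le_trans hq _.
    apply: (@le_trans _ _ ((k + 1) * `|p - p0|)); first by rewrite ler_wpM2r// lerDl.
    by rewrite mulrC -ler_pdivlMr// ltW.
  have a2 : `|hproj p0 0 0| = 2 * a by rewrite /a; field.
  have := lerB_normD (hproj p0 0 0) (hproj p 0 0 - hproj p0 0 0).
  rewrite [X in _ <= `|X|]addrC subrK => h1.
  have := ler_normD (hproj p0 0 0) (hproj p 0 0 - hproj p0 0 0).
  rewrite [X in `|X| <= _]addrC subrK => h2.
  by apply/andP; split; lra.
have F'lip : exists2 l : R, 0 <= l & forall x y, U x -> U y -> `|F' x - F' y| <= l * `|x - y|.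
  by exists L1 => // x y Ux' Uy; rewrite !F'E//; have [] := FL _ _ Ux' Uy.
have F'inj : {in U &, injective F'}.
  move=> x y /set_mem Ux' /set_mem Uy; rewrite !F'E// => E.
  have [_] := FL _ _ Ux' Uy; rewrite E subrr normr0 mulr0 normr_le0 subr_eq0.
  by move/eqP.
have F'S : F' @` U `<=` S by move=> _ [x Ux' <-]; rewrite F'E//; have [] := UF _ Ux'.
exists (F' @` Q).
  exists U, Q, F', a, c; split.
  - split=> //; apply: lipschitz_locally; exact/lipschitz_onP.
  - split=> //.
    + apply: lipschitz_locally; apply/lipschitz_onP.
      exists (k * L1); first by rewrite mulr_ge0.
      move=> x y Ux' Uy; rewrite /= !F'E// -mulrA.
      have [_ _ /(_ (F y) (Fe _ Uy))[_]] := He _ (Fe _ Ux').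
      by move/le_trans; apply; rewrite ler_wpM2l//; have [] := FL _ _ Ux' Uy.
    + move=> x y xU yU /= E; apply: F'inj => //.
      have SF z : z \in U -> S (F' z) by move=> /set_mem Uz; apply: F'S; exists z.
      exact: (achronal_hproj_inj OH SO aS (SF _ xU) (SF _ yU) E).
    + move=> _ [x Ux' <-]; have [tp fp _] := Rplus_coneP OH (SO _ (F'S _ (imageP _ Ux'))).
      exact: hproj_hyperbolic.
  - split; last first.
      move=> y; rewrite /F'; case: ifPn => [/set_mem Uy _|_]; last by rewrite eqxx.
      by have [] := He _ (Fe _ Uy).
    have [l l0 Hl] := F'lip; apply: (lipschitz_within_continuous l0) => x y /QU Ux' /QU Uy.
    exact: Hl.
  - split=> //.
    by rewrite /Q setIC; apply: compact_closedI; [exact: cube_compact|exact: closed_halfspace].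
  split=> // _ [x /QU Ux' <-]; have [tp fp _] := Rplus_coneP OH (SO _ (F'S _ (imageP _ Ux'))).
  rewrite F'E//; have [_ Sx xe] := UF _ Ux'; have [? ? ?] := bF _ xe; split=> //.
  by move: fp; rewrite F'E.
exists d => // q [Sq]; rewrite -ball_normE /= distrC => qd.
have [x Ux' [xq xr]] := dS _ Sq qd; exists x; last by rewrite F'E.
by apply/QP; split; [have [] := UF _ Ux'|exact: ltW].
Qed.
End pieces.

(** Used for the projection and the truncated cone: making the pieces of [S] disjoint makes their
    projections and cones disjoint in the same way, so that area, hyperbolic measure and volume are
    summed over the same pieces. *)
Lemma seqDU_comp (T T' : Type) (f : set T -> set T') (S : set T) (F : nat -> set T) :
  f set0 = set0 -> (forall A B, f (A `|` B) = f A `|` f B) ->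
  (forall A B, A `<=` S -> B `<=` S -> f (A `\` B) = f A `\` f B) ->
  (forall i, F i `<=` S) -> forall i, f (seqDU F i) = seqDU (f \o F) i.
Proof.
move=> f0 fU fD FS i; rewrite /seqDU fD//.
  by congr (_ `\` _); apply: (big_morph f fU f0).
by elim/big_ind: _ => [|A B AS BS|k _]; [exact: sub0set|rewrite subUset|exact: FS].
Qed.

Lemma measure_seqDU d (T : measurableType d) (R : realType)
    (mu : {measure set T -> \bar R}) (F : nat -> set T) :
  (forall i, measurable (F i)) ->
  mu (\bigcup_i F i) = (\sum_(0 <= i <oo) mu (seqDU F i))%E.
Proof.
move=> mF; rewrite seqDU_bigcup_eq measure_bigcup//; last first.
  by move=> i _; apply: measurableD => //; exact: bigsetU_measurable.
by apply: eq_eseriesl => i; rewrite in_setT.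
Qed.

Lemma measurable_seqDU d (T : measurableType d) (F : nat -> set T) i :
  (forall i, measurable (F i)) -> measurable (seqDU F i).
Proof. by move=> mF; apply: measurableD => //; exact: bigsetU_measurable. Qed.

Section area_finite.
Variables (R : realType) (n : nat) (v0 : 'rV[R]_n.+1).
Hypothesis hv0 : timelike v0.
Notation L := 'rV[R]_n.+1.
Notation borel := (borel_rV R n.+1).
Notation hproj := (@hproj R n).
Variables Omega S : set L.
Hypotheses (dO : domain v0 Omega) (SO : S `<=` Rplus_cone Omega)
  (aS : achronal v0 (Rplus_cone Omega) S) (lS : lipschitz_submanifold n S)
  (S0 : S !=set0).

Lemma hypersurface_radial : radial S.
Proof.
have [_ OH _] := dO; split=> [p Sp|p q Sp Sq].
  by have [] := Rplus_coneP OH (SO Sp).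
exact: (achronal_hproj_inj OH SO aS Sp Sq).
Qed.

Lemma area_pieces : exists2 K : nat -> set L,
  (forall i, area_piece v0 S (K i)) & S = \bigcup_i K i.
Proof.
have [K KP SK] := countable_cover S0
  (fun p Sp => area_piece_local dO SO aS lS Sp).
exists K => //; apply/seteqP; split=> // p [i _]; exact: area_piece_sub (KP i) _.
Qed.

(** [S] is a countable union of compact sets, hence so are its projection and both cones. *)
Lemma measurable_cones : measurable (truncated_cone S : set borel) /\
  measurable (truncated_cone (hproj @` S) : set borel).
Proof.
have [St _] := hypersurface_radial; have [K KP SK] := area_pieces.
have Kc i := area_piece_compact (KP i).
have Kt i p : K i p -> timelike p by move=> /(area_piece_sub (KP i))/St.
rewrite SK image_bigcup !truncated_cone_bigcup.
split; apply: bigcup_measurable => i _; apply: measurable_truncated_cone_compact => //.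
exact: compact_hproj (Kt i) (Kc i).
Qed.

Lemma area_lt_pinfty (mu area : {measure set borel -> \bar R}) :
  is_area_measure (hyperbolic_space v0) mu -> is_area_measure S area ->
  (mu (hproj @` S) < +oo)%E -> (volume (truncated_cone S) < +oo)%E ->
  (area S < +oo)%E.
Proof.
move=> hmu ha muS vS; have [St _] := hypersurface_radial; have rS := hypersurface_radial.
have [K KP SK] := area_pieces.
have KS i := area_piece_sub (KP i); have Kc i := area_piece_compact (KP i).
have Kt i p : K i p -> timelike p by move=> /(KS i)/St.
pose D := seqDU K.
have DK i : D i `<=` K i by exact: subDsetl.
have piD i : hproj @` D i = seqDU (fun i => hproj @` K i) i.
  apply: (@seqDU_comp _ _ (fun A => hproj @` A) S) => //.
  - exact: image_set0.
  - by move=> A B; exact: image_setU.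
  - by move=> A B AS BS; exact: hproj_setD rS AS BS.
have CD i : truncated_cone (D i) = seqDU (fun i => truncated_cone (K i)) i.
  apply: (@seqDU_comp _ _ (@truncated_cone R n) S) => //.
  - by apply/seteqP; split=> // w [t [v []]].
  - move=> A B; apply/seteqP; split=> w.
      by move=> [t [v [t0 t1 [Av|Bv] wE]]]; [left|right]; exists t, v.
    by move=> [] [t [v [t0 t1 Av wE]]]; exists t, v; split=> //; [left|right].
  - by move=> A B AS BS; exact: truncated_cone_setD rS AS BS.
have mK i : measurable (K i : set borel) by exact: measurable_compact_rV.
have mpK i : measurable (hproj @` K i : set borel).
  by apply: measurable_compact_rV; exact: compact_hproj (Kt i) (Kc i).
have mCK i : measurable (truncated_cone (K i) : set borel).
  exact: measurable_truncated_cone_compact.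
have mD i : measurable (D i : set borel) by exact: (@measurable_seqDU _ borel).
have mpD i : measurable (hproj @` D i : set borel) by rewrite piD; exact: (@measurable_seqDU _ borel).
have mCD i : measurable (truncated_cone (D i) : set borel).
  by rewrite CD; exact: (@measurable_seqDU _ borel).
have areaE : area S = (\sum_(0 <= i <oo) area (D i))%E by rewrite {1}SK (measure_seqDU area).
have muE : mu (hproj @` S) = (\sum_(0 <= i <oo) mu (hproj @` D i))%E.
  rewrite {1}SK image_bigcup (measure_seqDU mu)//.
  by apply: eq_eseriesr => i _; rewrite piD.
have vE : volume (truncated_cone S) = (\sum_(0 <= i <oo) volume (truncated_cone (D i)))%E.
  have CSE : truncated_cone S = \bigcup_i truncated_cone (K i).
    by rewrite {1}SK truncated_cone_bigcup.
  rewrite CSE; apply: etrans (measure_seqDU (lebesgue_rV R n.+1) mCK) _.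
  by apply: eq_eseriesr => i _; rewrite CD.
have mu0 i : (0 <= mu (hproj @` D i))%E by exact: measure_ge0.
have v00 i : (0 <= volume (truncated_cone (D i)))%E by exact: measure_ge0.
rewrite areaE; apply: (@le_lt_trans _ _ (\sum_(0 <= i <oo) ((4 ^+ n * 10 ^+ n.+1)%:E *
     (mu (hproj @` D i) + volume (truncated_cone (D i)))))%E).
  apply: lee_nneseries => [i _ _|i _]; first exact: measure_ge0.
  exact (area_piece_le hv0 hmu ha (KP i) (DK i) (mD i) (mpD i) (mCD i)).
rewrite nneseriesZl; last by move=> i _; rewrite adde_ge0.
rewrite nneseriesD//; apply: lte_mul_pinfty; rewrite ?lee_fin ?mulr_ge0 ?exprn_ge0//.
by rewrite lte_add_pinfty -?muE -?vE.
Qed.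
End area_finite.

(** * The deficits *)

Lemma excess_bernoulli (R : realType) (n : nat) (e : R) : 0 <= e -> n.+1%:R * e <= 1 ->
  (1 + e) * (1 - n.+1%:R * e) `^ (n.+1%:R^-1) <= 1.
Proof.
move=> e0 me; have e1 : e <= 1 by apply: le_trans me; rewrite ler_peMl// ler1n.
have y0 : 0 <= 1 - n.+1%:R * e by rewrite subr_ge0.
have z0 : 0 <= (1 + e) * (1 - n.+1%:R * e) `^ (n.+1%:R^-1).
  by rewrite mulr_ge0 ?powR_ge0// addr_ge0.
rewrite -(@ler_pXn2r _ n.+1) ?nnegrE// expr1n exprMn -[X in _ * X <= _]powR_mulrn ?powR_ge0//.
rewrite -powRrM mulVf ?pnatr_eq0// powRr1//.
apply: (@le_trans _ _ ((1 + e) ^+ n.+1 * (1 - e) ^+ n.+1)).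
  rewrite ler_wpM2l ?exprn_ge0 ?addr_ge0//.
  by rewrite mulrC mulr_natr; apply: bernoulli; rewrite e0.
rewrite -exprMn (_ : (1 + e) * (1 - e) = 1 - e ^+ 2); last by ring.
have h : e ^+ 2 <= 1 by rewrite exprn_ile1.
by rewrite exprn_ile1// ?subr_ge0// gerBl sqr_ge0.
Qed.

Section deficits.
Local Open Scope ereal_scope.

(** If [A] or [r] is 0, positivity of [V] and [P] makes [dC] and the quotient in the identity [+oo].
    Otherwise finiteness of [B] forces that of [P], which may be infinite when [r = 0], and
    everything takes place in the reals. *)
Lemma deficit_identity (R : realType) (n : nat) (V P A B E dB dC : \bar R) (r : R) :
  0 < V -> V < +oo -> 0 < P -> 0 <= A -> A < +oo -> (0 <= r)%R ->
  B = (r ^+ n.+1)%:E * P -> B <= V ->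
  E = (n.+1%:R^-1)%:E * ((V - B) / V) ->
  dB = n.+1%:R%:E * P `^ (n.+1%:R^-1) * (V `^ (n%:R / n.+1%:R) / A) - 1 ->
  dC = n.+1%:R%:E * (V / (A * r%:E)) - 1 ->
  dC = (1 + dB) / (1 - n.+1%:R%:E * E) `^ (n.+1%:R^-1) - 1 /\
  E + (1 + E) * dB <= dC.
Proof.
move=> V0 Voo P0 A0 Aoo r0 BE BV EE dBE dCE.
have Vfin : V \is a fin_num by rewrite ge0_fin_numE// ltW.
have m0 : (0 < n.+1%:R :> R)%R by rewrite ltr0n.
have mi : (n.+1%:R^-1 != 0 :> R)%R by rewrite invr_eq0 gt_eqF.
have B0 : 0 <= B by rewrite BE mule_ge0 ?lee_fin ?exprn_ge0//; exact: ltW.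
have Bfin : B \is a fin_num by rewrite ge0_fin_numE// (le_lt_trans BV).
have Pp : 0 < P `^ (n.+1%:R^-1) by exact: poweR_gt0.
have Vp : 0 < V `^ (n%:R / n.+1%:R) by exact: poweR_gt0.
pose v := fine V; pose b := fine B.
have vE : V = v%:E by rewrite fineK.
have bE : B = b%:E by rewrite fineK.
have v0 : (0 < v)%R by rewrite -lte_fin -vE.
have b0 : (0 <= b)%R by rewrite -lee_fin -bE.
have bv : (b <= v)%R by rewrite -lee_fin -bE -vE.
pose e : R := (n.+1%:R^-1 * ((v - b) / v))%R.
have eE : E = e%:E by rewrite EE vE bE inver gt_eqF.
have meE : (1 - n.+1%:R * e = b / v)%R by rewrite /e; field; rewrite gt_eqF//= addrC natr1 gt_eqF.
have e0 : (0 <= e)%R by rewrite /e mulr_ge0 ?divr_ge0 ?subr_ge0 ?invr_ge0// ltW.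
have yE : 1 - n.+1%:R%:E * E = (b / v)%:E by rewrite eE -EFinM -EFinB meE.
have y0 : (0 <= b / v)%R by rewrite divr_ge0// ltW.
have yi : 0 < ((b / v)%:E `^ (n.+1%:R^-1))^-1.
  by rewrite poweR_EFin inver; case: ifP => // h; rewrite lte_fin invr_gt0 lt_neqAle eq_sym h powR_ge0.
have trivial_case : dC = +oo -> n.+1%:R%:E * P `^ (n.+1%:R^-1) * (V `^ (n%:R / n.+1%:R) / A) /
     (b / v)%:E `^ (n.+1%:R^-1) = +oo ->
  dC = (1 + dB) / (1 - n.+1%:R%:E * E) `^ (n.+1%:R^-1) - 1 /\ E + (1 + E) * dB <= dC.
  move=> dCoo xoo; split; last by rewrite dCoo leey.
  by rewrite yE dBE [X in X / _]addeC subeK// xoo dCoo.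
have [A00|An0] := eqVneq A 0.
  apply: trivial_case.
    by rewrite dCE A00 mul0e inve0 gt0_muley// gt0_muley// lte_fin.
  rewrite A00 inve0 gt0_muley// gt0_muley ?mule_gt0 ?lte_fin//.
  by rewrite gt0_mulye.
have Ap : 0 < A by rewrite lt_neqAle eq_sym An0.
have Afin : A \is a fin_num by rewrite ge0_fin_numE.
pose a := fine A; have aE : A = a%:E by rewrite fineK.
have a0 : (0 < a)%R by rewrite -lte_fin -aE.
have ai : 0 < A^-1 by rewrite aE inver gt_eqF// lte_fin invr_gt0.
have [r00|rn0] := eqVneq r 0%R.
  apply: trivial_case.
    by rewrite dCE r00 mule0 inve0 gt0_muley// gt0_muley// lte_fin.
  have -> : b = 0%R by apply: EFin_inj; rewrite -bE BE r00 expr0n mul0e.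
  rewrite mul0r poweR0r// inve0 gt0_muley// !mule_gt0// lte_fin//.
have rp : (0 < r)%R by rewrite lt_neqAle eq_sym rn0.
have rmp : (0 < r ^+ n.+1)%R by rewrite exprn_gt0.
have Pfin : P \is a fin_num.
  rewrite ge0_fin_numE ?ltW// ltNge; apply/negP; rewrite leye_eq => /eqP Poo.
  by move: Bfin; rewrite BE Poo gt0_muley// lte_fin.
pose p := fine P; have pE : P = p%:E by rewrite fineK.
have p0 : (0 < p)%R by rewrite -lte_fin -pE.
have bp : (b = r ^+ n.+1 * p)%R by apply: EFin_inj; rewrite -bE BE pE EFinM.
pose x : R := (n.+1%:R * p `^ (n.+1%:R^-1) * (v `^ (n%:R / n.+1%:R) / a))%R.
have xE : dB = (x - 1)%:E.
  by rewrite dBE pE vE aE !poweR_EFin inver gt_eqF// -!EFinM.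
have x0 : (0 <= x)%R by rewrite /x !mulr_ge0 ?powR_ge0// ?invr_ge0 ltW.
pose y : R := ((b / v) `^ (n.+1%:R^-1))%R.
have yp : (0 < y)%R by rewrite powR_gt0// divr_gt0// bp mulr_gt0.
have key : (n.+1%:R * (v / (a * r)) = x / y)%R.
  have pp : (0 < p `^ (n.+1%:R^-1))%R by exact: powR_gt0.
  have vp : (0 < v `^ (n.+1%:R^-1))%R by exact: powR_gt0.
  (* With [b = r ^+ n.+1 * p] the root splits off [r]; the roots of [p] cancel in [x / y], and the
     two powers of [v] combine to [v]. *)
  have -> : y = (r * p `^ (n.+1%:R^-1) / v `^ (n.+1%:R^-1))%R.
    rewrite /y bp powRM ?mulr_ge0 ?invr_ge0 ?exprn_ge0 ?(ltW p0) ?(ltW v0)//.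
    rewrite powRM ?exprn_ge0 ?(ltW p0)//.
    rewrite -[X in (X * _ * _ = _)%R](_ : r = _); last first.
      by rewrite -[X in (X `^ _)%R]powR_mulrn// -powRrM mulfV ?gt_eqF// powRr1.
    congr (_ * _)%R.
    rewrite -[in LHS]powR_inv1 ?(ltW v0)// -powRrM mulN1r.
    by rewrite powRN.
  have vv : (v = v `^ (n%:R / n.+1%:R) * v `^ (n.+1%:R^-1))%R.
    rewrite -powRD; last by rewrite (gt_eqF v0) implybT.
    have -> : (n%:R / n.+1%:R + n.+1%:R^-1 = 1 :> R)%R.
      by field; rewrite addrC natr1 gt_eqF.
    by rewrite powRr1// ltW.
  rewrite {1}vv /x; move: (v `^ _)%R (v `^ _)%R (p `^ _)%R pp vp => s t q q0 t0.
  by field; rewrite !gt_eqF.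
have dE : dC = (x / y - 1)%:E.
  by rewrite dCE vE aE -EFinM inver gt_eqF ?mulr_gt0// -!EFinM key.
rewrite yE xE dE eE poweR_EFin -/y inver gt_eqF//; split.
  by rewrite (_ : 1 + (x - 1)%:E = x%:E)// -[1]/(1%R%:E) -EFinD addrC subrK.
rewrite (_ : 1 + e%:E = (1 + e)%:E)// -EFinM -EFinD lee_fin.
have := @excess_bernoulli R n e e0; rewrite meE -/y => /(_ _) ey.
have {}ey : ((1 + e) * y <= 1)%R.
  by apply: ey; rewrite -subr_ge0 meE.
have : ((1 + e) * x <= x / y)%R.
  by rewrite ler_pdivlMr// mulrAC ler_piMl.
by move=> h; lra.
Qed.
End deficits.

(** * Comparison of the cones over S and over its projection *)

Section truncated_cones.
Variables (R : realType) (n : nat).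
Notation L := 'rV[R]_n.+1.
Notation borel := (borel_rV R n.+1).
Notation hproj := (@hproj R n).

Lemma truncated_cone_sub_dilations (S : set L) : (forall p, S p -> timelike p) ->
  truncated_cone S `<=` \bigcup_k dilation k.+1%:R (truncated_cone (hproj @` S)).
Proof.
move=> St w [t [v [t0 t1 Sv ->]]]; have tv := St _ Sv; have u0 := mnorm_gt0 tv.
exists (Num.truncn (mnorm v)) => //; set k := Num.truncn _.
have uk : mnorm v <= k.+1%:R by apply/ltW/Num.Theory.truncnS_gt.
have k0 : 0 < k.+1%:R :> R by rewrite ltr0n.
exists (k.+1%:R^-1 * (t * mnorm v)), (hproj v); split.
- by rewrite !mulr_gt0 ?invr_gt0.
- by rewrite ler_pdivrMl// mulr1 (le_trans _ uk)// ler_piMl// ltW.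
- by exists v.
- by rewrite {1}(mnorm_hproj tv) !scalerA mulrA.
Qed.

(** As [mnorm] may be unbounded on [S], no single dilation of C(pi(S)) need contain C(S); countably
    many do, and they would all be null with C(pi(S)). *)
Lemma volume_truncated_cone_hproj_gt0 (S : set L) : (forall p, S p -> timelike p) ->
  measurable (truncated_cone S : set borel) ->
  measurable (truncated_cone (hproj @` S) : set borel) ->
  (0 < volume (truncated_cone S))%E -> (0 < volume (truncated_cone (hproj @` S)))%E.
Proof.
move=> St mC mP V0; rewrite lt_neqAle measure_ge0 andbT eq_sym.
apply: contraTneq V0 => P0; rewrite -leNgt.
pose F k : set borel := dilation k.+1%:R (truncated_cone (hproj @` S)).
have mF k : measurable (F k) by apply: measurable_dilation => //; rewrite pnatr_eq0.
apply: le_trans (@measure_sigma_subadditive _ _ _ (lebesgue_rV R n.+1) _ F mF mC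
  (truncated_cone_sub_dilations St)) _.
rewrite eseries0// => k _ _.
by apply: etrans (volume_dilation _ mP) _; rewrite ?ltr0n// P0 mule0.
Qed.

Lemma inf_mnorm_ge0 (S : set L) : S !=set0 -> 0 <= inf_mnorm S.
Proof.
move=> [p Sp]; apply: lb_le_inf; first by exists (mnorm p), p.
by move=> _ [q _ <-]; exact: mnorm_ge0.
Qed.

Lemma inf_mnorm_le (S : set L) p : S p -> inf_mnorm S <= mnorm p.
Proof.
move=> Sp; apply: ge_inf; last by exists p.
by exists 0 => _ [q _ <-]; exact: mnorm_ge0.
Qed.

Lemma cone_ball_inf_sub (S : set L) : (forall p, S p -> timelike p) ->
  cone_ball (inf_mnorm S) S `<=` truncated_cone S.
Proof.
move=> St w [[t [v [t0 Sv ->]]] wr]; exists t, v; split=> //.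
move: wr; rewrite mnormZ gtr0_norm// => /lt_le_trans/(_ (inf_mnorm_le Sv)).
by rewrite gtr_pMl ?mnorm_gt0 ?St// => /ltW.
Qed.

Lemma volume_cone_ball_inf (S : set L) : S !=set0 -> (forall p, S p -> timelike p) ->
  measurable (truncated_cone S : set borel) ->
  measurable (truncated_cone (hproj @` S) : set borel) ->
  (volume (truncated_cone S) < +oo)%E ->
  volume (cone_ball (inf_mnorm S) S) =
    ((inf_mnorm S ^+ n.+1)%:E * volume (truncated_cone (hproj @` S)))%E /\
  (volume (cone_ball (inf_mnorm S) S) <= volume (truncated_cone S))%E.
Proof.
move=> S0 St mC mP Voo; have [r0|r0] := eqVneq (inf_mnorm S) 0.
  (* Here both sides vanish, the right one by the convention [0 * +oo = 0] even if C(pi(S)) has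
     infinite volume. *)
  have -> : cone_ball (inf_mnorm S) S = set0.
    by apply/seteqP; split=> // w [_]; rewrite r0 ltNge mnorm_ge0.
  by rewrite r0 expr0n mul0e /volume measure0; split=> //; exact: measure_ge0.
have rp : 0 < inf_mnorm S by rewrite lt_neqAle eq_sym r0 inf_mnorm_ge0.
have [mB BE] := volume_cone_ball rp St mP.
have BV : (volume (cone_ball (inf_mnorm S) S) <= volume (truncated_cone S))%E.
  by apply: le_measure; rewrite ?inE//; exact: cone_ball_inf_sub.
by split=> //; apply: BE; exact: le_lt_trans BV Voo.
Qed.
End truncated_cones.

Local Open Scope ereal_scope.

Theorem proposition1p2 (R : realType) (n : nat)
    (v0 : 'rV[R]_n.+1) (hv0 : timelike v0)
    (mu : {measure set (borel_rV R n.+1) -> \bar R})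
    (hmu : is_area_measure (hyperbolic_space v0) mu)
    (M : set 'rV[R]_n.+1) (hM : conical_spacetime v0 M)
    (S : set 'rV[R]_n.+1)
    (hS : lipschitz_hypersurface M S) (achS : achronal v0 M S)
    (area : {measure set (borel_rV R n.+1) -> \bar R})
    (harea : is_area_measure S area)
    (hV : volume (truncated_cone S) < +oo)
    (hmuS : mu (@hproj R n @` S) < +oo) :
  delta_CM area S =
    (1 + delta_BE area S) /
      (1 - n.+1%:R%:E * volume_excess S) `^ (n.+1%:R^-1) - 1 /\
  delta_CM area S >=
    volume_excess S + (1 + volume_excess S) * delta_BE area S.
Proof.
have [W dW ME] := hM; have [S0 SM lS] := hS; rewrite ME in SM achS.
have [St _] := hypersurface_radial dW SM achS.
have [mC mP] := measurable_cones dW SM achS lS S0.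
have V0 := truncated_cone_volume_gt0 hv0 dW SM achS S0 lS mC.
have P0 := volume_truncated_cone_hproj_gt0 St mC mP V0.
have [BE BV] := volume_cone_ball_inf S0 St mC mP hV.
have Aoo := area_lt_pinfty hv0 dW SM achS lS S0 hmu harea hmuS hV.
exact: (deficit_identity V0 hV P0 (measure_ge0 area S) Aoo (inf_mnorm_ge0 S0) BE BV
  erefl erefl erefl).
Qed.
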